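(* \[\sup\big\{\|\log(\exp(A)\exp(B))\|_2:\ A,B\in M_2(\mathbb R),\ \|A\|_2\le\tfrac\pi2,\ \|B\|_2\le\tfrac\pi2,\ (A,B)\notin\{(\tfrac\pi2\tilde I,\tfrac\pi2\tilde I),(-\tfrac\pi2\tilde I,-\tfrac\pi2\tilde I)\}\big\}=\frac\pi2e^{\pi/2},\] where all logarithms occurring are well defined.
   Context: $\tilde I=\begin{pmatrix}0&-1\\1&0\end{pmatrix}$; $\|\cdot\|_2$ is the operator norm; $\log$ the principal matrix logarithm. *)

(* Defs.v *)
From HB Require Import structures.
From mathcomp Require Import all_boot all_order all_algebra.
From mathcomp Require Import all_classical all_reals all_analysis.
From mathcomp Require Import complex.
Set Implicit Arguments. Unset Strict Implicit. Unset Printing Implicit Defensive.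
Import Order.TTheory GRing.Theory Num.Theory.
Import numFieldNormedType.Exports.
Local Open Scope classical_set_scope.
Local Open Scope ring_scope.

Section Defs.
Variable R : realType.

Definition enorm (v : 'cV[R]_2) : R := Num.sqrt (\sum_(i < 2) v i 0 ^+ 2).

Definition opnorm (A : 'M[R]_2) : R :=
  sup [set enorm (A *m v) | v in [set v : 'cV[R]_2 | enorm v <= 1]].

Definition expm (A : 'M[R]_2) : 'M[R]_2 :=
  lim ((fun n : nat => \sum_(k < n) (k`!%:R)^-1 *: A ^+ k) @ \oo).

Definition eigenvalueC (X : 'M[R]_2) (z : R[i]) : Prop :=
  root (map_poly (fun x : R => x%:C%C) (char_poly X)) z.

Definition is_principal_log (M X : 'M[R]_2) : Prop :=
  expm X = M /\ forall z : R[i], eigenvalueC X z -> - pi < complex.Im z < pi.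

Definition Itil : 'M[R]_2 :=
  \matrix_(i < 2, j < 2)
    (if (i == 0 :> nat) && (j == 1 :> nat) then -1
     else if (i == 1 :> nat) && (j == 0 :> nat) then 1 else 0).

End Defs.

(* Main.v *)
Require Import Defs.
From Stdlib Require Import ZArith.
From HB Require Import structures.
From mathcomp Require Import all_boot all_order all_algebra.
From mathcomp Require Import all_classical all_reals all_analysis.
From mathcomp Require Import complex.
From mathcomp Require Import ssrZ zify ring lra.
Import Order.TTheory GRing.Theory Num.Theory.
Import numFieldNormedType.Exports.
Local Open Scope classical_set_scope.
Local Open Scope ring_scope.

(* Identify M_2(R) with the real-linear maps z |-> p z + q conj z of the complex plane: the
   operator norm is |p| + |q|, and a traceless J satisfies J^2 = - D, so exp and log are given
   by the Stumpff functions of D = (Im p)^2 - |q|^2.  With T = pi/2 and K = T e^T: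

   A unimodular S = exp(A), |A| <= T, moves every direction z by the argument of a point of
   the circle of centre p and radius |q| = sinh r, and this circle lies in a sector
   |arg| <= T - h with h > 0.  Sectors add under products, so for M = exp(A) exp(B) with
   centre cosh r e^{i th} one gets th + atan (sinh r) + h1 + h2 <= pi.  Among the A with
   given r the smallest h is H(r), attained on the family b = T (1 - y), s = T y; as a function
   of r it is subadditive, and it lies above its chord.  Hence r <= r1 + r2 reduces the product
   to one matrix: for r <= T to the family itself, beyond T to the chord; in both cases
   the resulting point stays inside the region where the principal logarithm has norm <= K.
   Shrinking A by a factor l (which is what a trace costs) increases h by at least
   (37/100) T (1 - l), and this pays for the trace of the logarithm.
   The one-variable inequalities behind these steps are certified by interval arithmetic.
   The value K is attained at A = T Itil, B = diag (T, -T). *)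

(** * Verified interval arithmetic *)

(** The bound is attained at the extremal pair, so no estimate may lose anything there. With
    [A = T Itil] the first factor is a quarter turn, for which [h = r = 0]; subadditivity of [H]
    says that putting the whole stretching into the other factor is the worst case, and this is what
    the reduction to one matrix means. A member of the family has [r <= T], whereas a product may
    reach [2 T]; hence the second regime, in which the level curve of norm [K] is compared with the
    prolonged chord of [H]. Level curve and chord meet in the extremal product. Interval arithmetic
    cannot decide an inequality that is tight somewhere. Each tight statement is therefore reduced
    to the sign of a derivative, with exact values at the end point, and only strict inequalities on
    closed boxes are certified. At the other end of the family, [y = 0], the product tends to -1,
    the product of an excluded pair: [cvX] and [cvU] both vanish, and that end is treated separately
    through the ratio of their derivatives. *)

(* A term over an abstract [arith] is read both in the reals and in intervals. *)
Record arith := Arith {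
  acar :> Type;
  aadd : acar -> acar -> acar;
  amul : acar -> acar -> acar;
  aopp : acar -> acar;
  acst : Z -> positive -> acar }.

Delimit Scope Z_scope with coqZ.
Declare Scope arith_scope.
Delimit Scope arith_scope with A.
Notation "x + y" := (aadd _ x y) : arith_scope.
Notation "x * y" := (amul _ x y) : arith_scope.
Notation "- x" := (aopp _ x) : arith_scope.
Notation "x - y" := (aadd _ x (aopp _ y)) : arith_scope.
Notation "p '/' q" := (acst _ p%coqZ q%positive) : arith_scope.

Section RealArith.
Context {R : realFieldType}.

Fixpoint pos_real (p : positive) : R :=
  match p with
  | xH => 1
  | xO p => 2 * pos_real p
  | xI p => 1 + 2 * pos_real p
  end.

Definition Z_real (z : Z) : R :=
  match z with
  | Z0 => 0
  | Zpos p => pos_real p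
  | Zneg p => - pos_real p
  end.

Definition real_arith : arith :=
  Arith R +%R *%R -%R (fun p q => Z_real p / pos_real q).

Lemma pos_realE (p : positive) : pos_real p = (Pos.to_nat p)%:R.
Proof.
elim: p => [p IH|p IH|] //=; rewrite IH.
  by rewrite Pos2Nat.inj_xI -[RHS]natr1 addrC -natrM.
by rewrite Pos2Nat.inj_xO -natrM.
Qed.

Lemma pos_real_gt0 (p : positive) : 0 < pos_real p.
Proof. by rewrite pos_realE ltr0n; lia. Qed.

Lemma Z_realE (z : Z) : Z_real z = (int_of_Z z)%:~R.
Proof.
case: z => [|p|p] //=; rewrite pos_realE // NegzE prednK ?mulrNz //; lia.
Qed.

Lemma Z_realD (x y : Z) : Z_real (Z.add x y) = Z_real x + Z_real y.
Proof. rewrite !Z_realE -intrD; congr _%:~R; lia. Qed.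

Lemma Z_realM (x y : Z) : Z_real (Z.mul x y) = Z_real x * Z_real y.
Proof. rewrite !Z_realE -intrM; congr _%:~R; lia. Qed.

Lemma Z_realN (x : Z) : Z_real (Z.opp x) = - Z_real x.
Proof. rewrite !Z_realE -mulrNz; congr _%:~R; lia. Qed.

Lemma Z_real_le (x y : Z) : Z.le x y -> Z_real x <= Z_real y.
Proof. rewrite !Z_realE ler_int; lia. Qed.

Lemma Z_real_lt (x y : Z) : Z.lt x y -> Z_real x < Z_real y.
Proof. rewrite !Z_realE ltr_int; lia. Qed.

End RealArith.

(* The pair [(a, b)] stands for the interval [a / 2^30, b / 2^30]. *)
Definition itvl := (Z * Z)%type.
Definition fscale : positive := 1073741824.

Definition floorZ (z : Z) : Z := Z.div z (Zpos fscale).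
Definition ceilZ (z : Z) : Z := Z.opp (floorZ (Z.opp z)).

Definition itvl_mul (x y : itvl) : itvl :=
  let p1 := Z.mul x.1 y.1 in let p2 := Z.mul x.1 y.2 in
  let p3 := Z.mul x.2 y.1 in let p4 := Z.mul x.2 y.2 in
  (floorZ (Z.min (Z.min p1 p2) (Z.min p3 p4)),
   ceilZ (Z.max (Z.max p1 p2) (Z.max p3 p4))).

Definition itvl_arith : arith :=
  Arith itvl (fun x y => (Z.add x.1 y.1, Z.add x.2 y.2)) itvl_mul
    (fun x => (Z.opp x.2, Z.opp x.1))
    (fun p q => (Z.div (Z.mul p (Zpos fscale)) (Zpos q),
       Z.opp (Z.div (Z.opp (Z.mul p (Zpos fscale))) (Zpos q)))).

(** Lower end of one enclosure and upper end of the other, so that the rational interval is rounded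
    outward. *)
Definition itvl_of (p : Z) (q : positive) (p' : Z) (q' : positive) : itvl :=
  ((acst itvl_arith p q).1, (acst itvl_arith p' q').2).

Local Arguments Z.opp : simpl never.
Local Arguments Z.mul : simpl never.
Local Arguments Z.add : simpl never.

Section Soundness.
Context {R : realFieldType}.
Local Notation S := (@pos_real R fscale).

Definition inI (X : itvl) (x : R) : Prop :=
  Z_real X.1 <= x * S /\ x * S <= Z_real X.2.

Lemma floorZ_le (z : Z) : Z_real (floorZ z) * S <= Z_real z.
Proof.
have -> : S = Z_real (Zpos fscale) by [].
rewrite -Z_realM; apply: Z_real_le; rewrite Z.mul_comm.
by apply: Z.mul_div_le.
Qed.

Lemma ceilZ_ge (z : Z) : Z_real z <= Z_real (ceilZ z) * S.
Proof.
rewrite /ceilZ Z_realN mulNr lerNr -Z_realN; exact: floorZ_le.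
Qed.

Lemma Z_real_min (x y : Z) (z : R) :
  Z_real x <= z \/ Z_real y <= z -> Z_real (Z.min x y) <= z.
Proof.
by case=> h; apply: le_trans h; apply: Z_real_le; lia.
Qed.

Lemma Z_real_max (x y : Z) (z : R) :
  z <= Z_real x \/ z <= Z_real y -> z <= Z_real (Z.max x y).
Proof.
by case=> h; apply: (le_trans h); apply: Z_real_le; lia.
Qed.

(** A product is affine in each factor: the sign of [y] selects an end for [x], and the sign of that
    end then selects one for [y]. *)
Lemma mul_corner_le (a b c d x y : R) : a <= x -> x <= b -> c <= y -> y <= d ->
  [\/ a * c <= x * y, a * d <= x * y, b * c <= x * y | b * d <= x * y].
Proof.
move=> ax xb cy yd; case: (leP 0 y) => y0.
- case: (leP 0 a) => a0; [apply: Or41 | apply: Or42]; nra.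
- case: (leP 0 b) => b0; [apply: Or43 | apply: Or44]; nra.
Qed.

Lemma mul_corner_ge (a b c d x y : R) : a <= x -> x <= b -> c <= y -> y <= d ->
  [\/ x * y <= a * c, x * y <= a * d, x * y <= b * c | x * y <= b * d].
Proof.
move=> ax xb cy yd; case: (leP 0 y) => y0.
- case: (leP 0 b) => b0; [apply: Or44 | apply: Or43]; nra.
- case: (leP 0 a) => a0; [apply: Or42 | apply: Or41]; nra.
Qed.

Lemma inI_add (X Y : itvl_arith) (x y : R) : inI X x -> inI Y y ->
  inI (X + Y)%A ((x : real_arith) + y)%A.
Proof.
rewrite /inI /= => -[h1 h2] [h3 h4]; rewrite !Z_realD mulrDl; split; lra.
Qed.

Lemma inI_opp (X : itvl_arith) (x : R) : inI X x -> inI (- X)%A (- (x : real_arith))%A.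
Proof.
rewrite /inI /= => -[h1 h2]; rewrite !Z_realN mulNr; split; lra.
Qed.

Lemma inI_mul (X Y : itvl_arith) (x y : R) : inI X x -> inI Y y ->
  inI (X * Y)%A ((x : real_arith) * y)%A.
Proof.
have S0 : 0 < S := pos_real_gt0 _.
rewrite /inI /= => -[h1 h2] [h3 h4]; split.
- rewrite -(ler_pM2r S0); apply: (le_trans (floorZ_le _)).
  have -> : x * y * S * S = (x * S) * (y * S) by ring.
  case: (mul_corner_le _ _ _ _ _ _ h1 h2 h3 h4) => h; rewrite -Z_realM in h.
  + by apply: Z_real_min; left; apply: Z_real_min; left.
  + by apply: Z_real_min; left; apply: Z_real_min; right.
  + by apply: Z_real_min; right; apply: Z_real_min; left.
  + by apply: Z_real_min; right; apply: Z_real_min; right.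
- rewrite -(ler_pM2r S0); apply: (le_trans _ (ceilZ_ge _)).
  have -> : x * y * S * S = (x * S) * (y * S) by ring.
  case: (mul_corner_ge _ _ _ _ _ _ h1 h2 h3 h4) => h; rewrite -Z_realM in h.
  + by apply: Z_real_max; left; apply: Z_real_max; left.
  + by apply: Z_real_max; left; apply: Z_real_max; right.
  + by apply: Z_real_max; right; apply: Z_real_max; left.
  + by apply: Z_real_max; right; apply: Z_real_max; right.
Qed.

Lemma inI_cst (p : Z) (q : positive) : inI (acst itvl_arith p q) (acst (@real_arith R) p q).
Proof.
have q0 : 0 < @pos_real R q := pos_real_gt0 _.
change (Z_real (Z.div (Z.mul p (Zpos fscale)) (Zpos q)) <= Z_real p / pos_real q * S /\
  Z_real p / pos_real q * S <= @Z_real R (Z.opp (Z.div (Z.opp (Z.mul p (Zpos fscale))) (Zpos q)))).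
rewrite mulrAC ler_pdivlMr // ler_pdivrMr //.
change S with (@Z_real R (Zpos fscale)); change (@pos_real R q) with (@Z_real R (Zpos q)).
rewrite -!Z_realM; split; apply: Z_real_le.
  by rewrite Z.mul_comm; apply: Z.mul_div_le.
have := Z.mul_div_le (Z.opp (Z.mul p (Zpos fscale))) (Zpos q) (Pos2Z.is_pos q).
by move: (Z.div _ _) => z; move: (Z.mul p _) => pf h; lia.
Qed.

Lemma inI_itvl (p : Z) (q : positive) (p' : Z) (q' : positive) (x : R) :
  Z_real p / pos_real q <= x -> x <= Z_real p' / pos_real q' ->
  inI (itvl_of p q p' q') x.
Proof.
have S0 : 0 < S := pos_real_gt0 _.
move=> h1 h2; split; rewrite [X in Z_real X]/=.
- by apply: (le_trans (proj1 (inI_cst p q))); rewrite ler_pM2r.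
- by apply: (le_trans _ (proj2 (inI_cst p' q'))); rewrite ler_pM2r.
Qed.

(* Branch and bound: a box is bisected along its longer side until the interval value is positive. *)
Fixpoint pos_on (fuel : nat) (g : itvl -> itvl -> itvl) (X Y : itvl) : bool :=
  if Z.ltb 0 (g X Y).1 then true else
  match fuel with
  | O => false
  | fuel.+1 =>
    if Z.leb (Z.sub Y.2 Y.1) (Z.sub X.2 X.1) then
      let m := Z.div2 (Z.add X.1 X.2) in
      if pos_on fuel g (X.1, m) Y then pos_on fuel g (m, X.2) Y else false
    else
      let m := Z.div2 (Z.add Y.1 Y.2) in
      if pos_on fuel g X (Y.1, m) then pos_on fuel g X (m, Y.2) else false
  end.

(** The two halves cover the box whatever the integer midpoint is, so its rounding is harmless;
    exhausted fuel answers [false], which costs no soundness. *)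
Lemma pos_onP (fuel : nat) (g : itvl -> itvl -> itvl) (f : R -> R -> R) (X Y : itvl) (x y : R) :
  (forall X Y x y, inI X x -> inI Y y -> inI (g X Y) (f x y)) ->
  pos_on fuel g X Y -> inI X x -> inI Y y -> 0 < f x y.
Proof.
have S0 : 0 < S := pos_real_gt0 _.
move=> gf.
have base X' Y' : Z.ltb 0 (g X' Y').1 -> inI X' x -> inI Y' y -> 0 < f x y.
  move=> h0 hX hY; have [h _] := gf _ _ _ _ hX hY; rewrite -(pmulr_lgt0 _ S0).
  by apply: lt_le_trans h; apply: (Z_real_lt 0); lia.
elim: fuel X Y => [|n IH] X Y /=; case: ifP => [h0 _ hX hY|_ //]; try exact: base h0 _ _.
move=> h hX hY; have [hX1 hX2] := hX; have [hY1 hY2] := hY.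
move: h; case: ifP => _; case: ifP => // l r.
- case: (leP (x * S) (Z_real (Z.div2 (Z.add X.1 X.2)))) => hm.
  + exact: IH l _ hY.
  + by apply: IH r _ hY; split => //=; exact: ltW.
- case: (leP (y * S) (Z_real (Z.div2 (Z.add Y.1 Y.2)))) => hm.
  + exact: IH l hX _.
  + by apply: IH r hX _; split => //=; exact: ltW.
Qed.

End Soundness.

Ltac inI_tac :=
  repeat match goal with
  | |- inI (acst _ _ _) _ => apply: inI_cst
  | |- inI (aadd _ _ _) _ => apply: inI_add
  | |- inI (aopp _ _) _ => apply: inI_opp
  | |- inI (amul _ _ _) _ => apply: inI_mul
  | |- _ => assumption
  end.

(** * Exponential generating functions and Stumpff functions *)

Section Egf.
Context {R : realType}.
Implicit Types (p q : nat -> R) (x M C : R).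

(** With the factorials divided out, differentiation is the shift of the coefficients [p], and a
    bound [C * M ^ n] on them makes the series converge everywhere. *)
Definition egf p x : R := limn (pseries (fun n => p n / n`!%:R) x).

Lemma is_cvg_egf p C M x : (forall n, `|p n| <= C * M ^+ n) ->
  cvgn (pseries (fun n => p n / n`!%:R) x).
Proof.
move=> pM; apply: normed_cvg.
have C0 : 0 <= C by have := pM 0%N; rewrite expr0 mulr1; apply: le_trans.
apply: (@series_le_cvg _ _ (C *: exp_coeff (`|M| * `|x|))) => [n|n|n|].
- exact: normr_ge0.
- by rewrite /= /GRing.scale /= mulr_ge0 // divr_ge0 ?exprn_ge0 ?mulr_ge0.
- change (`|p n / n`!%:R * x ^+ n| <= C * ((`|M| * `|x|) ^+ n / n`!%:R)).
  rewrite !normrM normrX normfV (@ger0_norm _ n`!%:R) ?ler0n //.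
  rewrite [X in _ <= X](_ : _ = (C * `|M| ^+ n) / n`!%:R * `|x| ^+ n); last first.
    by rewrite exprMn; ring.
  rewrite ler_wpM2r ?exprn_ge0 // ler_wpM2r ?invr_ge0 ?ler0n //.
  apply: (le_trans (pM n)); rewrite ler_wpM2l // -normrX; exact: ler_norm.
- exact/is_cvg_seriesZ/is_cvg_series_exp_coeff.
Qed.

Lemma is_derive_egf p C M x : (forall n, `|p n| <= C * M ^+ n) ->
  is_derive x 1 (egf p) (egf (fun n => p n.+1) x).
Proof.
move=> pM.
have diffsE q : pseries_diffs (fun n => q n / n`!%:R) = fun n => q n.+1 / n`!%:R.
  apply/funext => n; rewrite /pseries_diffs factS natrM invfM.
  by rewrite mulrCA mulVKf // pnatr_eq0.
have shiftM q C' : (forall n, `|q n| <= C' * M ^+ n) ->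
    forall n, `|q n.+1| <= (C' * M) * M ^+ n.
  by move=> qM n; rewrite -mulrA -exprS.
have c1 := shiftM _ _ pM; have c2 := shiftM _ _ c1.
rewrite /egf -diffsE; apply: (@pseries_snd_diffs _ _ (`|x| + 1)).
- exact: is_cvg_egf pM.
- by rewrite diffsE; apply: is_cvg_egf c1.
- by rewrite diffsE (diffsE (fun n => p n.+1)); apply: is_cvg_egf c2.
- by rewrite [ltRHS]ger0_norm ?addr_ge0 // ltrDl.
Qed.

Lemma egf_lin p q C M C' M' (a b : R) x :
  (forall n, `|p n| <= C * M ^+ n) -> (forall n, `|q n| <= C' * M' ^+ n) ->
  egf (fun n => a * p n + b * q n) x = a * egf p x + b * egf q x.
Proof.
move=> pM qM.
have cp := is_cvg_egf _ _ _ x pM; have cq := is_cvg_egf _ _ _ x qM.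
rewrite /egf /pseries.
rewrite (_ : (fun i => _ * x ^+ i) = (a *: (fun i => p i / i`!%:R * x ^+ i)) +
    (b *: (fun i => q i / i`!%:R * x ^+ i))); last first.
  by apply/funext => n; rewrite !fctE /GRing.scale /=; ring.
rewrite lim_seriesD; [|exact: is_cvg_seriesZ|exact: is_cvg_seriesZ].
by rewrite !lim_seriesZ.
Qed.

Lemma egf0 p : egf p 0 = p 0%N.
Proof.
rewrite /egf; apply: lim_near_cst => //; near=> m.
rewrite -[m]prednK; last by near: m.
rewrite /pseries seriesEnat /= big_nat_recl //= big1 ?addr0 => [|i _].
  by rewrite expr0 mulr1 fact0 divr1.
by rewrite exprS mul0r mulr0.
Unshelve. all: by end_near. Qed.

(* The Stumpff function [c_k]: [stumpff 0 D = cos (sqrt D)] and [stumpff 1 D = sin (sqrt D) / sqrt D],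
   extended to [D <= 0] by the hyperbolic functions. *)
Definition stumpff_num (k n : nat) : R := (-1) ^+ n * n`!%:R / (2 * n + k)`!%:R.
Definition stumpff (k : nat) : R -> R := egf (stumpff_num k).

Lemma stumpff_num_le k n : `|stumpff_num k n| <= 1 * 1 ^+ n.
Proof.
rewrite expr1n mulr1 /stumpff_num !normrM normrX normrN1 expr1n mul1r normfV.
rewrite !ger0_norm ?ler0n // ler_pdivrMr ?ltr0n ?fact_gt0 // mul1r ler_nat.
by apply: leq_fact; lia.
Qed.

Lemma stumpffE (k : nat) (D : R) : stumpff k D = k`!%:R^-1 - D * stumpff k.+2 D.
Proof.
have fE : pseries (fun n => stumpff_num k n / n`!%:R) D =
  fun n => \sum_(0 <= i < n) (-1) ^+ i / (2 * i + k)`!%:R * D ^+ i.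
  apply/funext => n; rewrite /pseries seriesEnat; apply: eq_bigr => i _.
  rewrite /stumpff_num; congr (_ * _).
  by rewrite [LHS]mulrAC mulfK // pnatr_eq0 -lt0n fact_gt0.
have c0 := is_cvg_egf _ _ _ D (stumpff_num_le k).
have c2 := is_cvg_egf _ _ _ D (stumpff_num_le k.+2).
rewrite /stumpff /egf; apply: cvg_lim => //.
rewrite -(cvg_shiftS (pseries _ _)).
have -> : [sequence pseries (fun n => stumpff_num k n / n`!%:R) D n.+1]_n =
  (fun=> k`!%:R^-1) - (D *: pseries (fun n => stumpff_num k.+2 n / n`!%:R) D).
  apply/funext => n; rewrite fE /= big_nat_recl //= fctE; congr (_ + _).
    by rewrite !expr0 mulr1 muln0 add0n mul1r.
  transitivity (- (D * \sum_(0 <= i < n) stumpff_num k.+2 i / i`!%:R * D ^+ i)); last first.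
    by rewrite /pseries seriesEnat.
  rewrite mulr_sumr -sumrN.
  apply: eq_bigr => i _; rewrite /stumpff_num.
  have -> : (2 * i.+1 + k = 2 * i + k.+2)%N by lia.
  rewrite [_ / i`!%:R]mulrAC mulfK; last by rewrite pnatr_eq0 -lt0n fact_gt0.
  by rewrite !exprS; ring.
apply: cvgB; first exact: cvg_cst.
by apply: cvgZl_tmp.
Qed.

(** On coefficients this is the identity 2 (n + 1) = (2 n + k + 2) - k over the common denominator
    (2 n + k + 2)!. *)
Global Instance is_derive_stumpff (k : nat) (D : R) :
  is_derive D 1 (stumpff k) ((k%:R * stumpff k.+2 D - stumpff k.+1 D) / 2).
Proof.
have -> : (k%:R * stumpff k.+2 D - stumpff k.+1 D) / 2 =
    egf (fun n => stumpff_num k n.+1) D.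
  have -> : (fun n => stumpff_num k n.+1) =
      fun n => (k%:R / 2) * stumpff_num k.+2 n + (- 2^-1) * stumpff_num k.+1 n.
    apply/funext => n; rewrite /stumpff_num exprS.
    have -> : (2 * n.+1 + k = (2 * n + k).+2)%N by lia.
    have -> : (2 * n + k.+2 = (2 * n + k).+2)%N by lia.
    have -> : (2 * n + k.+1 = (2 * n + k).+1)%N by lia.
    rewrite !factS !natrM; set f := (2 * n + k)`!%:R.
    have f0 : f != 0 :> R by rewrite pnatr_eq0 -lt0n fact_gt0.
    have h1 : 2 * n%:R + k%:R + 1 != 0 :> R.
      by rewrite -natrM -natrD natr1 pnatr_eq0.
    have h2 : 2 * n%:R + k%:R + 2 != 0 :> R.
      by rewrite -natrM -!natrD pnatr_eq0 addn2.
    rewrite -[(2 * n + k).+2%N%:R]natr1 -[(2 * n + k).+1%N%:R]natr1.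
    rewrite -[n.+1%:R]natr1 natrD natrM.
    rewrite -[_ + 1 + 1]addrA -[1 + 1]/(2%:R). 
    by field; rewrite h1 h2 pnatr_eq0 -lt0n fact_gt0.
  rewrite (egf_lin _ _ 1 1 1 1 (k%:R / 2) (- 2^-1) D (stumpff_num_le k.+2) (stumpff_num_le k.+1)).
  by rewrite /stumpff; field.
exact: is_derive_egf (stumpff_num_le k).
Qed.

Lemma stumpff0 k : stumpff k 0 = k`!%:R^-1.
Proof. by rewrite stumpffE mul0r subr0. Qed.

(** Since k! k^(2 n) <= (2 n + k)!, the term of index n is at most (|D| / k^2)^n / k!, and the
    series is dominated by a geometric one of ratio 1/2. *)
Lemma stumpff_bound (k : nat) (D : R) : (0 < k)%N -> `|D| <= k%:R ^+ 2 / 2 ->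
  `|stumpff k D| <= 2 / k`!%:R.
Proof.
move=> k0 Dk.
have kR : 0 < k%:R :> R by rewrite ltr0n.
have cv := is_cvg_egf _ _ _ D (stumpff_num_le k).
have geo : `|2^-1 : R| < 1 by rewrite ger0_norm ?invr_ge0 // invf_lt1 // ltr1n.
have gc := @cvg_geometric_series R (k`!%:R^-1) _ geo.
have le n : `|stumpff_num k n / n`!%:R * D ^+ n| <= geometric (k`!%:R^-1) (2^-1) n.
  rewrite /= /stumpff_num !normrM !normrX !normfV normrN1 expr1n mul1r.
  rewrite !normr_nat.
  have f0 m : 0 < m`!%:R :> R by rewrite ltr0n fact_gt0.
  have -> : n`!%:R / (2 * n + k)`!%:R / n`!%:R * `|D| ^+ n =
     `|D| ^+ n / (2 * n + k)`!%:R :> R.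
    by field; rewrite !lt0r_neq0.
  rewrite ler_pdivrMr // -mulrA ler_pdivlMl //.
  have fk : k`!%:R * k%:R ^+ (2 * n) <= (2 * n + k)`!%:R :> R.
    rewrite -natrX -natrM ler_nat; elim: (2 * n)%N => [|m IH].
      by rewrite expn0 muln1 add0n.
    rewrite expnS mulnCA addSn factS leq_mul //; lia.
  apply: le_trans (ler_wpM2l _ fk); last by rewrite exprn_ge0 ?invr_ge0.
  rewrite mulrCA ler_pM2l // exprM -exprMn lerXn2r ?nnegrE //; last by rewrite mulrC.
have nc : cvgn [normed pseries (fun n => stumpff_num k n / n`!%:R) D].
  apply: (@series_le_cvg _ _ (geometric (k`!%:R^-1) (2^-1))) => [n|n|n|].
  - exact: normr_ge0.
  - by rewrite /= mulr_ge0 ?exprn_ge0 ?invr_ge0.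
  - exact: le.
  - exact: is_cvg_geometric_series.
apply: (le_trans (lim_series_norm nc)).
have E := cvg_lim (@Rhausdorff R) gc.
rewrite (_ : 2 / k`!%:R = k`!%:R^-1 / (1 - 2^-1)); last first.
  by field; rewrite pnatr_eq0 -lt0n fact_gt0.
rewrite -E.
by apply: lim_series_le => //; exact: is_cvg_geometric_series.
Qed.

End Egf.

(** * Rules of differentiation, and monotonicity from the sign of the derivative *)

Section Der.
Context {R : realType}.
Implicit Types (f g : R -> R) (x y a b d : R).

Definition der f x d : Prop := is_derive x 1 f d.

Lemma der_eq f x d d' : der f x d -> d = d' -> der f x d'.
Proof. by move=> h <-. Qed.

Lemma der_ext f g x d : (forall y, f y = g y) -> der f x d -> der g x d.
Proof. by move=> /funext ->. Qed.

Lemma der_id x : der (fun x => x) x 1.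
Proof. exact: is_derive_id. Qed.

Lemma der_cst c x : der (fun=> c) x 0.
Proof. exact: is_derive_cst. Qed.

Lemma der_add f g x df dg : der f x df -> der g x dg ->
  der (fun x => f x + g x) x (df + dg).
Proof. by move=> hf hg; apply: (@is_deriveD _ _ _ f g). Qed.

Lemma der_opp f x df : der f x df -> der (fun x => - f x) x (- df).
Proof. by move=> hf; apply: (@is_deriveN _ _ _ f). Qed.

Lemma der_mul f g x df dg : der f x df -> der g x dg ->
  der (fun x => f x * g x) x (f x * dg + g x * df).
Proof. by move=> hf hg; apply: (@is_deriveM _ _ f g). Qed.

Lemma der_comp f g x df dg : der f (g x) df -> der g x dg ->
  der (fun x => f (g x)) x (df * dg).
Proof. by move=> hf hg; apply: (@is_derive1_comp _ f g). Qed.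

Lemma der_inv f x df : f x != 0 -> der f x df ->
  der (fun x => (f x)^-1) x (- df / f x ^+ 2).
Proof.
move=> f0 hf; apply: der_eq; first exact: is_deriveV f0 hf.
by rewrite /GRing.scale /= mulrC mulNr mulrN.
Qed.

Lemma der_sqr f x df : der f x df -> der (fun x => f x ^+ 2) x (2 * f x * df).
Proof.
move=> hf; apply: (der_ext (fun x => f x * f x)) => [y|]; first by rewrite expr2.
by apply: der_eq (der_mul _ _ _ _ _ hf hf) _; ring.
Qed.

Lemma der_stumpff k g x dg : der g x dg ->
  der (fun x => stumpff k (g x)) x
    ((k%:R * stumpff k.+2 (g x) - stumpff k.+1 (g x)) / 2 * dg).
Proof. exact/der_comp/is_derive_stumpff. Qed.

Lemma der_expR g x dg : der g x dg -> der (fun x => expR (g x)) x (expR (g x) * dg).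
Proof. exact/der_comp/is_derive_expR. Qed.

Lemma der_cos g x dg : der g x dg -> der (fun x => cos (g x)) x (- sin (g x) * dg).
Proof. exact/der_comp/is_derive_cos. Qed.

Lemma der_sin g x dg : der g x dg -> der (fun x => sin (g x)) x (cos (g x) * dg).
Proof. exact/der_comp/is_derive_sin. Qed.

Lemma der_atan g x dg : der g x dg ->
  der (fun x => atan (g x)) x ((1 + g x ^+ 2)^-1 * dg).
Proof. exact/der_comp/is_derive1_atan. Qed.

Lemma der_sqrt g x dg : 0 < g x -> der g x dg ->
  der (fun x => Num.sqrt (g x)) x ((2 * Num.sqrt (g x))^-1 * dg).
Proof. by move=> g0; apply/der_comp/is_derive1_sqrt. Qed.

Lemma der_ln g x dg : 0 < g x -> der g x dg -> der (fun x => ln (g x)) x ((g x)^-1 * dg).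
Proof. by move=> g0; apply/der_comp/is_derive1_ln. Qed.

Lemma der_acos g x dg : -1 < g x < 1 -> der g x dg ->
  der (fun x => acos (g x)) x (- (Num.sqrt (1 - g x ^+ 2))^-1 * dg).
Proof. by move=> g0; apply/der_comp/is_derive1_acos. Qed.

Lemma der_continuous f a b (df : R -> R) :
  (forall x, a <= x <= b -> der f x (df x)) -> {within `[a, b], continuous f}.
Proof.
move=> h; apply: derivable_within_continuous => x; rewrite in_itv /= => hx.
by have := h x hx => -[].
Qed.

Lemma der_nondecr f (df : R -> R) a b : a <= b ->
  (forall x, a <= x <= b -> der f x (df x)) ->
  (forall x, a < x < b -> 0 <= df x) -> f a <= f b.
Proof.
move=> ab h df0; move: ab; rewrite le_eqVlt => /predU1P[->//|ab].
have cf := der_continuous _ _ _ _ h.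
have [|c] := @MVT _ f df a b ab _ cf.
  move=> x; rewrite in_itv /= => /andP[ax xb]; apply: h; lra.
rewrite in_itv /= => cab E; rewrite -subr_ge0 E mulr_ge0 ?df0 // subr_ge0; exact: ltW.
Qed.

Lemma der_incr f (df : R -> R) a b : a < b ->
  (forall x, a <= x <= b -> der f x (df x)) ->
  (forall x, a < x < b -> 0 < df x) -> f a < f b.
Proof.
move=> ab h df0.
have cf := der_continuous _ _ _ _ h.
have [|c] := @MVT _ f df a b ab _ cf.
  move=> x; rewrite in_itv /= => /andP[ax xb]; apply: h; lra.
rewrite in_itv /= => cab E; rewrite -subr_gt0 E mulr_gt0 ?df0 // subr_gt0; exact.
Qed.

Lemma der0_cst f x y : (forall x, der f x 0) -> f x = f y.
Proof. exact: is_derive_0_is_cst. Qed.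

End Der.

Ltac der_step :=
  first [ apply: der_id | apply: der_cst | apply: der_add | apply: der_opp
        | apply: der_sqr | apply: der_mul | apply: der_stumpff | apply: der_expR
        | apply: der_cos | apply: der_sin | apply: der_atan | eassumption ].
Ltac der_auto := apply: der_eq; [repeat der_step | cbv beta].

(** * Stumpff functions as trigonometric and hyperbolic functions *)

Section StumpffTrig.
Context {R : realType}.
Implicit Types (D x : R).

Local Notation c0 := (@stumpff R 0).
Local Notation c1 := (@stumpff R 1).
Local Notation c2 := (@stumpff R 2).
Local Notation c3 := (@stumpff R 3).

Lemma stumpff0E D : c0 D = 1 - D * c2 D.
Proof. by rewrite stumpffE fact0 invr1. Qed.

Lemma stumpff1E D : c1 D = 1 - D * c3 D.
Proof. by rewrite stumpffE invr1. Qed.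

(** The derivative in [D] vanishes and the value at 0 is 1; this treats both signs of [D] at once,
    without square roots. *)
Lemma stumpff_cos2_sin2 D : c0 D ^+ 2 + D * c1 D ^+ 2 = 1.
Proof.
pose f D := c0 D ^+ 2 + D * c1 D ^+ 2.
rewrite -[LHS]/(f D) (der0_cst f D 0) => [|x].
  by rewrite /f !stumpff0 mul0r addr0 fact0 invr1 expr1n.
rewrite /f; der_auto.
have : x * (c3 x - c2 x) = c0 x - c1 x by rewrite stumpff0E stumpff1E; ring.
move: (c0 x) (c1 x) (c2 x) (c3 x) => a b c d h.
have -> : x * (2 * b * ((1%:R * d - c) / 2 * 1)) = b * (x * (d - c)) by field.
by rewrite h; field.
Qed.

(** Both pairs solve the harmonic oscillator with the same initial values, so the squared distance
    [f] of the two solutions has derivative zero and starts at 0. *)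
Lemma stumpff_cos_sin x : c0 (x ^+ 2) = cos x /\ x * c1 (x ^+ 2) = sin x.
Proof.
pose f x := (c0 (x ^+ 2) - cos x) ^+ 2 + (x * c1 (x ^+ 2) - sin x) ^+ 2.
have : f x = 0.
  rewrite (der0_cst f x 0) => [|y].
    by rewrite /f expr0n /= !stumpff0 cos0 sin0 mul0r fact0 invr1 !subrr expr0n addr0.
  rewrite /f; der_auto.
  have : y ^+ 2 * (c3 (y ^+ 2) - c2 (y ^+ 2)) = c0 (y ^+ 2) - c1 (y ^+ 2).
    by rewrite stumpff0E stumpff1E; ring.
  move: (c0 _) (c1 _) (c2 _) (c3 _) (cos y) (sin y) => a b c d co si h.
  have -> : y * ((1%:R * d - c) / 2 * (2 * y * 1)) = a - b by rewrite -h; field.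
  by field.
rewrite /f => h.
have h1 := sqr_ge0 (c0 (x ^+ 2) - cos x).
have h2 := sqr_ge0 (x * c1 (x ^+ 2) - sin x).
have /eqP : (c0 (x ^+ 2) - cos x) ^+ 2 = 0 by lra.
have /eqP : (x * c1 (x ^+ 2) - sin x) ^+ 2 = 0 by lra.
by rewrite !sqrf_eq0 !subr_eq0 => /eqP -> /eqP ->.
Qed.

Lemma stumpff_expR x : c0 (- x ^+ 2) + x * c1 (- x ^+ 2) = expR x.
Proof.
pose f x := (c0 (- x ^+ 2) + x * c1 (- x ^+ 2)) * expR (- x).
have : f x = 1.
  rewrite (der0_cst f x 0) => [|y].
    by rewrite /f expr0n /= !oppr0 !stumpff0 expR0 mul0r fact0 invr1 addr0 mulr1.
  rewrite /f; der_auto.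
  have : - y ^+ 2 * (c3 (- y ^+ 2) - c2 (- y ^+ 2)) = c0 (- y ^+ 2) - c1 (- y ^+ 2).
    by rewrite stumpff0E stumpff1E; ring.
  move: (c0 _) (c1 _) (c2 _) (c3 _) (expR _) => a b c d e h.
  have -> : y * ((1%:R * d - c) / 2 * - (2 * y * 1)) = a - b by rewrite -h; field.
  by field.
rewrite /f expRN => h; have e0 := expR_gt0 x.
by rewrite -[RHS]mul1r -h mulfVK // lt0r_neq0.
Qed.

Lemma stumpff_cosh x : c0 (- x ^+ 2) = (expR x + expR (- x)) / 2.
Proof.
have h1 := stumpff_expR x; have := stumpff_expR (- x); rewrite sqrrN => h2.
by rewrite -h1 -h2; field.
Qed.

Lemma stumpff_sinh x : x * c1 (- x ^+ 2) = (expR x - expR (- x)) / 2.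
Proof.
have h1 := stumpff_expR x; have := stumpff_expR (- x); rewrite sqrrN => h2.
by rewrite -h1 -h2; field.
Qed.

End StumpffTrig.

(* Taylor forms of [stumpff 4] and [stumpff 5], [e] standing for the remainder. *)
Section TaylorForms.
Context {A : arith}.
Implicit Types D e : A.
Definition tc4 D e : A :=
  ((1/24) * ((1/1) - D * (1/30) * ((1/1) - D * (1/56) * ((1/1) - D * (1/90) * ((1/1) - D * (1/132) * ((1/1) - e))))))%A.
Definition tc5 D e : A :=
  ((1/120) * ((1/1) - D * (1/42) * ((1/1) - D * (1/72) * ((1/1) - D * (1/110) * ((1/1) - D * (1/156) * ((1/1) - e))))))%A.
Definition tc2 D e : A := ((1/2) - D * tc4 D e)%A.
Definition tc3 D e : A := ((1/6) - D * tc5 D e)%A.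
Definition tc0 D e : A := ((1/1) - D * tc2 D e)%A.
Definition tc1 D e : A := ((1/1) - D * tc3 D e)%A.
End TaylorForms.

Section TaylorSound.
Context {R : realType}.
Local Notation RA := (@real_arith R).
Local Notation IA := itvl_arith.

Lemma inI_tc4 (D e : IA) (x y : RA) : inI D x -> inI e y -> inI (tc4 D e) (tc4 x y).
Proof. by move=> hD he; rewrite /tc4; inI_tac. Qed.
Lemma inI_tc5 (D e : IA) (x y : RA) : inI D x -> inI e y -> inI (tc5 D e) (tc5 x y).
Proof. by move=> hD he; rewrite /tc5; inI_tac. Qed.
Lemma inI_tc2 (D e : IA) (x y : RA) : inI D x -> inI e y -> inI (tc2 D e) (tc2 x y).
Proof. by move=> hD he; have h := inI_tc4 _ _ _ _ hD he; rewrite /tc2; inI_tac. Qed.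
Lemma inI_tc3 (D e : IA) (x y : RA) : inI D x -> inI e y -> inI (tc3 D e) (tc3 x y).
Proof. by move=> hD he; have h := inI_tc5 _ _ _ _ hD he; rewrite /tc3; inI_tac. Qed.
Lemma inI_tc0 (D e : IA) (x y : RA) : inI D x -> inI e y -> inI (tc0 D e) (tc0 x y).
Proof. by move=> hD he; have h := inI_tc2 _ _ _ _ hD he; rewrite /tc0; inI_tac. Qed.
Lemma inI_tc1 (D e : IA) (x y : RA) : inI D x -> inI e y -> inI (tc1 D e) (tc1 x y).
Proof. by move=> hD he; have h := inI_tc3 _ _ _ _ hD he; rewrite /tc1; inI_tac. Qed.

Definition nstumpff (k : nat) (D : R) : R := k`!%:R * stumpff k D.

Lemma nstumpff_rec (k : nat) (D : R) :
  nstumpff k D = 1 - D / ((k.+1 * k.+2)%N)%:R * nstumpff k.+2 D.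
Proof.
rewrite /nstumpff stumpffE !factS !natrM mulrBr mulfV ?pnatr_eq0 -?lt0n ?fact_gt0 //; congr (_ - _).
have h1 : k.+1%:R != 0 :> R by rewrite pnatr_eq0.
have h2 : k.+2%:R != 0 :> R by rewrite pnatr_eq0.
move: (k.+1%:R : R) (k.+2%:R : R) (k`!%:R : R) h1 h2 => a b f h1 h2.
by field; rewrite h1 h2.
Qed.

(** |D / c| is at most 1/2 and the normalised function at most 2. The range 10 is taken because it
    contains pi^2. *)
Lemma nstumpff_bound (k : nat) (D c : R) : (0 < k)%N -> `|D| <= 10 ->
  10 <= k%:R ^+ 2 / 2 :> R -> 20 <= c -> -1 <= D / c * nstumpff k D <= 1.
Proof.
move=> k0 D10 hk c20.
have b := stumpff_bound k D k0 (le_trans D10 hk).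
have f0 : 0 < k`!%:R :> R by rewrite ltr0n fact_gt0.
rewrite -ler_norml !normrM normfV (ger0_norm (ltW f0)) (@ger0_norm _ c); last by lra.
have b2 : k`!%:R * `|stumpff k D| <= 2 by rewrite mulrC -ler_pdivlMr.
rewrite mulrAC ler_pdivrMr ?mul1r; last by lra.
apply: (le_trans _ c20); have -> : (20 : R) = 10 * 2 by ring.
by rewrite ler_pM ?mulr_ge0.
Qed.

Definition unitI : itvl := itvl_of (-1) 1 1 1.

(** The recursion moves by two orders, so one remainder serves the orders 0, 2, 4 and another one 1,
    3, 5. They are what is left at orders 14 and 15, whence the denominators 182 = 13 * 14 and 210 =
    14 * 15. *)
Lemma stumpff_taylor (D : R) : `|D| <= 10 -> exists e4 e5 : R,
  [/\ inI unitI e4, inI unitI e5 & [/\ stumpff 4 D = tc4 (D : RA) e4,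
     stumpff 5 D = tc5 (D : RA) e5, stumpff 2 D = tc2 (D : RA) e4 &
     [/\ stumpff 3 D = tc3 (D : RA) e5, stumpff 0 D = tc0 (D : RA) e4
       & stumpff 1 D = tc1 (D : RA) e5]]].
Proof.
move=> D10.
have b4 : -1 <= D / 182 * nstumpff 14 D <= 1 by apply: nstumpff_bound => //; lra.
have b5 : -1 <= D / 210 * nstumpff 15 D <= 1 by apply: nstumpff_bound => //; lra.
have r4 : nstumpff 4 D = 1 - D / 30 * nstumpff 6 D := nstumpff_rec 4 D.
have r6 : nstumpff 6 D = 1 - D / 56 * nstumpff 8 D := nstumpff_rec 6 D.
have r8 : nstumpff 8 D = 1 - D / 90 * nstumpff 10 D := nstumpff_rec 8 D.
have r10 : nstumpff 10 D = 1 - D / 132 * nstumpff 12 D := nstumpff_rec 10 D.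
have r12 : nstumpff 12 D = 1 - D / 182 * nstumpff 14 D := nstumpff_rec 12 D.
have r5 : nstumpff 5 D = 1 - D / 42 * nstumpff 7 D := nstumpff_rec 5 D.
have r7 : nstumpff 7 D = 1 - D / 72 * nstumpff 9 D := nstumpff_rec 7 D.
have r9 : nstumpff 9 D = 1 - D / 110 * nstumpff 11 D := nstumpff_rec 9 D.
have r11 : nstumpff 11 D = 1 - D / 156 * nstumpff 13 D := nstumpff_rec 11 D.
have r13 : nstumpff 13 D = 1 - D / 210 * nstumpff 15 D := nstumpff_rec 13 D.
move: b4 b5 r12 r13.
set e4 := D / 182 * nstumpff 14 D; set e5 := D / 210 * nstumpff 15 D => b4 b5 r12 r13.
exists e4, e5.
have i1 e : -1 <= e <= 1 -> inI unitI (e : R).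
  move=> /andP[h1 h2]; apply: inI_itvl; rewrite /Z_real /pos_real; lra.
have h4 : stumpff 4 D = tc4 (D : RA) e4.
  have f4 : 4`!%:R = 24 :> R by [].
  have -> : stumpff 4 D = 24^-1 * nstumpff 4 D by rewrite /nstumpff f4; field.
  by rewrite r4 r6 r8 r10 r12 /tc4 /=; field.
have h5 : stumpff 5 D = tc5 (D : RA) e5.
  have f5 : 5`!%:R = 120 :> R by [].
  have -> : stumpff 5 D = 120^-1 * nstumpff 5 D by rewrite /nstumpff f5; field.
  by rewrite r5 r7 r9 r11 r13 /tc5 /=; field.
have h2 : stumpff 2 D = tc2 (D : RA) e4.
  have fE : 2`!%:R = 2 :> R by [].
  by rewrite stumpffE fE h4 /tc2 /=; field.
have h3 : stumpff 3 D = tc3 (D : RA) e5.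
  have fE : 3`!%:R = 6 :> R by [].
  by rewrite stumpffE fE h5 /tc3 /=; field.
have h0 : stumpff 0 D = tc0 (D : RA) e4.
  have fE : 0`!%:R = 1 :> R by [].
  by rewrite stumpffE fE h2 /tc0 /=; field.
have h1 : stumpff 1 D = tc1 (D : RA) e5.
  have fE : 1`!%:R = 1 :> R by [].
  by rewrite stumpffE fE h3 /tc1 /=; field.
by split; [exact: i1|exact: i1|].
Qed.

Lemma tc0_real (D e : R) : tc0 (D : RA) e =
  1 - D * (1 / 2 - D * (1 / 24 * (1 - D / 30 * (1 - D / 56 * (1 - D / 90 * (1 - D / 132 * (1 - e))))))).
Proof. by rewrite /tc0 /tc2 /tc4 /=; field. Qed.

Lemma tc1_real (D e : R) : tc1 (D : RA) e =
  1 - D * (1 / 6 - D * (1 / 120 * (1 - D / 42 * (1 - D / 72 * (1 - D / 110 * (1 - D / 156 * (1 - e))))))).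
Proof. by rewrite /tc1 /tc3 /tc5 /=; field. Qed.

Lemma inI_unit (e : R) : inI unitI e -> -1 <= e <= 1.
Proof.
have -> : unitI = (Zneg fscale, Zpos fscale) by vm_compute.
have s0 : 0 < @pos_real R fscale := pos_real_gt0 _.
move=> -[]; change (- @pos_real R fscale <= e * pos_real fscale ->
  e * pos_real fscale <= @pos_real R fscale -> -1 <= e <= 1).
by move: (pos_real fscale) s0 => s s0 h1 h2; nra.
Qed.

End TaylorSound.

(** * Certified inequalities *)

Section Forms.
Context {A : arith}.
Implicit Types y P T K Q D l : A.

(** With [n2] = [cvm], [n3] = [1 + cvU ^ 2] and [n4] = [cvn], this is the derivative of [- cvM] up
    to a positive factor; its positivity makes [H] concave as a function of [r]. *)
Definition concave_form y P c0 c1 c2 c3 c4 c5 : A :=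
  (let n2 := (1/1) - y + y * c0 in
   let ys := P * (y * c1) in
   let n3 := (1/1) + ys * (y * c1) in
   let d23 := c2 - c3 in
   let n4 := c1 + P * y * d23 in
   let dn3 := P * (c4 - (3/1) * c5) in
   let dn2 := c0 - (1/1) + ys in
   let dn4 := P * ((2/1) * d23 + P * y * (c3 - (3/1) * c4 + (3/1) * c5)) in
   c3 * n2 * (ys * n4 * n4 + dn4 * n3) - (dn3 * n2 + c3 * dn2) * n3 * n4)%A.

Definition curve_form y P T K D c0 c1 c2 c3 : A :=
  (let Pb := P * ((1/1) - y) in
   K * ((1/1) - Pb * (c2 + c3 - D * c2 * c3))
   - (c1 - Pb * (c2 - c3)) * (c0 + T * y * c1))%A.

(** The constant is the square of 259/1000, a rational lower bound of [slope]. *)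
Definition level_form Q D c0 c1 c2 c3 : A :=
  (let n4 := (2/1) * c1 + (Q - D) * (c2 - c3) in
   let Y := c1 * (Q + D) in
   let S := c3 * (Q + D + (Q - D) * c0) in
   (67081/1000000) * ((4/1) * Q * c0 * c0 + Y * Y) * n4 * n4 - (4/1) * Q * S * S)%A.

(** 37/100 has to stay below the quotient of [1 - y + y * c0] by [1 + P * u ^ 2]; at [l = y = 1]
    this quotient is 1 / cosh (pi / 2), about 0.398. *)
Definition ray_form l y P c0 c1 : A :=
  (let u := l * y * c1 in
   (1/1) - y + y * c0 - (37/100) * ((1/1) + P * u * u))%A.

End Forms.

Section Boxes.
(** Enclosures of [T ^ 2], [T], [K] and [K ^ 2]. Their widths are harmless because every certified
    form is strictly positive on its closed box. *)
Definition boxP : itvl := itvl_of 2467 1000 617 250.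
Definition boxT : itvl := itvl_of 333 212 377 240.
Definition boxK : itvl := itvl_of 1511 200 189 25.
Definition boxQ : itvl := itvl_of 1426 25 1429 25.
Definition box0 : itvl := itvl_of 0 1 0 1.
Local Notation IA := itvl_arith.

Definition curveD {A : arith} (P y : A) : A := (P * ((1/1) - (2/1) * y))%A.

Definition concave_itvl (y _ : itvl) : itvl :=
  let D := curveD (boxP : IA) y in let e := unitI : IA in
  concave_form (y : IA) boxP (tc0 D e) (tc1 D e) (tc2 D e) (tc3 D e) (tc4 D e) (tc5 D e).
Definition curve_itvl (y _ : itvl) : itvl :=
  let D := curveD (boxP : IA) y in let e := unitI : IA in
  curve_form (y : IA) boxP boxT boxK D (tc0 D e) (tc1 D e) (tc2 D e) (tc3 D e).
Definition level_itvl (D _ : itvl) : itvl :=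
  let D := D : IA in let e := unitI : IA in
  level_form (boxQ : IA) D (tc0 D e) (tc1 D e) (tc2 D e) (tc3 D e).
Definition ray_itvl (l y : itvl) : itvl :=
  let D := curveD ((boxP : IA) * ((l : IA) * l))%A y in let e := unitI : IA in
  ray_form (l : IA) y boxP (tc0 D e) (tc1 D e).
Definition ratio_itvl (D _ : itvl) : itvl :=
  let D := D : IA in let e := unitI : IA in
  ((5/1) * (tc2 D e - tc3 D e) - tc1 D e)%A.
Definition gap_itvl (y _ : itvl) : itvl :=
  let D := curveD (boxP : IA) y in let e := unitI : IA in
  (tc0 D e - (boxT : IA) * (y : IA) * tc1 D e)%A.
Definition start_itvl (y _ : itvl) : itvl :=
  let D := curveD (boxP : IA) y in let e := unitI : IA in
  ((boxT : IA) * tc1 D e - (1419/1000) * (tc1 D e + (boxP : IA) * (y : IA) * (tc2 D e - tc3 D e)))%A.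

Lemma concave_check : pos_on 30 concave_itvl (itvl_of 0 1 1 1) box0.
Proof. by vm_compute. Qed.
Lemma curve_check : pos_on 30 curve_itvl (itvl_of 1 10 1 1) box0.
Proof. by vm_compute. Qed.
Lemma level_check : pos_on 30 level_itvl (itvl_of (-247) 25 617 250) box0.
Proof. by vm_compute. Qed.
Lemma ray_check : pos_on 30 ray_itvl (itvl_of 0 1 1 1) (itvl_of 0 1 1 1).
Proof. by vm_compute. Qed.
Lemma ratio_check : pos_on 30 ratio_itvl (itvl_of (-247) 25 247 25) box0.
Proof. by vm_compute. Qed.
Lemma gap_check : pos_on 30 gap_itvl (itvl_of 1 10 1 1) box0.
Proof. by vm_compute. Qed.
Lemma start_check : pos_on 30 start_itvl (itvl_of 0 1 1 10) box0.
Proof. by vm_compute. Qed.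

Section Real.
Context {R : realType}.
Local Notation T := (pi / 2 : R).
Local Notation P := (T ^+ 2 : R).
Local Notation K := (T * expR T).
Local Notation RA := (@real_arith R).

(** The cosine decreases on [0, pi], and its Taylor form is positive at 333/212 and negative at
    377/240, the halves of the classical approximations 333/106 and 377/120 of pi. *)
Lemma pihalf_bounds : 333 / 212 < T < 377 / 240.
Proof.
have cE (x : R) : 0 <= x <= 2 -> exists2 e, inI unitI e & cos x = tc0 (x ^+ 2 : RA) e.
  move=> x2; have [|e4 [e5 [h4 _ [_ _ _ [_ h0 _]]]]] := @stumpff_taylor R (x ^+ 2).
    by rewrite ger0_norm ?sqr_ge0 //; nra.
  by exists e4 => //; rewrite -h0 (proj1 (stumpff_cos_sin x)).
have pi2 : 2 <= pi :> R := pi_ge2 R.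
have c (x : R) : 0 <= x <= 2 -> x \in `[0, pi].
  by move=> /andP[x0 x2]; rewrite in_itv /=; lra.
have [/ltW h1 /ltW h2] := andP (pihalf_02 R).
have ct : T \in `[0, pi] by apply: c; rewrite h1.
apply/andP; split.

- have cx : (333 / 212 : R) \in `[0, pi] by apply: c; lra.
  rewrite -(ltr_cos cx ct) cos_pihalf.
  have [|e /inI_unit he ->] := cE (333 / 212); first lra.
  by rewrite tc0_real; lra.
- have cx : (377 / 240 : R) \in `[0, pi] by apply: c; lra.
  rewrite -(ltr_cos ct cx) cos_pihalf.
  have [|e /inI_unit he ->] := cE (377 / 240); first lra.
  by rewrite tc0_real; lra.
Qed.

Lemma expR_pihalf_bounds : 481 / 100 < expR T < 433 / 90.
Proof.
have eE (x : R) : 0 <= x <= 2 -> exists e4 e5,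
    [/\ -1 <= e4 <= 1, -1 <= e5 <= 1 & expR x = tc0 (- x ^+ 2 : RA) e4 + x * tc1 (- x ^+ 2 : RA) e5].
  move=> x2; have [|e4 [e5 [h4 h5 [_ _ _ [_ h0 h1]]]]] := @stumpff_taylor R (- x ^+ 2).
    by rewrite normrN ger0_norm ?sqr_ge0 //; nra.
  exists e4, e5; split; [exact: inI_unit|exact: inI_unit|].
  by rewrite -stumpff_expR h0 h1.
have /andP[t1 t2] := pihalf_bounds; apply/andP; split.
- apply: (@lt_trans _ _ (expR (333 / 212))); last by rewrite ltr_expR.
  have [|e4 [e5 [h4 h5 ->]]] := eE (333 / 212); first lra.
  by rewrite tc0_real tc1_real; lra.
- apply: (@lt_trans _ _ (expR (377 / 240))); first by rewrite ltr_expR.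
  have [|e4 [e5 [h4 h5 ->]]] := eE (377 / 240); first lra.
  by rewrite tc0_real tc1_real; lra.
Qed.

Lemma level_bounds : 1511 / 200 < K < 189 / 25.
Proof.
have /andP[t1 t2] := pihalf_bounds; have /andP[e1 e2] := expR_pihalf_bounds.
by apply/andP; split; nra.
Qed.

End Real.
End Boxes.

Section Positivity.
Context {R : realType}.
Implicit Types (y l D : R).
Local Notation T := (pi / 2 : R).
Local Notation P := (T ^+ 2 : R).
Local Notation K := (T * expR T).
Local Notation RA := (@real_arith R).
Local Notation c0 := (@stumpff R 0).
Local Notation c1 := (@stumpff R 1).
Local Notation c2 := (@stumpff R 2).
Local Notation c3 := (@stumpff R 3).
Local Notation c4 := (@stumpff R 4).
Local Notation c5 := (@stumpff R 5).

Lemma sqr_pihalf_bounds : 2467 / 1000 < P < 617 / 250.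
Proof. by have /andP[t1 t2] := @pihalf_bounds R; apply/andP; split; nra. Qed.

Lemma sqr_level_bounds : 1426 / 25 < K ^+ 2 < 1429 / 25.
Proof. by have /andP[t1 t2] := @level_bounds R; apply/andP; split; nra. Qed.

Lemma inI_P : inI boxP (P).
Proof.
have /andP[/ltW h1 /ltW h2] := sqr_pihalf_bounds; apply: inI_itvl.
  by rewrite [X in X <= _](_ : _ = 2467 / 1000) //=; field.
by rewrite [X in _ <= X](_ : _ = 617 / 250) //=; field.
Qed.

Lemma inI_T : inI boxT (T).
Proof.
have /andP[/ltW h1 /ltW h2] := @pihalf_bounds R; apply: inI_itvl.
  by rewrite [X in X <= _](_ : _ = 333 / 212) //=; field.
by rewrite [X in _ <= X](_ : _ = 377 / 240) //=; field.
Qed.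

Lemma inI_K : inI boxK (K).
Proof.
have /andP[/ltW h1 /ltW h2] := @level_bounds R; apply: inI_itvl.
  by rewrite [X in X <= _](_ : _ = 1511 / 200) //=; field.
by rewrite [X in _ <= X](_ : _ = 189 / 25) //=; field.
Qed.

Lemma inI_Q : inI boxQ (K ^+ 2).
Proof.
have /andP[/ltW h1 /ltW h2] := sqr_level_bounds; apply: inI_itvl.
  by rewrite [X in X <= _](_ : _ = 1426 / 25) //=; field.
by rewrite [X in _ <= X](_ : _ = 1429 / 25) //=; field.
Qed.

Lemma inI_01 (y : R) : 0 <= y <= 1 -> inI (itvl_of 0 1 1 1) y.
Proof. by move=> /andP[h1 h2]; apply: inI_itvl; rewrite /=; lra. Qed.

Lemma inI_0 : inI box0 (0 : R).
Proof. by apply: inI_itvl; rewrite /=; lra. Qed.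

Lemma inI_curveD (X Y : itvl_arith) (x y : RA) : inI X x -> inI Y y ->
  inI (curveD X Y) (curveD x y).
Proof. by move=> hX hY; rewrite /curveD; inI_tac. Qed.

Lemma curveD_real (x y : R) : curveD (x : RA) y = x * (1 - 2 * y).
Proof. by rewrite /curveD /=; field. Qed.

Lemma curve_taylor y : 0 <= y <= 1 -> exists e4 e5 : R,
  [/\ inI unitI e4, inI unitI e5 & let D := curveD (P : RA) y in
     [/\ c4 D = tc4 D e4, c5 D = tc5 D e5, c2 D = tc2 D e4 &
     [/\ c3 D = tc3 D e5, c0 D = tc0 D e4 & c1 D = tc1 D e5]]].
Proof.
move=> /andP[y0 y1]; have /andP[p1 p2] := sqr_pihalf_bounds.
apply: stumpff_taylor; rewrite curveD_real ler_norml; apply/andP; split; nra.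
Qed.

Lemma concave_pos y D n2 n3 n4 : 0 <= y <= 1 ->
  D = P * (1 - 2 * y) -> n2 = 1 - y + y * c0 D ->
  n3 = 1 + P * (y * c1 D) ^+ 2 -> n4 = c1 D + P * y * (c2 D - c3 D) ->
  (P * (c4 D - 3 * c5 D) * n2 + c3 D * (c0 D - 1 + P * (y * c1 D))) * n3 * n4 <
  c3 D * n2 * (P * (y * c1 D) * n4 ^+ 2 +
    P * (2 * (c2 D - c3 D) + P * y * (c3 D - 3 * c4 D + 3 * c5 D)) * n3).
Proof.
move=> hy -> -> -> ->; rewrite -curveD_real.
have [e4 [e5 [h4 h5 [-> -> -> [-> -> ->]]]]] := curve_taylor y hy.
pose f (y _ : R) : R := let D := curveD (P : RA) y in
  concave_form (y : RA) P (tc0 D e4) (tc1 D e5) (tc2 D e4) (tc3 D e5) (tc4 D e4) (tc5 D e5).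
have sound X Y x z : inI X x -> inI Y z -> inI (concave_itvl X Y) (f x z).
  move=> hX _; rewrite /concave_itvl /f /concave_form.
  have hP := inI_P; have hD := inI_curveD _ _ _ _ hP hX.
  have i0 := inI_tc0 _ _ _ _ hD h4; have i1 := inI_tc1 _ _ _ _ hD h5.
  have i2 := inI_tc2 _ _ _ _ hD h4; have i3 := inI_tc3 _ _ _ _ hD h5.
  have i4 := inI_tc4 _ _ _ _ hD h4; have i5 := inI_tc5 _ _ _ _ hD h5.
  by inI_tac.
have h := pos_onP 30 _ f _ _ y 0 sound concave_check (inI_01 y hy) inI_0.
rewrite -subr_gt0; apply: (eq_ind _ (fun z => is_true (0 < z)) h); rewrite /f; cbv zeta beta.
move: (tc0 _ _) (tc1 _ _) (tc2 _ _) (tc3 _ _) (tc4 _ _) (tc5 _ _) => a0 a1 a2 a3 a4 a5.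
by move: (P : R) => p; rewrite /concave_form /=; field.
Qed.

(** The factors on the left are minus the derivative of [cvY] divided by [T], and [cvX + cvU]; the
    bracket on the right is the Wronskian of [cvX] and [cvU] divided by [T]. So this is the sign of
    the derivative in [acos_cvY]. Both sides vanish at [y = 0], hence the lower end 1/10. *)
Lemma curve_pos y D : 1 / 10 <= y <= 1 -> D = P * (1 - 2 * y) ->
  (c1 D - P * (1 - y) * (c2 D - c3 D)) * (c0 D + T * y * c1 D) <
  K * (1 - P * (1 - y) * (c2 D + c3 D - D * c2 D * c3 D)).
Proof.
move=> /andP[y0 y1] ->; rewrite -curveD_real.
have hy : 0 <= y <= 1 by apply/andP; split; lra.
have [e4 [e5 [h4 h5 [_ _ -> [-> -> ->]]]]] := curve_taylor y hy.
pose f (y _ : R) : R := let D := curveD (P : RA) y in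
  curve_form (y : RA) P T K D (tc0 D e4) (tc1 D e5) (tc2 D e4) (tc3 D e5).
have sound X Y x z : inI X x -> inI Y z -> inI (curve_itvl X Y) (f x z).
  move=> hX _; rewrite /curve_itvl /f /curve_form.
  have hP := inI_P; have hT := inI_T; have hK := inI_K; have hD := inI_curveD _ _ _ _ hP hX.
  have i0 := inI_tc0 _ _ _ _ hD h4; have i1 := inI_tc1 _ _ _ _ hD h5.
  have i2 := inI_tc2 _ _ _ _ hD h4; have i3 := inI_tc3 _ _ _ _ hD h5.
  by inI_tac.
have iy : inI (itvl_of 1 10 1 1) y.
  apply: inI_itvl; last by rewrite /=; lra.
  by rewrite [X in X <= _](_ : _ = 1 / 10) //=; field.
have h := pos_onP 30 _ f _ _ y 0 sound curve_check iy inI_0.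
rewrite -subr_gt0; apply: (eq_ind _ (fun z => is_true (0 < z)) h); rewrite /f; cbv zeta beta.
move: (tc0 _ _) (tc1 _ _) (tc2 _ _) (tc3 _ _) => a0 a1 a2 a3; move: (curveD _ _) => d.
by move: (expR T) => E; rewrite /curve_form /=; field.
Qed.

Lemma level_pos D Y n4 S : - (247 / 25) <= D <= P ->
  n4 = 2 * c1 D + (K ^+ 2 - D) * (c2 D - c3 D) -> Y = c1 D * (K ^+ 2 + D) ->
  S = c3 D * (K ^+ 2 + D + (K ^+ 2 - D) * c0 D) ->
  4 * K ^+ 2 * S ^+ 2 < (259 / 1000) ^+ 2 * (4 * K ^+ 2 * c0 D ^+ 2 + Y ^+ 2) * n4 ^+ 2.
Proof.
move=> /andP[D0 D1] -> -> ->; have /andP[_ p2] := sqr_pihalf_bounds.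
have [|e4 [e5 [h4 h5 [_ _ -> [-> -> ->]]]]] := @stumpff_taylor R D.
  by rewrite ler_norml; apply/andP; split; lra.
pose f (D _ : R) : R := let D := D : RA in
  level_form (K ^+ 2 : RA) D (tc0 D e4) (tc1 D e5) (tc2 D e4) (tc3 D e5).
have sound X Y' x z : inI X x -> inI Y' z -> inI (level_itvl X Y') (f x z).
  move=> hX _; rewrite /level_itvl /f /level_form; have hQ := inI_Q.
  have i0 := inI_tc0 _ _ _ _ hX h4; have i1 := inI_tc1 _ _ _ _ hX h5.
  have i2 := inI_tc2 _ _ _ _ hX h4; have i3 := inI_tc3 _ _ _ _ hX h5.
  by inI_tac.
have iD : inI (itvl_of (-247) 25 617 250) D.
  apply: inI_itvl.
    by rewrite [X in X <= _](_ : _ = - (247 / 25)) //=; field.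
  by apply: (le_trans D1); rewrite [X in _ <= X](_ : _ = 617 / 250) ?ltW //=; field.
have h := pos_onP 30 _ f _ _ D 0 sound level_check iD inI_0.
rewrite -subr_gt0; apply: (eq_ind _ (fun z => is_true (0 < z)) h); rewrite /f; cbv zeta beta.
move: (tc0 _ _) (tc1 _ _) (tc2 _ _) (tc3 _ _) => a0 a1 a2 a3.
by move: (K ^+ 2) => Q; rewrite /level_form /=; field.
Qed.

Lemma ray_pos l y D : 0 <= l <= 1 -> 0 <= y <= 1 -> D = l ^+ 2 * (P * (1 - 2 * y)) ->
  37 / 100 * (1 + P * (l * y * c1 D) ^+ 2) < 1 - y + y * c0 D.
Proof.
move=> hl hy ->.
have -> : l ^+ 2 * (P * (1 - 2 * y)) = curveD (P * l ^+ 2 : RA) y by rewrite curveD_real; ring.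
have /andP[p1 p2] := sqr_pihalf_bounds.
have [|e4 [e5 [h4 h5 [_ _ _ [_ -> ->]]]]] := @stumpff_taylor R (curveD (P * l ^+ 2 : RA) y).
  have /andP[l0 l1] := hl; have /andP[y0 y1] := hy.
  have pl : 0 <= P * l ^+ 2 <= 10.
    by rewrite mulr_ge0 ?sqr_ge0 //=; have : l ^+ 2 <= 1; [nra|move=> ?; nra].
  rewrite curveD_real ler_norml; move: (P * l ^+ 2) pl => q q1; apply/andP; split; nra.
pose f (l y : R) : R := let D := curveD ((P : RA) * ((l : RA) * l))%A y in
  ray_form (l : RA) y P (tc0 D e4) (tc1 D e5).
have sound X Y x z : inI X x -> inI Y z -> inI (ray_itvl X Y) (f x z).
  move=> hX hY; rewrite /ray_itvl /f /ray_form; have hP := inI_P.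
  have hXX : inI ((boxP : itvl_arith) * ((X : itvl_arith) * X))%A ((P : RA) * ((x : RA) * x))%A.
    by inI_tac.
  have hD := inI_curveD _ _ _ _ hXX hY.
  have i0 := inI_tc0 _ _ _ _ hD h4; have i1 := inI_tc1 _ _ _ _ hD h5.
  by inI_tac.
have h := pos_onP 30 _ f _ _ l y sound ray_check (inI_01 l hl) (inI_01 y hy).
rewrite -subr_gt0; apply: (eq_ind _ (fun z => is_true (0 < z)) h); rewrite /f; cbv zeta beta.
have -> : ((P : RA) * ((l : RA) * l))%A = P * l ^+ 2 by rewrite /= expr2.
move: (tc0 _ _) (tc1 _ _) => a0 a1.
by move: (P : R) => p; rewrite /ray_form /=; field.
Qed.

Lemma ratio_pos D : - (247 / 25) <= D <= 247 / 25 -> c1 D < 5 * (c2 D - c3 D).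
Proof.
move=> /andP[D0 D1].
have [|e4 [e5 [h4 h5 [_ _ -> [-> _ ->]]]]] := @stumpff_taylor R D.
  by rewrite ler_norml; apply/andP; split; lra.
pose f (D _ : R) : R := let D := D : RA in
  ((5/1) * (tc2 D e4 - tc3 D e5) - tc1 D e5)%A.
have sound X Y x z : inI X x -> inI Y z -> inI (ratio_itvl X Y) (f x z).
  move=> hX _; rewrite /ratio_itvl /f.
  have i1 := inI_tc1 _ _ _ _ hX h5.
  have i2 := inI_tc2 _ _ _ _ hX h4; have i3 := inI_tc3 _ _ _ _ hX h5.
  by inI_tac.
have iD : inI (itvl_of (-247) 25 247 25) D.
  apply: inI_itvl.
    by rewrite [X in X <= _](_ : _ = - (247 / 25)) //=; field.
  by rewrite [X in _ <= X](_ : _ = 247 / 25) //=; field.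
have h := pos_onP 30 _ f _ _ D 0 sound ratio_check iD inI_0.
rewrite -subr_gt0; apply: (eq_ind _ (fun z => is_true (0 < z)) h); rewrite /f; cbv zeta beta.
by move: (tc1 _ _) (tc2 _ _) (tc3 _ _) => a1 a2 a3; rewrite /=; field.
Qed.

Lemma gap_pos y D : 1 / 10 <= y <= 1 -> D = P * (1 - 2 * y) -> T * y * c1 D < c0 D.
Proof.
move=> /andP[y0 y1] ->; rewrite -curveD_real.
have hy : 0 <= y <= 1 by apply/andP; split; lra.
have [e4 [e5 [h4 h5 [_ _ _ [_ -> ->]]]]] := curve_taylor y hy.
pose f (y _ : R) : R := let D := curveD (P : RA) y in
  (tc0 D e4 - (T : RA) * (y : RA) * tc1 D e5)%A.
have sound X Y x z : inI X x -> inI Y z -> inI (gap_itvl X Y) (f x z).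
  move=> hX _; rewrite /gap_itvl /f.
  have hP := inI_P; have hT := inI_T; have hD := inI_curveD _ _ _ _ hP hX.
  have i0 := inI_tc0 _ _ _ _ hD h4; have i1 := inI_tc1 _ _ _ _ hD h5.
  by inI_tac.
have iy : inI (itvl_of 1 10 1 1) y.
  apply: inI_itvl; last by rewrite /=; lra.
  by rewrite [X in X <= _](_ : _ = 1 / 10) //=; field.
have h := pos_onP 30 _ f _ _ y 0 sound gap_check iy inI_0.
rewrite -subr_gt0; apply: (eq_ind _ (fun z => is_true (0 < z)) h); rewrite /f; cbv zeta beta.
by move: (tc0 _ _) (tc1 _ _) => a0 a1; rewrite /=; field.
Qed.

(** This compares the derivatives of [cvX] and [cvU] near [y = 0], where both functions vanish. The
    constant 1.419 is large enough for (1.419 - 1) / (1.419 + 1) = 419/2419 times [K ^ 2] to exceed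
    pi^2. *)
Lemma start_pos y D : 0 <= y <= 1 / 10 -> D = P * (1 - 2 * y) ->
  1419 / 1000 * (c1 D + P * y * (c2 D - c3 D)) < T * c1 D.
Proof.
move=> /andP[y0 y1] ->; rewrite -curveD_real.
have hy : 0 <= y <= 1 by apply/andP; split; lra.
have [e4 [e5 [h4 h5 [_ _ -> [-> _ ->]]]]] := curve_taylor y hy.
pose f (y _ : R) : R := let D := curveD (P : RA) y in
  ((T : RA) * tc1 D e5 - (1419/1000) * (tc1 D e5 + (P : RA) * (y : RA) * (tc2 D e4 - tc3 D e5)))%A.
have sound X Y x z : inI X x -> inI Y z -> inI (start_itvl X Y) (f x z).
  move=> hX _; rewrite /start_itvl /f.
  have hP := inI_P; have hT := inI_T; have hD := inI_curveD _ _ _ _ hP hX.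
  have i1 := inI_tc1 _ _ _ _ hD h5.
  have i2 := inI_tc2 _ _ _ _ hD h4; have i3 := inI_tc3 _ _ _ _ hD h5.
  by inI_tac.
have iy : inI (itvl_of 0 1 1 10) y.
  apply: inI_itvl; first by rewrite /=; lra.
  by rewrite [X in _ <= X](_ : _ = 1 / 10) //=; field.
have h := pos_onP 30 _ f _ _ y 0 sound start_check iy inI_0.
rewrite -subr_gt0; apply: (eq_ind _ (fun z => is_true (0 < z)) h); rewrite /f; cbv zeta beta.
by move: (tc1 _ _) (tc2 _ _) (tc3 _ _) => a1 a2 a3; rewrite /=; field.
Qed.

End Positivity.

(** * Hyperbolic functions *)

Section Hyperbolic.
Context {R : realType}.
Implicit Types (x y u : R).

Definition sinh x : R := (expR x - expR (- x)) / 2.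
Definition cosh x : R := (expR x + expR (- x)) / 2.
Definition asinh u : R := ln (u + Num.sqrt (1 + u ^+ 2)).

Lemma expRNE x : expR x * expR (- x) = 1.
Proof. by rewrite -expRD subrr expR0. Qed.

Lemma cosh2 x : cosh x ^+ 2 = 1 + sinh x ^+ 2.
Proof. by have := expRNE x; rewrite /cosh /sinh => h; field: h. Qed.

Lemma cosh_ge1 x : 1 <= cosh x.
Proof.
have e0 := expR_gt0 x; have e1 := expR_gt0 (- x); have := expRNE x.
rewrite /cosh; move: (expR x) (expR (- x)) e0 e1 => a b a0 b0 ab.
rewrite leNgt; apply/negP => h; have := sqr_ge0 (a - b).
by have : (a + b) * (a + b) < 2 * 2; [nra|nra].
Qed.

Lemma cosh_gt0 x : 0 < cosh x.
Proof. exact: lt_le_trans ltr01 (cosh_ge1 x). Qed.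

Lemma sinh0 : sinh 0 = 0.
Proof. by rewrite /sinh oppr0 subrr mul0r. Qed.

Lemma ltr_sinh : {mono sinh : x y / x < y}.
Proof.
apply: leW_mono; apply: le_mono => x y xy; rewrite /sinh ltr_pM2r ?invr_gt0 //.
by rewrite ltrB // ltr_expR ?ltrN2.
Qed.

Lemma ler_sinh : {mono sinh : x y / x <= y}.
Proof. by move=> x y; rewrite !leNgt ltr_sinh. Qed.

Lemma sinh_ge0 x : (0 <= sinh x) = (0 <= x).
Proof. by rewrite -{1}sinh0 ler_sinh. Qed.

Lemma sinh_gt0 x : (0 < sinh x) = (0 < x).
Proof. by rewrite -{1}sinh0 ltr_sinh. Qed.

Lemma sinhD x y : sinh (x + y) = sinh x * cosh y + cosh x * sinh y.
Proof. by rewrite /sinh /cosh opprD !expRD; field. Qed.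

Lemma sqrt1D_gt0 u : 0 < Num.sqrt (1 + u ^+ 2).
Proof. by rewrite sqrtr_gt0; have := sqr_ge0 u; lra. Qed.

Lemma asinh_arg_gt0 u : 0 < u + Num.sqrt (1 + u ^+ 2).
Proof.
have s0 := sqrt1D_gt0 u.
have h : Num.sqrt (1 + u ^+ 2) ^+ 2 = 1 + u ^+ 2 by rewrite sqr_sqrtr //; have := sqr_ge0 u; lra.
by rewrite ltNge; apply/negP => hu; nra.
Qed.

Lemma asinhK : cancel asinh sinh.
Proof.
move=> u; rewrite /sinh /asinh expRN lnK ?posrE ?asinh_arg_gt0 //.
have s0 := asinh_arg_gt0 u.
have h : Num.sqrt (1 + u ^+ 2) ^+ 2 = 1 + u ^+ 2 by rewrite sqr_sqrtr //; have := sqr_ge0 u; lra.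
move: (Num.sqrt _) h s0 => s h s0.
have -> : (u + s)^-1 = s - u.
  by apply: (mulfI (lt0r_neq0 s0)); rewrite mulfV ?lt0r_neq0 //; lra.
by field.
Qed.

Lemma sinhK : cancel sinh asinh.
Proof.
move=> x; have := asinhK (sinh x).
by move/eqP; rewrite eq_le !ler_sinh -eq_le => /eqP.
Qed.

Lemma cosh_asinh u : cosh (asinh u) = Num.sqrt (1 + u ^+ 2).
Proof.
by rewrite -[u in RHS]asinhK -cosh2 sqrtr_sqr ger0_norm // ltW // cosh_gt0.
Qed.

Lemma ler_asinh : {mono asinh : x y / x <= y}.
Proof. by move=> x y; rewrite -ler_sinh !asinhK. Qed.

Lemma asinh0 : asinh 0 = 0.
Proof. by rewrite -[X in asinh X]sinh0 sinhK. Qed.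

Lemma der_asinh (g : R -> R) x dg : der g x dg ->
  der (fun x => asinh (g x)) x (dg / Num.sqrt (1 + g x ^+ 2)).
Proof.
move=> hg; rewrite /asinh; have s0 := sqrt1D_gt0 (g x).
have p0 : 0 < 1 + g x ^+ 2 by have := sqr_ge0 (g x); lra.
apply: der_eq.
  apply: der_ln; first exact: asinh_arg_gt0.
  apply: (der_add _ _ _ _ _ hg); apply: der_sqrt => //; apply: der_add; first exact: der_cst.
  exact: (der_sqr _ _ _ hg).
have := lt0r_neq0 (asinh_arg_gt0 (g x)).
by move: (Num.sqrt _) (lt0r_neq0 s0) => s hs hu; field; rewrite hu hs.
Qed.

End Hyperbolic.

(** * Signs and monotonicity of the Stumpff functions *)

Section StumpffSigns.
Context {R : realType}.
Implicit Types (D x : R).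
Local Notation T := (pi / 2 : R).
Local Notation c0 := (@stumpff R 0).
Local Notation c1 := (@stumpff R 1).
Local Notation c2 := (@stumpff R 2).
Local Notation c3 := (@stumpff R 3).

Lemma stumpff0_cosh x : c0 (- x ^+ 2) = cosh x.
Proof. exact: stumpff_cosh. Qed.

Lemma stumpff1_sinh x : x * c1 (- x ^+ 2) = sinh x.
Proof. exact: stumpff_sinh. Qed.

Lemma stumpff1_gt0 D : D < pi ^+ 2 -> 0 < c1 D.
Proof.
case: (ltrgtP D 0) => [D0 _|D0 hD|-> _]; last by rewrite stumpff0 invr1.
- have x0 : 0 < Num.sqrt (- D) by rewrite sqrtr_gt0 oppr_gt0.
  have := stumpff1_sinh (Num.sqrt (- D)); rewrite sqr_sqrtr ?oppr_ge0 ?ltW // opprK => h.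
  by rewrite -(pmulr_rgt0 _ x0) h sinh_gt0.
- have x0 : 0 < Num.sqrt D by rewrite sqrtr_gt0.
  have := proj2 (stumpff_cos_sin (Num.sqrt D)); rewrite sqr_sqrtr ?ltW // => h.
  rewrite -(pmulr_rgt0 _ x0) h sin_gt0_pi // x0 /=.
  by rewrite -(@ltr_pXn2r _ 2) ?nnegrE ?pi_ge0 ?sqrtr_ge0 // sqr_sqrtr // ltW.
Qed.

Lemma stumpff0_decr D D' : D < D' -> D' <= pi ^+ 2 -> c0 D' < c0 D.
Proof.
move=> DD' hD'; rewrite -ltrN2.
apply: (der_incr (fun x => - c0 x) (fun x => c1 x / 2)) DD' _ _ => x hx.
  by der_auto; field.
by rewrite divr_gt0 // stumpff1_gt0 //; lra.
Qed.

Lemma stumpff0_decr_le D D' : D <= D' -> D' <= pi ^+ 2 -> c0 D' <= c0 D.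
Proof. by rewrite le_eqVlt => /predU1P[->//|h] h'; apply/ltW/stumpff0_decr. Qed.

Lemma pi2_bound : pi ^+ 2 < 247 / 25 :> R.
Proof.
by have /andP[_ h] := @sqr_pihalf_bounds R; rewrite [X in X < _](_ : _ = 4 * T ^+ 2); [lra|field].
Qed.

(** The derivative of [c1] is [(c3 - c2) / 2], so this gives the monotonicity of [c1] together with
    a rate; the factor 5 is what the trade of angle against trace consumes. *)
Lemma stumpff23_gt D : - pi ^+ 2 <= D <= pi ^+ 2 -> c1 D < 5 * (c2 D - c3 D).
Proof. by move=> hD; apply: ratio_pos; have := pi2_bound; lra. Qed.

Lemma stumpff1_decr_le D D' : - pi ^+ 2 <= D -> D <= D' -> D' <= pi ^+ 2 -> c1 D' <= c1 D.
Proof.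
move=> hD DD' hD'; rewrite -lerN2.
apply: (der_nondecr (fun x => - c1 x) (fun x => (c2 x - c3 x) / 2)) DD' _ _ => x hx.
  by der_auto; field.
have := @stumpff1_gt0 x; have := @stumpff23_gt x; lra.
Qed.

Lemma stumpff0_ge0 D : D <= T ^+ 2 -> 0 <= c0 D.
Proof.
move=> hD; have <- : c0 (T ^+ 2) = 0 by rewrite (proj1 (stumpff_cos_sin _)) cos_pihalf.
apply: stumpff0_decr_le hD _; rewrite -[pi](_ : 2 * T = _); last by field.
by have := sqr_ge0 T; rewrite exprMn; lra.
Qed.

(* For [D = 0] this is the limit of [sin^2 = (1 - cos) (1 + cos)] divided by [D]. *)
Lemma stumpff1_sqr D : c1 D ^+ 2 = c2 D * (1 + c0 D).
Proof.
have [->|D0] := eqVneq D 0.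
  have f2 : 2`!%:R = 2 :> R by [].
  by rewrite !stumpff0 f2 -[0`!]/1%N -[1`!]/1%N; field.
have := stumpff_cos2_sin2 D; have h2 := stumpff0E D.
move=> h; apply: (mulfI D0).
have -> : D * (c2 D * (1 + c0 D)) = (1 - c0 D) * (1 + c0 D) by rewrite {2}h2; ring.
by lra.
Qed.

Lemma stumpff3_gt0 D : `|D| <= 247 / 100 -> 0 < c3 D.
Proof.
move=> hD; have [|e4 [e5 [_ /inI_unit h5 [_ E5 _ _]]]] := @stumpff_taylor R D; first lra.
rewrite stumpffE; have f3 : 3`!%:R = 6 :> R by [].
rewrite f3 subr_gt0; have b5 : `|stumpff 5 D| <= 2 / 5`!%:R by apply: stumpff_bound => //; lra.
have f5 : 5`!%:R = 120 :> R by [].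
rewrite f5 in b5; have : D * stumpff 5 D <= 247 / 100 * (2 / 120).
  by apply: (le_trans (ler_norm _)); rewrite normrM ler_pM.
by lra.
Qed.

(** This is the existence of a principal logarithm: [x] is half the trace of a unimodular matrix,
    and [D] the determinant of its traceless logarithm. Uniqueness comes from the strict decrease of
    [c0]. *)
Lemma stumpff0_onto x : -1 < x -> exists2 D, D < pi ^+ 2 & c0 D = x.
Proof.
move=> x1; case: (leP x 1) => hx.
- exists (acos x ^+ 2).
    rewrite ltr_pXn2r ?nnegrE ?pi_ge0 ?acos_ge0 ?acos_ltpi ?x1 //.
    by rewrite ltW.
  by rewrite (proj1 (stumpff_cos_sin _)) acosK // in_itv /= hx ltW.
- exists (- asinh (Num.sqrt (x ^+ 2 - 1)) ^+ 2).
    have := sqr_ge0 (asinh (Num.sqrt (x ^+ 2 - 1))); have := pi_gt0 R.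
    by move=> p0 h; have := exprn_gt0 2 p0; lra.
  rewrite stumpff0_cosh cosh_asinh sqr_sqrtr; last by nra.
  by rewrite addrC subrK sqrtr_sqr ger0_norm //; lra.
Qed.

End StumpffSigns.

(** * The boundary family of exponentials *)

Section Gap.
Context {R : realType}.
Implicit Types (X Y U x : R).

(* For [X^2 + Y^2 = 1 + U^2] this is [pi / 2] minus the largest argument on the circle
   of centre [X + i Y] and radius [U], i.e. minus the argument of [(X + i Y) (1 + i U)]. *)
Definition gap X Y U : R := atan ((X - Y * U) / (X * U + Y)).

(** Minus the gap is, up to a constant, the argument of X + i Y plus [atan] of U. Their derivatives
    have denominators X^2 + Y^2 and 1 + U^2, which agree by hypothesis. *)
Lemma der_gap (fX fY fU : R -> R) x dX dY dU :
  fX x ^+ 2 + fY x ^+ 2 = 1 + fU x ^+ 2 -> fX x * fU x + fY x != 0 ->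
  der fX x dX -> der fY x dY -> der fU x dU ->
  der (fun x => gap (fX x) (fY x) (fU x)) x
    (- (fX x * dY - fY x * dX + dU) / (1 + fU x ^+ 2)).
Proof.
move=> hE hM hX hY hU; rewrite /gap; apply: der_eq.
  apply: der_atan; apply: der_mul; last first.
    by apply: der_inv; [exact: hM|apply: der_add; [apply: der_mul; eassumption|exact: hY]].
  by apply: der_add; [exact: hX|apply: der_opp; apply: der_mul; eassumption].
have u0 : 1 + fU x ^+ 2 != 0 by apply: lt0r_neq0; have := sqr_ge0 (fU x); lra.
have e0 : (fX x * fU x + fY x) ^+ 2 + (fX x - fY x * fU x) ^+ 2 != 0.
  have -> : (fX x * fU x + fY x) ^+ 2 + (fX x - fY x * fU x) ^+ 2 =
    (fX x ^+ 2 + fY x ^+ 2) * (1 + fU x ^+ 2) by ring.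
  by rewrite hE mulf_neq0.
have E : (fX x * fU x + fY x) ^+ 2 + (fX x - fY x * fU x) ^+ 2 = (1 + fU x ^+ 2) ^+ 2.
  by transitivity ((fX x ^+ 2 + fY x ^+ 2) * (1 + fU x ^+ 2)); [ring|rewrite hE; ring].
move: (fX x) (fY x) (fU x) hE hM u0 e0 E => X Y U hE hM u0 e0 E.
have -> : (1 + ((X - Y * U) / (X * U + Y)) ^+ 2)^-1 = (X * U + Y) ^+ 2 / (1 + U ^+ 2) ^+ 2.
  by rewrite -E; field; rewrite hM e0.
have h1 : (X * U + Y) ^+ 2 / (1 + U ^+ 2) ^+ 2 *
  ((X - Y * U) * (- (X * dU + U * dX + dY) / (X * U + Y) ^+ 2) +
   (X * U + Y)^-1 * (dX + - (Y * dU + U * dY))) =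
  - ((X * dY - Y * dX) * (1 + U ^+ 2) + (X ^+ 2 + Y ^+ 2) * dU) / (1 + U ^+ 2) ^+ 2.
  by field; rewrite hM u0.
by rewrite h1 hE; field.
Qed.

Lemma gap_cos_sin X Y U : X ^+ 2 + Y ^+ 2 = 1 + U ^+ 2 -> 0 < X * U + Y ->
  cos (gap X Y U) = (X * U + Y) / (1 + U ^+ 2) /\
  sin (gap X Y U) = (X - Y * U) / (1 + U ^+ 2).
Proof.
move=> hE hM; rewrite /gap; set z := _ / _.
have u0 : 0 < 1 + U ^+ 2 by have := sqr_ge0 U; lra.
have E : (X * U + Y) ^+ 2 + (X - Y * U) ^+ 2 = (1 + U ^+ 2) ^+ 2.
  by transitivity ((X ^+ 2 + Y ^+ 2) * (1 + U ^+ 2)); [ring|rewrite hE; ring].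
have cE : cos (atan z) = (X * U + Y) / (1 + U ^+ 2).
  rewrite cos_atan; have -> : 1 + z ^+ 2 = ((1 + U ^+ 2) / (X * U + Y)) ^+ 2.
    rewrite /z !exprMn !exprVn -E; field; exact: lt0r_neq0.
  by rewrite sqrtr_sqr ger0_norm ?divr_ge0 ?ltW // invf_div.
split=> //.
have c0 : cos (atan z) != 0.
  by rewrite cE mulf_neq0 ?invr_eq0 ?lt0r_neq0.
have -> : sin (atan z) = tan (atan z) * cos (atan z) by rewrite /tan mulfVK.
by rewrite atanK cE /z; field; rewrite !lt0r_neq0.
Qed.

End Gap.

Section Curve.
Context {R : realType}.
Implicit Types (x y u D : R).
Local Notation T := (pi / 2 : R).
Local Notation P := (T ^+ 2 : R).
Local Notation K := (T * expR T).
Local Notation c0 := (@stumpff R 0).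
Local Notation c1 := (@stumpff R 1).
Local Notation c2 := (@stumpff R 2).
Local Notation c3 := (@stumpff R 3).
Local Notation c4 := (@stumpff R 4).
Local Notation c5 := (@stumpff R 5).

(* The exponential of the matrix with rotation part [b = T (1 - y)] and symmetric part of
   norm [s = T y] has complex coordinates [X + i Y] (conformal part) and modulus [U]
   (anticonformal part). *)
Definition cvD y := P * (1 - 2 * y).
Definition cvX y := c0 (cvD y).
Definition cvY y := T * (1 - y) * c1 (cvD y).
Definition cvU y := T * y * c1 (cvD y).
Definition cvr y := asinh (cvU y).
Definition cvH y := gap (cvX y) (cvY y) (cvU y).

Let T0 : 0 < T. Proof. by have /andP[h _] := @pihalf_bounds R; lra. Qed.
Let P0 : 0 < P. Proof. exact: exprn_gt0. Qed.

Lemma cvD_bounds y : 0 <= y <= 1 -> - P <= cvD y <= P.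
Proof. by move=> /andP[y0 y1]; rewrite /cvD; apply/andP; split; nra. Qed.

Let piE : pi ^+ 2 = 4 * P. Proof. by field. Qed.

Lemma cvD_pi y : 0 <= y <= 1 -> - pi ^+ 2 < cvD y < pi ^+ 2.
Proof.
by move=> hy; have := cvD_bounds y hy; rewrite piE; have := P0; lra.
Qed.

Lemma cv_norm y : cvX y ^+ 2 + cvY y ^+ 2 = 1 + cvU y ^+ 2.
Proof.
rewrite -[in RHS](stumpff_cos2_sin2 (cvD y)) /cvX /cvY /cvU /cvD; ring.
Qed.

Lemma cv_c1_gt0 y : 0 <= y <= 1 -> 0 < c1 (cvD y).
Proof. by move=> hy; apply: stumpff1_gt0; have := cvD_pi y hy; lra. Qed.

Lemma cvX_ge0 y : 0 <= y <= 1 -> 0 <= cvX y.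
Proof. by move=> hy; apply: stumpff0_ge0; have := cvD_bounds y hy; lra. Qed.

Lemma cvX_gt0 y : 0 < y <= 1 -> 0 < cvX y.
Proof.
move=> /andP[y0 y1]; apply: (@le_lt_trans _ _ (c0 P)); first exact: stumpff0_ge0.
apply: stumpff0_decr; first by rewrite /cvD; have := P0; nra.
by rewrite piE; have := P0; lra.
Qed.

Lemma cvY_ge0 y : 0 <= y <= 1 -> 0 <= cvY y.
Proof.
move=> hy; have /andP[y0 y1] := hy.
by apply: mulr_ge0; [apply: mulr_ge0; [exact: ltW T0|lra]|exact/ltW/cv_c1_gt0].
Qed.

Lemma cvU_ge0 y : 0 <= y <= 1 -> 0 <= cvU y.
Proof.
move=> hy; have /andP[y0 y1] := hy.
by apply: mulr_ge0; [apply: mulr_ge0; [exact: ltW T0|lra]|exact/ltW/cv_c1_gt0].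
Qed.

Lemma cvU_gt0 y : 0 < y <= 1 -> 0 < cvU y.
Proof.
move=> /andP[y0 y1]; apply: mulr_gt0; first by apply: mulr_gt0; [exact: T0|].
by apply: cv_c1_gt0; rewrite ltW.
Qed.

Lemma cv_gap_den y : 0 <= y <= 1 -> 0 < cvX y * cvU y + cvY y.
Proof.
move=> /andP[y0]; rewrite le_eqVlt => /predU1P[->|y1].
  rewrite ltr_wpDr //; first by apply: cvY_ge0; rewrite ler01 lexx.
  by rewrite mulr_gt0 ?cvX_gt0 ?cvU_gt0 // ltr01 lexx.
have hy : 0 <= y <= 1 by rewrite y0 ltW.
apply: ltr_wpDl; first by apply: mulr_ge0; [exact: cvX_ge0|exact: cvU_ge0].
by apply: mulr_gt0; [apply: mulr_gt0; [exact: T0|lra]|exact: cv_c1_gt0].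
Qed.

Lemma cv0 : [/\ cvX 0 = 0, cvY 0 = 1, cvU 0 = 0, cvr 0 = 0 & cvH 0 = 0].
Proof.
have [h0 h1] := stumpff_cos_sin T; rewrite cos_pihalf in h0; rewrite sin_pihalf in h1.
have hD : cvD 0 = P by rewrite /cvD; ring.
have X0 : cvX 0 = 0 by rewrite /cvX hD.
have U0 : cvU 0 = 0 by rewrite /cvU mulr0 mul0r.
split=> //; first by rewrite /cvY hD subr0 mulr1.
  by rewrite /cvr U0 asinh0.
by rewrite /cvH /gap X0 U0 mulr0 subr0 mul0r atan0.
Qed.

Lemma cv1 : [/\ cvX 1 = cosh T, cvY 1 = 0, cvU 1 = sinh T & cvr 1 = T].
Proof.
have hD : cvD 1 = - T ^+ 2 by rewrite /cvD; ring.
have hU : cvU 1 = sinh T by rewrite /cvU hD mulr1 stumpff1_sinh.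
split=> //; first by rewrite /cvX hD stumpff0_cosh.
  by rewrite /cvY subrr mulr0 mul0r.
by rewrite /cvr hU sinhK.
Qed.

(** Up to positive factors, [cvn] and [cvm] are the derivatives of [cvU] and [cvH]. *)
Definition cvn y := c1 (cvD y) + P * y * (c2 (cvD y) - c3 (cvD y)).
Definition cvm y := 1 - y + y * cvX y.

Lemma cv_c23_gt0 y : 0 <= y <= 1 -> 0 < c2 (cvD y) - c3 (cvD y).
Proof.
move=> hy; have h1 := cv_c1_gt0 y hy; have := @stumpff23_gt R (cvD y).
by have := cvD_pi y hy; lra.
Qed.

Lemma cvn_gt0 y : 0 <= y <= 1 -> 0 < cvn y.
Proof.
move=> hy; have /andP[y0 y1] := hy; rewrite /cvn ltr_wpDr ?cv_c1_gt0 //.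
by apply: mulr_ge0; [apply: mulr_ge0; [exact: ltW P0|lra]|exact/ltW/cv_c23_gt0].
Qed.

Lemma cvm_gt0 y : 0 <= y <= 1 -> 0 < cvm y.
Proof.
move=> hy; have /andP[y0 y1] := hy; rewrite /cvm.
have := cvX_ge0 y hy; move: y1; rewrite le_eqVlt => /predU1P[->|y1].
  by have := @cvX_gt0 1; rewrite ltr01 lexx => /(_ isT); lra.
by move=> h; have : 0 <= y * cvX y; [rewrite mulr_ge0|lra].
Qed.

Lemma der_cvX y : der cvX y (P * c1 (cvD y)).
Proof. by rewrite /cvX /cvD; der_auto; field. Qed.

Lemma der_cvU y : der cvU y (T * cvn y).
Proof. by rewrite /cvU /cvn /cvD; der_auto; field. Qed.

Lemma der_cvY y : der cvY y (- T * (c1 (cvD y) - P * (1 - y) * (c2 (cvD y) - c3 (cvD y)))).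
Proof. by rewrite /cvY /cvD; der_auto; field. Qed.

Lemma der_cvr y : der cvr y (T * cvn y / Num.sqrt (1 + cvU y ^+ 2)).
Proof. exact/der_asinh/der_cvU. Qed.

Lemma der_cvH y : 0 <= y <= 1 -> der cvH y (T * P * c3 (cvD y) * cvm y / (1 + cvU y ^+ 2)).
Proof.
move=> hy; apply: der_eq.
  apply: (der_gap cvX cvY cvU); [exact: cv_norm|exact/lt0r_neq0/cv_gap_den|exact: der_cvX
    |exact: der_cvY|exact: der_cvU].
congr (_ / _); rewrite /cvn /cvm /cvX /cvY.
have h0 := stumpff0E (cvD y); have h1 := stumpff1E (cvD y); have h2 := stumpff1_sqr (cvD y).
have hD : cvD y = P * (1 - 2 * y) by [].
move: (cvD y) (c0 _) (c1 _) (c2 _) (c3 _) h0 h1 h2 hD => D a0 a1 a2 a3 h0 h1 h2 hD.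
apply/eqP; rewrite -subr_eq0; apply/eqP.
(* The difference is a combination of the recursions for [c1] and [c0] and of
   [c1 ^ 2 = c2 (1 + c0)]; each bracket vanishes. *)
transitivity (T * ((a0 - 1) * (a1 - (1 - D * a3)) - ((1 - D * a2) - a0) +
  P * (1 - y) * (a1 ^+ 2 - a2 * (1 + a0)))); first by rewrite hD; ring.
by rewrite -h0 -h1 -h2 !subrr !mulr0 subr0 addr0 mulr0.
Qed.


(* [cvN] is the derivative of [cvH] with respect to [cvr]; its square is rational in the
   Stumpff functions. *)
Definition cvM y := (c3 (cvD y) * cvm y) ^+ 2 / ((1 + cvU y ^+ 2) * cvn y ^+ 2).
Definition cvN y := P * Num.sqrt (cvM y).

Lemma cv_c3_gt0 y : 0 <= y <= 1 -> 0 < c3 (cvD y).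
Proof.
move=> hy; apply: stumpff3_gt0; have := cvD_bounds y hy; have := @sqr_pihalf_bounds R.
by rewrite ler_norml => h1 h2; apply/andP; split; lra.
Qed.

Lemma cv1DU_gt0 y : 0 < 1 + cvU y ^+ 2.
Proof. by have := sqr_ge0 (cvU y); lra. Qed.

Lemma cvNE y : 0 <= y <= 1 ->
  cvN y = P * c3 (cvD y) * cvm y / (Num.sqrt (1 + cvU y ^+ 2) * cvn y).
Proof.
move=> hy; have h1 := cv1DU_gt0 y; have hn := cvn_gt0 y hy.
have hc : 0 < c3 (cvD y) * cvm y by rewrite mulr_gt0 ?cv_c3_gt0 ?cvm_gt0.
rewrite /cvN /cvM sqrtrM ?sqr_ge0 // sqrtr_sqr ger0_norm ?(ltW hc) // sqrtrV; last first.
  by rewrite mulr_ge0 ?sqr_ge0 ?ltW.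
by rewrite sqrtrM ?ltW // sqrtr_sqr ger0_norm ?(ltW hn) // !mulrA.
Qed.

Lemma cvN_gt0 y : 0 <= y <= 1 -> 0 < cvN y.
Proof.
move=> hy; rewrite cvNE //; apply: divr_gt0; apply: mulr_gt0.
- by apply: mulr_gt0; [exact: P0|exact: cv_c3_gt0].
- exact: cvm_gt0.
- exact: sqrt1D_gt0.
- exact: cvn_gt0.
Qed.

Lemma cvM_decr y y' : 0 <= y -> y <= y' -> y' <= 1 -> cvM y' <= cvM y.
Proof.
move=> y0 yy' y1; rewrite -lerN2.
pose n3 x := 1 + cvU x ^+ 2.
pose dn x := P * (2 * (c2 (cvD x) - c3 (cvD x)) +
  P * x * (c3 (cvD x) - 3 * c4 (cvD x) + 3 * c5 (cvD x))).
pose dc x := P * (c4 (cvD x) - 3 * c5 (cvD x)) * cvm x +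
  c3 (cvD x) * (cvX x - 1 + P * (x * c1 (cvD x))).
pose df x := 2 * (c3 (cvD x) * cvm x) * cvn x / (n3 x * cvn x ^+ 2) ^+ 2 *
  (c3 (cvD x) * cvm x * (P * (x * c1 (cvD x)) * cvn x ^+ 2 + dn x * n3 x) - dc x * n3 x * cvn x).
apply: (der_nondecr (fun x => - cvM x) df y y' yy') => x hx.
- have hx' : 0 <= x <= 1 by apply/andP; split; lra.
  have hn : der cvn x (dn x) by rewrite /cvn /cvD /dn /cvD; der_auto; field.
  have hc : der (fun x => c3 (cvD x) * cvm x) x (dc x).
    by rewrite /cvm /cvX /dc /cvX /cvD /cvm /cvX /cvD; der_auto; field.
  have h3 : der n3 x (2 * cvU x * (T * cvn x)).
    by rewrite /n3; apply: der_eq; [apply: der_add; [exact: der_cst|exact/der_sqr/der_cvU]|rewrite add0r].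
  have a0 : n3 x != 0 by rewrite lt0r_neq0 ?cv1DU_gt0.
  have b0 : cvn x != 0 by rewrite lt0r_neq0 ?cvn_gt0.
  have d0 : n3 x * cvn x ^+ 2 != 0 by rewrite mulf_neq0 ?expf_neq0.
  rewrite /cvM; apply: der_eq.
    apply: der_opp; apply: der_mul; first exact: (der_sqr _ _ _ hc).
    by apply: der_inv; [exact: d0|apply: der_mul; [exact: h3|exact: (der_sqr _ _ _ hn)]].
  have U2 : cvU x * T = P * (x * c1 (cvD x)) by rewrite /cvU; ring.
  rewrite /df -U2 -/(n3 x); move: (n3 x) (cvn x) (dn x) (dc x) (c3 _ * _) (cvU x) a0 b0 {d0}.
  by move=> a b d e f u a0 b0; field; rewrite a0 b0.
- have hx' : 0 <= x <= 1 by apply/andP; split; lra.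
  have n30 := cv1DU_gt0 x; have hn := cvn_gt0 x hx'.
  have hc : 0 < c3 (cvD x) * cvm x by rewrite mulr_gt0 ?cv_c3_gt0 ?cvm_gt0.
  rewrite /df; apply: mulr_ge0.
    apply: divr_ge0; last exact: sqr_ge0.
    by apply: mulr_ge0; [apply: mulr_ge0; [lra|exact: ltW]|exact: ltW].
  rewrite subr_ge0; apply: ltW.
  apply: concave_pos hx' erefl erefl _ erefl.
  by rewrite /n3 /cvU; ring.
Qed.

Lemma cvN_decr y y' : 0 <= y -> y <= y' -> y' <= 1 -> cvN y' <= cvN y.
Proof.
by move=> y0 yy' y1; rewrite /cvN ler_pM2l ?P0 // ler_wsqrtr // cvM_decr.
Qed.

Lemma der_cvH_r k y : 0 <= y <= 1 -> der (fun y => cvH y - k * cvr y) y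
  ((cvN y - k) * (T * cvn y / Num.sqrt (1 + cvU y ^+ 2))).
Proof.
move=> hy; apply: der_eq.
  apply: der_add; first exact: der_cvH.
  by apply: der_opp; apply: der_mul; [exact: der_cst|exact: der_cvr].
have hs := sqrt1D_gt0 (cvU y); have hn := cvn_gt0 y hy.
have E : Num.sqrt (1 + cvU y ^+ 2) ^+ 2 = 1 + cvU y ^+ 2 by rewrite sqr_sqrtr // ltW ?cv1DU_gt0.
rewrite cvNE //; move: (Num.sqrt _) hs E => s hs <-; field.
by rewrite !lt0r_neq0.
Qed.

Lemma cvr_slope_gt0 y : 0 <= y <= 1 -> 0 < T * cvn y / Num.sqrt (1 + cvU y ^+ 2).
Proof.
move=> hy; rewrite divr_gt0 ?sqrt1D_gt0 //.
by apply: mulr_gt0; [exact: T0|exact: cvn_gt0].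
Qed.

Lemma cvr_incr y y' : 0 <= y -> y < y' -> y' <= 1 -> cvr y < cvr y'.
Proof.
move=> y0 yy' y1; apply: (der_incr cvr _ _ _ yy' (fun x _ => der_cvr x)) => x hx.
by apply: cvr_slope_gt0; apply/andP; split; lra.
Qed.

(** Concavity of H as a function of r in parametric form: the quotient [cvN] of the derivatives
    decreases, so [cvH - cvN y * cvr] is largest at [y]. *)
Lemma cvH_tangent y y' : 0 <= y <= 1 -> 0 <= y' <= 1 ->
  cvH y' - cvH y <= cvN y * (cvr y' - cvr y).
Proof.
move=> hy hy'; have /andP[y0 y1] := hy; have /andP[y0' y1'] := hy'.
have [yy'|/ltW yy'] := leP y y'.
- suff h : - (cvH y - cvN y * cvr y) <= - (cvH y' - cvN y * cvr y') by lra.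
  apply: (der_nondecr (fun x => - (cvH x - cvN y * cvr x))
    (fun x => - ((cvN x - cvN y) * (T * cvn x / Num.sqrt (1 + cvU x ^+ 2))))) yy' _ _ => x hx.
    by apply: der_opp; apply: der_cvH_r; apply/andP; split; lra.
  rewrite -mulNr; apply: mulr_ge0; last by apply/ltW/cvr_slope_gt0/andP; split; lra.
  by rewrite oppr_ge0 subr_le0; apply: cvN_decr; lra.
- suff h : cvH y' - cvN y * cvr y' <= cvH y - cvN y * cvr y by lra.
  apply: (der_nondecr (fun x => cvH x - cvN y * cvr x)
    (fun x => (cvN x - cvN y) * (T * cvn x / Num.sqrt (1 + cvU x ^+ 2)))) yy' _ _ => x hx.
    by apply: der_cvH_r; apply/andP; split; lra.
  apply: mulr_ge0; last by apply/ltW/cvr_slope_gt0/andP; split; lra.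
  by rewrite subr_ge0; apply: cvN_decr; lra.
Qed.

Lemma cvH_incr y y' : 0 <= y -> y < y' -> y' <= 1 -> cvH y < cvH y'.
Proof.
move=> y0 yy' y1; have hy : 0 <= y <= 1 by apply/andP; split; lra.
have hy' : 0 <= y' <= 1 by apply/andP; split; lra.
have := cvH_tangent y' y hy' hy; have := cvr_incr y y' y0 yy' y1; have := cvN_gt0 y' hy'.
by move=> *; nra.
Qed.

Lemma cvr_ge0 y : 0 <= y <= 1 -> 0 <= cvr y.
Proof. by move=> hy; rewrite -asinh0 ler_asinh cvU_ge0. Qed.

Lemma cvH_ge0 y : 0 <= y <= 1 -> 0 <= cvH y.
Proof.
move=> /andP[]; rewrite le_eqVlt => /predU1P[<- _|y0 y1]; first by case: cv0 => _ _ _ _ ->.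
by have [_ _ _ _ <-] := cv0; rewrite ltW // cvH_incr.
Qed.

Lemma cvH_gt0 y : 0 < y <= 1 -> 0 < cvH y.
Proof. by move=> /andP[y0 y1]; have [_ _ _ _ <-] := cv0; rewrite cvH_incr. Qed.

Lemma cvH_ge_r y : 0 <= y <= 1 -> cvN y * cvr y <= cvH y.
Proof.
move=> hy; have := cvH_tangent y 0 hy; rewrite lexx ler01 => /(_ isT).
by case: cv0 => _ _ _ -> ->; lra.
Qed.

(** The tangent at the larger radius bounds the increment of H by [cvN y1 * cvr y2]; this is at most
    [cvN y2 * cvr y2], and by concavity from the value 0 at most [cvH y2]. *)
Lemma cvH_subadd y1 y2 y3 : 0 <= y1 <= 1 -> 0 <= y2 <= 1 -> 0 <= y3 <= 1 ->
  cvr y3 <= cvr y1 + cvr y2 -> cvH y3 <= cvH y1 + cvH y2.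
Proof.
wlog y12 : y1 y2 / y2 <= y1 => [wl h1 h2 h3 hr|h1 h2 h3 hr].
  have [/wl|/ltW /wl] := leP y2 y1; first exact.
  by rewrite [cvH y1 + _]addrC; apply => //; rewrite addrC.
have := cvH_tangent y1 y3 h1 h3; have := cvH_ge_r y2 h2.
have /andP[? ?] := h1; have /andP[? ?] := h2.
have := cvN_decr y2 y1; have := cvr_ge0 y2 h2; have := cvN_gt0 y1 h1 => n0 r0 /(_ _ y12) nn hr2 ht.
have {}nn : cvN y1 <= cvN y2 by apply: nn.
have : cvN y1 * cvr y2 <= cvN y2 * cvr y2 by rewrite ler_wpM2r.
have : cvN y1 * (cvr y3 - cvr y1) <= cvN y1 * cvr y2 by rewrite ler_pM2l //; lra.
by lra.
Qed.

Lemma cvH_chord y : 0 <= y <= 1 -> cvr y * cvH 1 <= T * cvH y.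
Proof.
move=> hy; have h1 : (0 <= (1 : R)) && ((1 : R) <= 1) by rewrite ler01 lexx.
have := cvH_tangent y 1 hy h1; have := cvH_ge_r y hy; have [_ _ _ ->] := cv1.
have := cvr_ge0 y hy => r0 hr ht.
have rT : cvr y <= T.
  have [_ _ _ <-] := cv1; have /andP[_] := hy.
  by rewrite le_eqVlt => /predU1P[->//|y1]; rewrite ltW // cvr_incr //; case/andP: hy.
have : cvr y * cvH 1 <= cvr y * (cvH y + cvN y * (T - cvr y)) by rewrite ler_wpM2l //; lra.
have : (T - cvr y) * (cvN y * cvr y) <= (T - cvr y) * cvH y by rewrite ler_wpM2l // subr_ge0.
by nra.
Qed.

End Curve.

(** * The logarithm along the boundary family *)

Section Levels.
Context {R : realType}.
Implicit Types (x y u D : R).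
Local Notation T := (pi / 2 : R).
Local Notation P := (T ^+ 2 : R).
Local Notation K := (T * expR T).
Local Notation c0 := (@stumpff R 0).
Local Notation c1 := (@stumpff R 1).
Local Notation c2 := (@stumpff R 2).
Local Notation c3 := (@stumpff R 3).

Let T0 : 0 < T. Proof. by have /andP[h _] := @pihalf_bounds R; lra. Qed.
Let K0 : 0 < K. Proof. by have /andP[h _] := @level_bounds R; lra. Qed.
Let piE : pi = 2 * T. Proof. by field. Qed.

(** As [y] tends to 0 the ratio of [cvX] to [cvU] tends to [T > 1]. For small [y] this keeps the
    square root away from 0, and the right side of [acos_cvY] already exceeds pi, the largest value
    of [acos]. *)
Lemma cvX_gt_U y : 0 < y <= 1 -> cvU y < cvX y /\
  (y < 1 / 10 -> pi <= K * Num.sqrt ((cvX y - cvU y) / (cvX y + cvU y))).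
Proof.
move=> hy; have /andP[y0 y1] := hy.
have U0 := cvU_gt0 y hy; have X0 := cvX_gt0 y hy.
case: (ltP y (1 / 10)) => hy10; last first.
  split=> //; rewrite /cvU /cvX.
  by apply: gap_pos => //; rewrite hy10.
have h : 1419 / 1000 * cvU y <= cvX y.
  rewrite -subr_ge0; have [X00 _ U00 _ _] := @cv0 R.
  have -> : 0 = cvX 0 - 1419 / 1000 * cvU 0 :> R by rewrite X00 U00; ring.
  apply: (der_nondecr (fun y => cvX y - 1419 / 1000 * cvU y)
    (fun y => T * (T * c1 (cvD y) - 1419 / 1000 * cvn y)) _ _ (ltW y0)) => x hx.
    apply: der_eq.
      by apply: der_add; [exact: der_cvX|apply: der_opp; apply: der_mul; [exact: der_cst|exact: der_cvU]].
    by cbv beta; field.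
  apply: mulr_ge0; first exact: ltW.
  by rewrite subr_ge0; apply/ltW/start_pos => //; apply/andP; split; lra.
split=> [|_]; first by lra.
have q0 : 419 / 2419 <= (cvX y - cvU y) / (cvX y + cvU y).
  by rewrite ler_pdivlMr; lra.
have Kq : pi ^+ 2 <= K ^+ 2 * ((cvX y - cvU y) / (cvX y + cvU y)).
  have := @pi2_bound R; have /andP[k1 _] := @sqr_level_bounds R => hp.
  have : K ^+ 2 * (419 / 2419) <= K ^+ 2 * ((cvX y - cvU y) / (cvX y + cvU y)).
    by rewrite ler_wpM2l ?sqr_ge0.
  lra.
rewrite -(@ler_pXn2r _ 2) ?nnegrE ?pi_ge0 //.
  by rewrite exprMn sqr_sqrtr //; apply: le_trans q0; lra.
by rewrite mulr_ge0 ?sqrtr_ge0 // ltW.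
Qed.

Lemma cvY_lt1 y : 0 < y <= 1 -> 0 <= cvY y < 1.
Proof.
move=> hy; have /andP[y0 y1] := hy; have hy' : 0 <= y <= 1 by rewrite ltW.
have Y0 := cvY_ge0 y hy'; rewrite Y0 /=.
have [h _] := cvX_gt_U y hy; have U0 := cvU_gt0 y hy; have := cv_norm y.
by move=> e; nra.
Qed.

(** After multiplication by exp(T Itil), that is by i, the conformal part becomes - Y + i X. With th
    = acos (- Y), the logarithm of this product has norm th * sqrt ((X + U) / (X - U)), so the claim
    says that this norm is at most [K]. It is an equality at [y = 1]; away from [y = 0] it follows
    because the difference of the two sides is monotone. *)
Lemma acos_cvY y : 0 < y <= 1 ->
  acos (- cvY y) <= K * Num.sqrt ((cvX y - cvU y) / (cvX y + cvU y)).
Proof.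
move=> hy; have /andP[y0 y1] := hy.
have aY x : 0 < x <= 1 -> -1 < - cvY x < 1.
  by move=> /cvY_lt1 h; apply/andP; split; lra.
have [hUX hpi] := cvX_gt_U y hy.
have [/hpi h|hy10] := ltP y (1 / 10).
  by apply: le_trans h; apply: acos_lepi; have := aY y hy; lra.
pose q x := (cvX x - cvU x) / (cvX x + cvU x).
have q0 x : 0 < x <= 1 -> 0 < q x.
  move=> hx; have [h _] := cvX_gt_U x hx; have h' := cvU_gt0 x hx.
  by rewrite /q divr_gt0 //; lra.
pose df x := (K * (P * c1 (cvD x) * cvU x - cvX x * (T * cvn x)) -
  (- T * (c1 (cvD x) - P * (1 - x) * (c2 (cvD x) - c3 (cvD x)))) * (cvX x + cvU x)) /
  (Num.sqrt (q x) * (cvX x + cvU x) ^+ 2).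
have E1 : K * Num.sqrt (q 1) - acos (- cvY 1) = 0.
  rewrite /q; have [-> -> -> _] := @cv1 R; rewrite oppr0 acos0.
  have -> : (cosh T - sinh T) / (cosh T + sinh T) = expR (- T) ^+ 2.
    rewrite /cosh /sinh; have := expRNE T; have := lt0r_neq0 (expR_gt0 T).
    move: (expR T) (expR (- T)) => a b a0 ab.
    have -> : (a + b) / 2 + (a - b) / 2 = a by field.
    by apply: (mulIf a0); rewrite mulfVK // expr2 -mulrA [b * a]mulrC ab; field.
  rewrite sqrtr_sqr ger0_norm ?expR_ge0 // -mulrA expRNE; ring.
suff : acos (- cvY y) - K * Num.sqrt (q y) <= acos (- cvY 1) - K * Num.sqrt (q 1).
  by move: E1; rewrite /q; lra.
apply: (der_nondecr (fun x => acos (- cvY x) - K * Num.sqrt (q x)) (fun x => - df x) _ _ y1) => x hx.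
- have hx' : 0 < x <= 1 by apply/andP; split; lra.
  have [h _] := cvX_gt_U x hx'; have h' := cvU_gt0 x hx'; have hq := q0 x hx'.
  have s0 : 0 < Num.sqrt (q x) by rewrite sqrtr_gt0.
  have hN := cv_norm x.
  have XU0 : 0 < cvX x + cvU x by lra.
  have sE : Num.sqrt (1 - cvY x ^+ 2) = Num.sqrt (q x) * (cvX x + cvU x).
    have -> : 1 - cvY x ^+ 2 = q x * (cvX x + cvU x) ^+ 2.
      have -> : 1 - cvY x ^+ 2 = (cvX x - cvU x) * (cvX x + cvU x) by nra.
      by rewrite /q; field; rewrite lt0r_neq0.
    by rewrite sqrtrM ?ltW // sqrtr_sqr ger0_norm // ltW.
  have hdq : der q x (2 * (P * c1 (cvD x) * cvU x - cvX x * (T * cvn x)) / (cvX x + cvU x) ^+ 2).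
    rewrite /q; apply: der_eq.
      apply: der_mul; first by apply: der_add; [exact: der_cvX|apply: der_opp; exact: der_cvU].
      by apply: der_inv; [exact: lt0r_neq0|apply: der_add; [exact: der_cvX|exact: der_cvU]].
    cbv beta; move: (c1 _) (cvn x) (cvX x) (cvU x) XU0 => a1 n X U XU0.
    by field; rewrite lt0r_neq0.
  apply: der_eq.
    apply: der_add.
      by apply: der_acos; [exact: aY|apply: der_opp; exact: der_cvY].
    apply: der_opp; apply: der_mul; first exact: der_cst.
    by apply: der_sqrt; [exact: hq|exact: hdq].
  cbv beta; rewrite sqrrN sE /df; move: (Num.sqrt (q x)) s0 => s s0.
  move: (c1 _) (c2 _) (c3 _) (cvn x) (cvX x) (cvU x) XU0 => a1 a2 a3 n X U XU0.
  by move: (expR T) => E; field; rewrite !lt0r_neq0.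
- have hx' : 0 < x <= 1 by apply/andP; split; lra.
  have [h _] := cvX_gt_U x hx'; have h' := cvU_gt0 x hx'; have hq := q0 x hx'.
  have s0 : 0 < Num.sqrt (q x) by rewrite sqrtr_gt0.
  rewrite /df -mulNr; apply: divr_ge0; last by rewrite mulr_ge0 ?sqr_ge0 // ltW.
  rewrite oppr_ge0 subr_le0.
  have := @curve_pos R x (cvD x); rewrite -/(cvX x) -/(cvU x) => /(_ _ erefl) hc.
  have {}hc : (c1 (cvD x) - P * (1 - x) * (c2 (cvD x) - c3 (cvD x))) * (cvX x + cvU x) <=
      K * (1 - P * (1 - x) * (c2 (cvD x) + c3 (cvD x) - cvD x * c2 (cvD x) * c3 (cvD x))).
    by apply/ltW/hc/andP; split; lra.
  (* The Wronskian of [cvX] and [cvU]. *)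
  have key : cvX x * (T * cvn x) - P * c1 (cvD x) * cvU x =
      T * (1 - P * (1 - x) * (c2 (cvD x) + c3 (cvD x) - cvD x * c2 (cvD x) * c3 (cvD x))).
    rewrite /cvn /cvX /cvU.
    have g0 := stumpff0E (cvD x); have g1 := stumpff1E (cvD x); have g2 := stumpff1_sqr (cvD x).
    have hD : cvD x = P * (1 - 2 * x) by [].
    move: (cvD x) (c0 _) (c1 _) (c2 _) (c3 _) g0 g1 g2 hD => D a0 a1 a2 a3 g0 g1 g2 hD.
    transitivity (T * (a0 * (a1 + P * x * (a2 - a3)) - P * x * a1 ^+ 2)); first by ring.
    by rewrite g2 g1 g0 hD; ring.
  have : T * ((c1 (cvD x) - P * (1 - x) * (c2 (cvD x) - c3 (cvD x))) * (cvX x + cvU x)) <=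
    T * (K * (1 - P * (1 - x) * (c2 (cvD x) + c3 (cvD x) - cvD x * c2 (cvD x) * c3 (cvD x)))).
    by rewrite ler_pM2l.
  rewrite [T * (K * _)]mulrCA -key; move: K => k; lra.
Qed.

End Levels.

(** * Level sets of the norm of the logarithm *)

Section Levels.
Context {R : realType}.
Implicit Types (x y u D w t : R).
Local Notation T := (pi / 2 : R).
Local Notation P := (T ^+ 2 : R).
Local Notation K := (T * expR T).
Local Notation c0 := (@stumpff R 0).
Local Notation c1 := (@stumpff R 1).
Local Notation c2 := (@stumpff R 2).
Local Notation c3 := (@stumpff R 3).

Let T0 : 0 < T. Proof. by have /andP[h _] := @pihalf_bounds R; lra. Qed.
Let K0 : 0 < K. Proof. by have /andP[h _] := @level_bounds R; lra. Qed.
Let piE : pi ^+ 2 = 4 * P. Proof. by field. Qed.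

(* A traceless [X0] with [det X0 = D] and [exp X0 = S] has norm at most [k] iff
   [lev w D <= k ^ 2], where [w] is the norm of the traceless symmetric part of [S]. *)
Definition lev w D := D + 2 * K * w / c1 D.

(** This restates [acos_cvY] through [lev], at [D] the square of th = acos (- Y). *)
Lemma cv_level y : 0 < y <= 1 ->
  exists D, [/\ D < pi ^+ 2, c0 D = - cvY y & lev (cvU y) D <= K ^+ 2].
Proof.
move=> hy; have hY := cvY_lt1 y hy; have [hUX _] := cvX_gt_U y hy.
have hle := acos_cvY y hy; have hN := cv_norm y; have U0 := cvU_gt0 y hy.
move: hle; set q := (cvX y - cvU y) / (cvX y + cvU y) => hle.
have XU0 : 0 < cvX y + cvU y by lra.
have q0 : 0 < q by rewrite /q divr_gt0 //; lra.
have s0 : 0 < Num.sqrt q by rewrite sqrtr_gt0.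
have s2 : Num.sqrt q ^+ 2 = q by rewrite sqr_sqrtr // ltW.
have aY : -1 < - cvY y < 1 by apply/andP; split; lra.
set th := acos (- cvY y) in hle *.
have [th0 thpi] : 0 < th /\ th < pi.
  by split; [apply: acos_gt0|apply: acos_ltpi]; apply/andP; split; lra.
exists (th ^+ 2); have [cE sE] := stumpff_cos_sin th.
split.
- by rewrite ltr_pXn2r ?nnegrE ?pi_ge0 // ltW.
- by rewrite cE /th acosK // in_itv /=; apply/andP; split; lra.
have sinE : sin th = Num.sqrt q * (cvX y + cvU y).
  rewrite /th sin_acos ?sqrrN; last by apply/andP; split; lra.
  have -> : 1 - cvY y ^+ 2 = q * (cvX y + cvU y) ^+ 2.
    have -> : 1 - cvY y ^+ 2 = (cvX y - cvU y) * (cvX y + cvU y) by nra.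
    by rewrite /q; field; rewrite lt0r_neq0.
  by rewrite sqrtrM ?ltW // sqrtr_sqr ger0_norm // ltW.
have UE : 2 * cvU y * Num.sqrt q = sin th * (1 - q).
  have : q * (cvX y + cvU y) = cvX y - cvU y by rewrite /q mulfVK // lt0r_neq0.
  by move=> h; rewrite sinE -[RHS]mulrA mulrBr mulr1 [_ * q]mulrC h; ring.
have c1E : c1 (th ^+ 2) = sin th / th by rewrite -sE mulrC mulKf ?lt0r_neq0.
have sin0 : 0 < sin th by rewrite sinE mulr_gt0.
have levE : lev (cvU y) (th ^+ 2) = th ^+ 2 + K * th * (1 - q) / Num.sqrt q.
  have -> : 1 - q = 2 * cvU y * Num.sqrt q / sin th.
    by rewrite UE mulrAC mulfV ?mul1r // lt0r_neq0.
  rewrite /lev c1E; move: (K) => k; field; by rewrite !lt0r_neq0.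
rewrite levE -subr_ge0; move: (Num.sqrt q) s0 s2 hle => s s0 s2 hle.
(* The second factor is positive, and [acos_cvY] is the sign of the first. *)
have -> : K ^+ 2 - (th ^+ 2 + K * th * (1 - q) / s) = (K * s - th) * (th + K / s).
  by rewrite -s2; move: (K) => k; field; rewrite lt0r_neq0.
apply: mulr_ge0; first by rewrite subr_ge0.
by apply: addr_ge0; [exact: ltW|apply/ltW/divr_gt0].
Qed.

Lemma lev_mono w D D' : 0 <= w -> - pi ^+ 2 <= D -> D <= D' -> D' < pi ^+ 2 ->
  lev w D <= lev w D'.
Proof.
move=> w0 hD DD' hD'; rewrite /lev; apply: lerD => //.
apply: ler_wpM2l; first by apply: mulr_ge0; [apply: mulr_ge0; [lra|exact: ltW]|].
by rewrite lef_pV2 ?posrE ?stumpff1_gt0 //; [apply: stumpff1_decr_le => //; exact: ltW|lra].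
Qed.

(** The slope of the chord of H over the whole range of the family, [cvr 1] being [T]. *)
Definition slope := cvH (1 : R) / T.

(** [cvH 1] is atan (1 / sinh T). The bound combines sinh T < 99/43 with atan z >= z - z^3 / 3. *)
Lemma slope_gt : 259 / 1000 < slope.
Proof.
have [X1 Y1 U1 _] := @cv1 R; have h1 : 0 < (1 : R) <= 1 by rewrite ltr01 lexx.
have s0 : 0 < sinh T by rewrite sinh_gt0.
have c0 := cosh_gt0 T.
have cvHE : cvH 1 = atan (sinh T)^-1.
  by rewrite /cvH /gap X1 Y1 U1 mul0r subr0 addr0 invfM mulrA mulfV ?mul1r // lt0r_neq0.
have sb : sinh T < 99 / 43.
  have /andP[e1 e2] := @expR_pihalf_bounds R; have := expRNE T.
  by rewrite /sinh; move: (expR T) (expR (- T)) e1 e2 => a b e1 e2 e3; nra.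
have zb : 43 / 99 < (sinh T)^-1.
  by rewrite -[(sinh T)^-1]div1r ltr_pdivlMr //; lra.
have ab : 43 / 99 - (43 / 99) ^+ 3 / 3 <= atan (43 / 99 : R).
  rewrite -subr_ge0; pose f z : R := atan z - (z - z * z ^+ 2 / 3).
  have -> : 0 = f 0 by rewrite /f atan0 expr0n /= !mul0r !subr0.
  have -> : atan (43 / 99) - (43 / 99 - (43 / 99) ^+ 3 / 3) = f (43 / 99) by rewrite /f; ring.
  apply: (der_nondecr f (fun z => z ^+ 4 / (1 + z ^+ 2))) => [|z _|z _]; first lra.
    have z0 : 1 + z ^+ 2 != 0 by apply: lt0r_neq0; have := sqr_ge0 z; lra.
    by rewrite /f; der_auto; field; rewrite z0.
  by rewrite divr_ge0 ?exprn_even_ge0 //; have := sqr_ge0 z; lra.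
have := @lt_atan R _ _ zb; rewrite /slope cvHE ltr_pdivlMr //.
have /andP[_ t2] := @pihalf_bounds R; lra.
Qed.

(** The level curve of norm [K]: a traceless logarithm with determinant [D] and anticonformal
    modulus m has norm [K] when D + 2 K m = K^2. So m = (K^2 - D) / (2 K), its rotation part is K -
    m = (K^2 + D) / (2 K), and [lvX], [lvY], [lvU] are the coordinates of its exponential. *)
Definition lvX D := c0 D.
Definition lvY D := c1 D * (K ^+ 2 + D) / (2 * K).
Definition lvU D := c1 D * (K ^+ 2 - D) / (2 * K).

Let range D : - pi ^+ 2 <= D <= P -> [/\ 0 < c1 D, 0 <= c0 D, 0 < K ^+ 2 + D, 0 < K ^+ 2 - D & D < pi ^+ 2].
Proof.
move=> /andP[h1 h2]; have P0 : 0 < P by exact: exprn_gt0.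
have /andP[k1 _] := @sqr_level_bounds R; have := @pi2_bound R => p2.
split; [by apply: stumpff1_gt0; lra|exact: stumpff0_ge0|lra|lra|lra].
Qed.

Lemma lv_norm D : lvX D ^+ 2 + lvY D ^+ 2 = 1 + lvU D ^+ 2.
Proof.
rewrite -[in RHS](stumpff_cos2_sin2 D) /lvX /lvY /lvU.
by move: (K) K0 => k k0; field; rewrite lt0r_neq0.
Qed.

Lemma lvY_gt0 D : - pi ^+ 2 <= D <= P -> 0 < lvY D.
Proof. by move=> /range[h1 _ h2 _ _]; apply: divr_gt0; apply: mulr_gt0. Qed.

Lemma lvU_gt0 D : - pi ^+ 2 <= D <= P -> 0 < lvU D.
Proof. by move=> /range[h1 _ _ h2 _]; apply: divr_gt0; apply: mulr_gt0. Qed.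

Lemma lv_den D : - pi ^+ 2 <= D <= P -> 0 < lvX D * lvU D + lvY D.
Proof.
move=> h; have [_ h0 _ _ _] := range D h.
by apply: ltr_wpDl; [apply: mulr_ge0; [|exact/ltW/lvU_gt0]|exact: lvY_gt0].
Qed.

Lemma der_lvU D : der lvU D (- (2 * c1 D + (K ^+ 2 - D) * (c2 D - c3 D)) / (4 * K)).
Proof. by rewrite /lvU; der_auto; move: (K) K0 => k k0; field; rewrite lt0r_neq0. Qed.

Lemma der_lvY D : der lvY D ((2 * c1 D - (K ^+ 2 + D) * (c2 D - c3 D)) / (4 * K)).
Proof. by rewrite /lvY; der_auto; move: (K) K0 => k k0; field; rewrite lt0r_neq0. Qed.

Lemma der_lvX D : der lvX D (- c1 D / 2).
Proof. by rewrite /lvX; der_auto; field. Qed.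

(** At [D = P] the level curve passes through the extremal product, which is i times the end [y = 1]
    of the family; the quarter turn accounts for the summand [T]. *)
Lemma lv_gap_end : gap (lvX P) (lvY P) (lvU P) + T = slope * asinh (lvU P).
Proof.
have [h0 h1] := stumpff_cos_sin T; rewrite cos_pihalf in h0; rewrite sin_pihalf in h1.
have c1E : c1 P = T^-1 by rewrite -[c1 P](mulKf (lt0r_neq0 T0)) h1 mulr1.
have e0 := lt0r_neq0 (expR_gt0 T); have t0 := lt0r_neq0 T0.
have UE : lvU P = sinh T.
  by rewrite /lvU c1E /sinh expRN; move: (T) e0 t0 => t e0 t0; field; rewrite e0 t0.
have YE : lvY P = cosh T.
  by rewrite /lvY c1E /cosh expRN; move: (T) e0 t0 => t e0 t0; field; rewrite e0 t0.
rewrite UE sinhK /slope mulfVK //.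
have [X1 Y1 U1 _] := @cv1 R; have i1 : 0 <= (1 : R) <= 1 by rewrite ler01 lexx.
have := lv_norm P; rewrite /lvX h0 YE UE => nP.
have cT := cosh_gt0 T; have sT : 0 < sinh T by rewrite sinh_gt0.
have d1 : 0 < 0 * sinh T + cosh T by rewrite mul0r add0r.
have [cg sg] := gap_cos_sin 0 (cosh T) (sinh T) nP d1.
have [ch sh] := gap_cos_sin (cvX 1) (cvY 1) (cvU 1) (cv_norm 1) (cv_gap_den 1 i1).
rewrite -/(cvH 1) X1 Y1 U1 in ch sh.
have a1 : - T < gap 0 (cosh T) (sinh T) := atan_gtNpi2 _.
have a2 : gap 0 (cosh T) (sinh T) < T := atan_ltpi2 _.
have b1 : cvH (1 : R) < T := atan_ltpi2 _.
have b0 : 0 < cvH (1 : R) by apply: cvH_gt0; rewrite ltr01 lexx.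
have pE : pi = 2 * T :> R by field.
apply: cos_inj; [by rewrite in_itv /=; apply/andP; split; lra|by rewrite in_itv /=; apply/andP; split; lra|].
by rewrite cosDpihalf sg ch -mulNr; congr (_ / _); ring.
Qed.

(** For a point of the level curve, [gap + T] is what its angle and [atan] of its radius leave of
    pi. So the curve lies on or below the chord of H, with equality at [D = P]; the claim reduces to
    the sign of a derivative in [D], and there 259/1000 can replace [slope]. *)
Lemma lv_gap D : - pi ^+ 2 <= D <= P ->
  gap (lvX D) (lvY D) (lvU D) + T <= slope * asinh (lvU D).
Proof.
move=> /andP[D0 D1].
suff : gap (lvX D) (lvY D) (lvU D) - slope * asinh (lvU D) <=
    gap (lvX P) (lvY P) (lvU P) - slope * asinh (lvU P) by have := lv_gap_end; lra.
pose n4 x := 2 * c1 x + (K ^+ 2 - x) * (c2 x - c3 x).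
pose S x := c3 x * (K ^+ 2 + x + (K ^+ 2 - x) * c0 x).
pose s x := Num.sqrt (1 + lvU x ^+ 2).
apply: (der_nondecr (fun D => gap (lvX D) (lvY D) (lvU D) - slope * asinh (lvU D))
  (fun x => (slope * n4 x * s x - S x) / (4 * K * s x ^+ 2)) _ _ D1) => x hx.
- have hx' : - pi ^+ 2 <= x <= P by apply/andP; split; lra.
  have s0 : 0 < s x by exact: sqrt1D_gt0.
  have s2 : s x ^+ 2 = 1 + lvU x ^+ 2 by rewrite sqr_sqrtr //; have := sqr_ge0 (lvU x); lra.
  apply: der_eq.
    apply: der_add.
      by apply: (der_gap lvX lvY lvU); [exact: lv_norm|exact/lt0r_neq0/lv_den|exact: der_lvX
        |exact: der_lvY|exact: der_lvU].
    by apply: der_opp; apply: der_mul; [exact: der_cst|exact/der_asinh/der_lvU].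
  cbv beta; rewrite -/(s x) -s2 /n4 /S.
  have key : lvX x * ((2 * c1 x - (K ^+ 2 + x) * (c2 x - c3 x)) / (4 * K)) -
      lvY x * (- c1 x / 2) + - (2 * c1 x + (K ^+ 2 - x) * (c2 x - c3 x)) / (4 * K) =
      c3 x * (K ^+ 2 + x + (K ^+ 2 - x) * c0 x) / (4 * K).
    rewrite /lvX /lvY.
    have g0 := stumpff0E x; have g1 := stumpff1E x; have g2 := stumpff1_sqr x.
    move: (c0 _) (c1 _) (c2 _) (c3 _) (K) K0 g0 g1 g2 => a0 a1 a2 a3 k k0 g0 g1 g2.
    transitivity ((a0 * (2 * a1 - (k ^+ 2 + x) * (a2 - a3)) + (k ^+ 2 + x) * a1 ^+ 2 -
      (2 * a1 + (k ^+ 2 - x) * (a2 - a3))) / (4 * k)); first by field; rewrite lt0r_neq0.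
    by congr (_ / _); rewrite g2 g1 g0; ring.
  rewrite key; move: (s x) s0 (K) K0 slope => r r0 k k0 l.
  by field; rewrite !lt0r_neq0.
- have hx' : - pi ^+ 2 <= x <= P by apply/andP; split; lra.
  have s0 : 0 < s x by exact: sqrt1D_gt0.
  have s2 : s x ^+ 2 = 1 + lvU x ^+ 2 by rewrite sqr_sqrtr //; have := sqr_ge0 (lvU x); lra.
  have [h1 h2 h3 h4 h5] := range x hx'.
  have h23 : 0 < c2 x - c3 x by have := @stumpff23_gt R x; have := h1; have /andP[? ?] := hx'; lra.
  have n0 : 0 < n4 x by rewrite /n4; have := mulr_gt0 h4 h23; lra.
  apply: divr_ge0; last by apply: mulr_ge0; [apply: mulr_ge0; [|exact: ltW]|exact: sqr_ge0].
  rewrite subr_ge0.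
  have xr : - (247 / 25) <= x <= P.
    by have p2 := @pi2_bound R; apply/andP; split; [lra|case/andP: hx'].
  have := level_pos x _ _ _ xr erefl erefl erefl; rewrite -/(n4 x) -/(S x) => hl.
  have hl2 : S x ^+ 2 < (259 / 1000 * (n4 x * s x)) ^+ 2.
    rewrite -(@ltr_pM2l _ (4 * K ^+ 2)); last by apply: mulr_gt0 => //; exact: exprn_gt0.
    apply: (lt_le_trans hl); rewrite [(259 / 1000 * (n4 x * s x)) ^+ 2]exprMn [(n4 x * s x) ^+ 2]exprMn s2 -lv_norm /lvX /lvY le_eqVlt; apply/orP; left.
    by apply/eqP; move: (K) K0 => k k0; field; rewrite lt0r_neq0.
  have ns0 : 0 < n4 x * s x by rewrite mulr_gt0.
  have hS : S x <= 259 / 1000 * (n4 x * s x).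
    have b0 : 0 < 259 / 1000 * (n4 x * s x) by apply: mulr_gt0; [lra|exact: ns0].
    move: (S x) (259 / 1000 * (n4 x * s x)) b0 hl2 => a b b0 hab.
    rewrite leNgt; apply/negP => h.
    nra.
  apply: (le_trans hS); rewrite -[slope * _ * _]mulrA ler_pM2r //; exact/ltW/slope_gt.
Qed.

End Levels.

(** * Shrinking the members of the family along rays *)

Section Rays.
Context {R : realType}.
Implicit Types (x y u l D w t : R).
Local Notation T := (pi / 2 : R).
Local Notation P := (T ^+ 2 : R).
Local Notation K := (T * expR T).
Local Notation c0 := (@stumpff R 0).
Local Notation c1 := (@stumpff R 1).
Local Notation c2 := (@stumpff R 2).
Local Notation c3 := (@stumpff R 3).

Let T0 : 0 < T. Proof. by have /andP[h _] := @pihalf_bounds R; lra. Qed.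
Let K0 : 0 < K. Proof. by have /andP[h _] := @level_bounds R; lra. Qed.

(** The coordinates below are those of the exponential of [l] times the generator of the member
    [y]. *)
Definition rayD y l := l ^+ 2 * cvD y.
Definition rayX y l := c0 (rayD y l).
Definition rayY y l := l * T * (1 - y) * c1 (rayD y l).
Definition rayU y l := l * T * y * c1 (rayD y l).

Lemma ray1 y : [/\ rayX y 1 = cvX y, rayY y 1 = cvY y & rayU y 1 = cvU y].
Proof. by rewrite /rayX /rayY /rayU /rayD expr1n !mul1r. Qed.

Lemma ray_norm y l : rayX y l ^+ 2 + rayY y l ^+ 2 = 1 + rayU y l ^+ 2.
Proof.
by rewrite -[in RHS](stumpff_cos2_sin2 (rayD y l)) /rayX /rayY /rayU /rayD /cvD; ring.
Qed.

Let rayD_bounds y l : 0 <= y <= 1 -> 0 <= l <= 1 -> - P <= rayD y l <= P.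
Proof.
move=> hy /andP[l0 l1]; have /andP[h1 h2] := cvD_bounds y hy; rewrite /rayD.
have l2 : 0 <= l ^+ 2 <= 1 by rewrite sqr_ge0 /= expr_le1.
by move: (l ^+ 2) l2 (cvD y) h1 h2 => m m0 d h1 h2; apply/andP; split; nra.
Qed.

Lemma ray_c1_gt0 y l : 0 <= y <= 1 -> 0 <= l <= 1 -> 0 < c1 (rayD y l).
Proof.
move=> hy hl; apply: stumpff1_gt0; have := rayD_bounds y l hy hl.
have -> : pi ^+ 2 = 4 * P :> R by field.
by have P0 : 0 < P := exprn_gt0 2 T0; lra.
Qed.

Lemma rayX_ge0 y l : 0 <= y <= 1 -> 0 <= l <= 1 -> 0 <= rayX y l.
Proof. by move=> hy hl; apply: stumpff0_ge0; have := rayD_bounds y l hy hl; lra. Qed.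

Lemma ray_den y l : 0 <= y <= 1 -> 0 < l <= 1 -> 0 < rayX y l * rayU y l + rayY y l.
Proof.
move=> /andP[y0 y1] /andP[l0 l1].
have hy : 0 <= y <= 1 by rewrite y0.
have hl : 0 <= l <= 1 by rewrite ltW.
have c10 := ray_c1_gt0 y l hy hl; have X0 := rayX_ge0 y l hy hl.
have U0 : 0 <= rayU y l by rewrite /rayU; apply: mulr_ge0 (ltW c10); apply: mulr_ge0 y0; exact: mulr_ge0 (ltW l0) (ltW T0).
move: y1; rewrite le_eqVlt => /predU1P[yE|y1].
  have Xp : 0 < rayX y l.
    rewrite lt0r X0 andbT; apply/eqP => X00.
    have Y0 : rayY y l = 0 by rewrite /rayY yE subrr mulr0 mul0r.
    have := ray_norm y l; rewrite X00 Y0 expr0n /=.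
    by have := sqr_ge0 (rayU y l); lra.
  rewrite ltr_wpDr //; first by rewrite /rayY yE subrr mulr0 mul0r.
  apply: mulr_gt0 Xp _; rewrite /rayU; apply: mulr_gt0 c10; rewrite yE mulr1; exact: mulr_gt0 l0 T0.
apply: ltr_wpDl; first exact: mulr_ge0.
by rewrite /rayY; apply: mulr_gt0 c10; apply: mulr_gt0; [exact: mulr_gt0 l0 T0|lra].
Qed.

Lemma der_rayX y l : der (rayX y) l (- (l * cvD y * c1 (rayD y l))).
Proof. by rewrite /rayX /rayD; der_auto; field. Qed.

Let der_lc1 k l D : der (fun l => l * k * c1 (l ^+ 2 * D)) l (k * c0 (l ^+ 2 * D)).
Proof.
der_auto; have h0 := stumpff0E (l ^+ 2 * D); have h1 := stumpff1E (l ^+ 2 * D).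
have : l ^+ 2 * D * (c3 (l ^+ 2 * D) - c2 (l ^+ 2 * D)) = c0 (l ^+ 2 * D) - c1 (l ^+ 2 * D).
  by rewrite h0 h1; ring.
move: (c0 _) (c1 _) (c2 _) (c3 _) => a0 a1 a2 a3 h.
transitivity (k * (l ^+ 2 * D * (a3 - a2) + a1)); first by field.
by rewrite h; ring.
Qed.

Lemma der_rayY y l : der (rayY y) l (T * (1 - y) * rayX y l).
Proof.
by apply: der_ext (der_lc1 (T * (1 - y)) l (cvD y)) => z; rewrite /rayY /rayD !mulrA.
Qed.

Lemma der_rayU y l : der (rayU y) l (T * y * rayX y l).
Proof.
by apply: der_ext (der_lc1 (T * y) l (cvD y)) => z; rewrite /rayU /rayD !mulrA.
Qed.

(** Along the ray the gap decreases in [l] at the rate T (1 - y + y X) / (1 + U^2), which [ray_pos]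
    bounds below by (37/100) T. *)
Lemma ray_gap y l : 0 <= y <= 1 -> 0 < l <= 1 ->
  cvH y + 37 / 100 * T * (1 - l) <= gap (rayX y l) (rayY y l) (rayU y l).
Proof.
move=> hy /andP[l0 l1].
suff : - (gap (rayX y l) (rayY y l) (rayU y l)) - 37 / 100 * T * l <=
    - (gap (rayX y 1) (rayY y 1) (rayU y 1)) - 37 / 100 * T * 1.
  by case: (ray1 y) => -> -> ->; rewrite -/(cvH y); lra.
apply: (der_nondecr (fun l => - (gap (rayX y l) (rayY y l) (rayU y l)) - 37 / 100 * T * l)
  (fun l => T * ((1 - y + y * rayX y l) / (1 + rayU y l ^+ 2) - 37 / 100)) _ _ l1) => x hx.
- have hx' : 0 < x <= 1 by apply/andP; split; lra.
  apply: der_eq.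
    apply: der_add.
      apply: der_opp; apply: (der_gap (rayX y) (rayY y) (rayU y)); [exact: ray_norm
        |exact/lt0r_neq0/ray_den|exact: der_rayX|exact: der_rayY|exact: der_rayU].
    by apply: der_opp; apply: der_mul; [exact: der_cst|exact: der_id].
  cbv beta; have u0 : 1 + rayU y x ^+ 2 != 0 by apply: lt0r_neq0; have := sqr_ge0 (rayU y x); lra.
  have E : rayX y x * (T * (1 - y) * rayX y x) - rayY y x * - (x * cvD y * c1 (rayD y x)) = T * (1 - y).
    have := stumpff_cos2_sin2 (rayD y x); rewrite -/(rayX y x) /rayY /rayD.
    move: (c1 _) (rayX y x) => a1 X h.
    transitivity (T * (1 - y) * (X ^+ 2 + x ^+ 2 * cvD y * a1 ^+ 2)); first by ring.
    by rewrite h mulr1.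
  rewrite E; move: (rayX y x) (rayU y x) u0 => X U u0; field.
  exact: u0.
- apply: mulr_ge0; first exact: ltW.
  have u0 : 0 < 1 + rayU y x ^+ 2 by have := sqr_ge0 (rayU y x); lra.
  rewrite subr_ge0 ler_pdivlMr //.
  have hx' : 0 <= x <= 1 by apply/andP; split; lra.
  have := ray_pos x y (rayD y x) hx' hy; rewrite /rayD => /(_ erefl)/ltW.
  rewrite -/(rayD y x) -/(rayX y x); apply: le_trans; rewrite le_eqVlt; apply/orP; left.
  by apply/eqP; rewrite /rayU; ring.
Qed.

Lemma rayU_le y l : 0 <= y <= 1 -> 0 <= l <= 1 -> 0 <= rayU y l <= cvU y.
Proof.
move=> hy hl; have /andP[l0 l1] := hl; have /andP[y0 y1] := hy; apply/andP; split.
  apply: mulr_ge0 (ltW (ray_c1_gt0 y l hy hl)).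
  exact: mulr_ge0 (mulr_ge0 l0 (ltW T0)) y0.
have [_ _ <-] := ray1 y.
apply: (der_nondecr (rayU y) _ _ _ l1 (fun x _ => der_rayU y x)) => x hx.
apply: mulr_ge0; first exact: mulr_ge0 (ltW T0) y0.
by apply: rayX_ge0 => //; apply/andP; split; lra.
Qed.

(** With s = l T y one has sinh s = s c1(- s^2), while the radius uses [c1] at a determinant not
    below - s^2, and [c1] decreases. *)
Lemma asinh_rayU_le y l : 0 <= y <= 1 -> 0 <= l <= 1 -> asinh (rayU y l) <= l * T * y.
Proof.
move=> hy hl; rewrite -ler_sinh asinhK /rayU -stumpff1_sinh.
have /andP[l0 l1] := hl; have /andP[y0 y1] := hy.
have s0 : 0 <= l * T * y := mulr_ge0 (mulr_ge0 l0 (ltW T0)) y0.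
apply: ler_wpM2l => //.
have P0 : 0 < P := exprn_gt0 2 T0.
have pE : pi ^+ 2 = 4 * P :> R by field.
apply: stumpff1_decr_le; last by have := rayD_bounds y l hy hl; lra.
- rewrite lerN2 pE !exprMn.
  have : l ^+ 2 * y ^+ 2 <= 1 by rewrite -exprMn expr_le1 ?mulr_ge0 // mulr_ile1.
  by rewrite mulrAC; move: (_ * y ^+ 2) => z; nra.
- rewrite /rayD /cvD; have -> : - (l * T * y) ^+ 2 = l ^+ 2 * (P * - y ^+ 2) by ring.
  rewrite ler_wpM2l ?sqr_ge0 // ler_pM2l //.
  by have := sqr_ge0 (1 - y); lra.
Qed.

End Rays.

(** * Trading angle for trace *)

Section Trade.
Context {R : realType}.
Implicit Types (x y u D w t : R).
Local Notation T := (pi / 2 : R).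
Local Notation P := (T ^+ 2 : R).
Local Notation K := (T * expR T).
Local Notation c0 := (@stumpff R 0).
Local Notation c1 := (@stumpff R 1).
Local Notation c2 := (@stumpff R 2).
Local Notation c3 := (@stumpff R 3).

Let K0 : 0 < K. Proof. by have /andP[h _] := @level_bounds R; lra. Qed.

Let k2 : 151 / 20 < K. Proof. by have /andP[h _] := @level_bounds R; lra. Qed.
Let p3 : pi < 22 / 7 :> R. Proof. by have /andP[_ h] := @pihalf_bounds R; lra. Qed.
Let pb : pi ^+ 2 < 99 / 10 :> R. Proof. by have := @pi2_bound R; lra. Qed.

(** Here [u] and [v] stand for the conformal and anticonformal moduli of a traceless logarithm. The
    last hypothesis reads (k - v)^2 < u^2 + (p - r)^2, so u + v exceeds k - p + r; as (u - v)(u + v)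
    = D is bounded, neither modulus can be small. These linear bounds leave about 17.4 at the worst
    point. *)
Lemma trade_arith (k p r u v D : R) : 151 / 20 < k -> p < 22 / 7 -> 0 <= r <= p -> 0 <= u -> 0 <= v ->
  u ^+ 2 = v ^+ 2 + D -> - r ^+ 2 <= D <= 99 / 10 ->
  k ^+ 2 < D + 2 * k * v + (p - r) ^+ 2 -> 17 <= 2 * u + 3 * (u * v).
Proof.
move=> hk hp /andP[r0 r1] u0 v0 uE /andP[D1 D2] h.
have F : k - p + r < u + v.
  rewrite ltNge; apply/negP => hF; have : u + (p - r) <= k - v by lra.
  have p0 : 0 <= p - r by lra.
  by move=> h1; nra.
have F1 : 22 / 5 + r < u + v by lra.
have E : (u - v) * (u + v) = D by rewrite -subr_sqr uE; ring.
have [D0|D0] := leP 0 D.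
  have uv : v <= u by rewrite leNgt; apply/negP => ?; nra.
  have d1 : u - v <= 9 / 4 by rewrite leNgt; apply/negP => ?; nra.
  have v1 : 43 / 40 <= v by lra.
  have [v2|v2] := leP v (11 / 5); last by nra.
  have u1 : 22 / 5 - v <= u by lra.
  have : (22 / 5 - v) * (2 + 3 * v) <= u * (2 + 3 * v) by apply: ler_wpM2r => //; lra.
  by nra.
have uv : u <= v by rewrite leNgt; apply/negP => ?; nra.
have d1 : v - u <= r by rewrite leNgt; apply/negP => ?; nra.
have u1 : 11 / 5 <= u by lra.
by nra.
Qed.

Lemma cos_le_pi (a b : R) : 0 <= a -> a <= b -> b <= pi -> cos b <= cos a.
Proof.
move=> a0 ab bpi.
have ia : a \in `[0, pi] by rewrite in_itv /= a0 (le_trans ab).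
have ib : b \in `[0, pi] by rewrite in_itv /= bpi (le_trans a0).
by rewrite leNgt ltr_cos // -leNgt.
Qed.

(* Near the level [K ^ 2], [lev] grows at least 17 times as fast as the angle [th], so an
   angle that is [t ^ 2 / 17] smaller leaves room for the trace [t]. *)
Lemma trade_trace r D1 D2 th1 th2 t : 0 < r <= pi -> - r ^+ 2 <= D1 <= D2 -> D2 < pi ^+ 2 ->
  c0 D1 = cosh r * cos th1 -> c0 D2 = cosh r * cos th2 ->
  0 <= th1 -> th1 <= th2 -> th2 <= pi ->
  lev (sinh r) D2 <= K ^+ 2 -> t ^+ 2 <= 17 * (th2 - th1) -> `|t| <= pi - r ->
  lev (sinh r) D1 + t ^+ 2 <= K ^+ 2.
Proof.
move=> /andP[r0 rpi] /andP[D1r D12] D2pi e1 e2 th1_0 th12 th2pi lev2 t17 tr.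
rewrite leNgt; apply/negP => hlt.
have w0 : 0 < sinh r by rewrite sinh_gt0.
have C1 : 1 < cosh r by have := cosh2 r; have := cosh_gt0 r; nra.
have C0 : 0 < cosh r by lra.
have r2 : r ^+ 2 <= pi ^+ 2 by rewrite ler_pXn2r ?nnegrE ?pi_ge0 // ltW.
have t2 : t ^+ 2 <= (pi - r) ^+ 2.
  by rewrite -[t ^+ 2]real_normK ?num_real // ler_pXn2r ?nnegrE // subr_ge0.
(* The midpoint of [th1] and of the angle at which growth at rate 17 would bring the level down from
   [K ^ 2] to its value at [D1]. Being above [th1] keeps [c0 x / cosh r] below 1, where [acos] is
   differentiable; being below the other angle gives the contradiction. *)
pose th := (th1 + th2 - (K ^+ 2 - lev (sinh r) D1) / 17) / 2.
have lev12 : lev (sinh r) D1 <= lev (sinh r) D2 by apply: lev_mono => //; [exact: ltW|lra].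
have [a1 a2] : th1 < th /\ th <= th2 by rewrite /th; split; lra.
have cpi := cospi R; have pi0 := pi_gt0 R.
have c2lo : -1 < c0 D2.
  have [E _] := stumpff_cos_sin (pi : R).
  by have := stumpff0_decr D2 (pi ^+ 2) D2pi (lexx _); rewrite E cpi.
have ith : th \in `[0, pi] by rewrite in_itv /=; apply/andP; split; lra.
have ith1 : th1 \in `[0, pi] by rewrite in_itv /=; apply/andP; split; lra.
have ith2 : th2 \in `[0, pi] by rewrite in_itv /=; apply/andP; split; lra.
have cth1 : cos th < cos th1 by rewrite ltr_cos.
have cth2 : cos th2 <= cos th by apply: cos_le_pi; lra.
have [] := stumpff0_onto (cosh r * cos th).
  by apply: lt_le_trans c2lo _; rewrite e2 ler_pM2l.
move=> D' D'pi e'.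
have D1D' : D1 < D'.
  rewrite ltNge; apply/negP => h; have := stumpff0_decr_le D' D1 h.
  by rewrite e1 e' ler_pM2l // => hh; have := hh ltac:(lra); lra.
have D'D2 : D' <= D2.
  rewrite leNgt; apply/negP => h; have := stumpff0_decr D2 D' h (ltW D'pi).
  by rewrite e2 e' ltr_pM2l //; lra.
have cle : cos th1 <= 1 := cos_le1 th1.
have inside x : D' <= x <= D2 -> [/\ x < pi ^+ 2, - pi ^+ 2 <= x & -1 < c0 x / cosh r < 1].
  move=> /andP[x1 x2]; split; [lra|lra|].
  have h1 := stumpff0_decr_le D' x x1; have h2 := stumpff0_decr_le x D2 x2.
  rewrite ltr_pdivlMr // ltr_pdivrMr // mul1r.
  have := h1 (ltW (le_lt_trans x2 D2pi)); have := h2 (ltW D2pi); rewrite e' => h3 h4.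
  have : cosh r * cos th < cosh r by rewrite -[X in _ < X]mulr1 ltr_pM2l //; lra.
  by move=> h5; apply/andP; split; lra.
(* The first square root is the rotation part of the traceless logarithm; the second is the sine of
   the angle, which is the denominator in the derivative of [acos]. *)
have root x : D' <= x <= D2 -> 0 < Num.sqrt ((sinh r / c1 x) ^+ 2 + x) /\
    Num.sqrt (1 - (c0 x / cosh r) ^+ 2) = c1 x * Num.sqrt ((sinh r / c1 x) ^+ 2 + x) / cosh r.
  move=> hx; have [x1 x2 x3] := inside x hx; have c10 := stumpff1_gt0 x x1.
  have E : (sinh r / c1 x) ^+ 2 + x = (cosh r / c1 x) ^+ 2 * (1 - (c0 x / cosh r) ^+ 2).
    have := stumpff_cos2_sin2 x; have := cosh2 r.
    move: (c0 x) (c1 x) (cosh r) (sinh r) (lt0r_neq0 c10) (lt0r_neq0 C0) => p q C s h1 h2 h3 h4.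
    transitivity ((s ^+ 2 + x * q ^+ 2) / q ^+ 2); first by field.
    transitivity ((C ^+ 2 - p ^+ 2) / q ^+ 2); first by congr (_ / _); lra.
    by field; rewrite h1 h2.
  have z0 : 0 < 1 - (c0 x / cosh r) ^+ 2 by move/andP: x3 => [h1 h2]; nra.
  have Cc : 0 < cosh r / c1 x by apply: divr_gt0.
  rewrite E sqrtrM ?sqr_ge0 // sqrtr_sqr ger0_norm ?ltW //; split.
    by apply: mulr_gt0 => //; rewrite sqrtr_gt0.
  by field; rewrite !lt0r_neq0.
suff : lev (sinh r) D' - 17 * acos (c0 D' / cosh r) <= lev (sinh r) D2 - 17 * acos (c0 D2 / cosh r).
  rewrite e' e2 ![cosh r * _]mulrC !mulfK ?lt0r_neq0 // !cosK //.
  have := lev_mono (sinh r) D1 D' (ltW w0) ltac:(lra) (ltW D1D') D'pi.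
  by rewrite /th; lra.
apply: (der_nondecr (fun x => lev (sinh r) x - 17 * acos (c0 x / cosh r))
  (fun x => 1 + K * (sinh r / c1 x) * (c2 x - c3 x) / c1 x
     - 17 / (2 * Num.sqrt ((sinh r / c1 x) ^+ 2 + x))) _ _ D'D2) => x hx.
- have [x1 x2 x3] := inside x hx; have c10 := stumpff1_gt0 x x1.
  have c1n := lt0r_neq0 c10.
  have [u0 S] := root x hx.
  rewrite /lev; apply: der_eq; [apply: der_add|].
  - apply: der_add; [exact: der_id|apply: der_mul; [exact: der_cst|apply: der_inv; [exact: c1n|apply: der_stumpff; exact: der_id]]].
  - apply: der_opp; apply: der_mul; [exact: der_cst|apply: der_acos; [exact: x3|]].
    by apply: der_mul; [apply: der_stumpff; exact: der_id|exact: der_cst].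
  cbv beta; rewrite S.
  move: (Num.sqrt ((sinh r / c1 x) ^+ 2 + x)) u0 => u u0.
  move: (c0 x) (c1 x) (c2 x) (c3 x) (cosh r) (sinh r) (K) c1n (lt0r_neq0 C0) (lt0r_neq0 u0) => q0 q1 q2 q3 C s k h1 h2 h3.
  by field; rewrite h1 h2 h3.
- have hx' : D' <= x <= D2 by apply/andP; split; lra.
  have [x1 x2 x3] := inside x hx'; have c10 := stumpff1_gt0 x x1.
  have [u0 _] := root x hx'.
  have v0 : 0 <= sinh r / c1 x by apply: divr_ge0; exact: ltW.
  have u2 : Num.sqrt ((sinh r / c1 x) ^+ 2 + x) ^+ 2 = (sinh r / c1 x) ^+ 2 + x.
    by rewrite sqr_sqrtr // ltW // -sqrtr_gt0.
  have ratio := stumpff23_gt x ltac:(lra).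
  have levx : lev (sinh r) D1 <= lev (sinh r) x.
    by apply: lev_mono => //; [exact: ltW|lra|lra].
  have := trade_arith K pi r (Num.sqrt ((sinh r / c1 x) ^+ 2 + x)) (sinh r / c1 x) x
    k2 p3 ltac:(lra) (ltW u0) v0 u2.
  have hx2 : - r ^+ 2 <= x <= 99 / 10.
    by apply/andP; split; [|exact: ltW (lt_trans x1 pb)]; lra.
  have hl : K ^+ 2 < x + 2 * K * (sinh r / c1 x) + (pi - r) ^+ 2.
    have <- : lev (sinh r) x = x + 2 * K * (sinh r / c1 x) by rewrite /lev -[2 * K * sinh r / _]mulrA.
    by lra.
  move=> /(_ hx2 hl).
  move: (c1 x) (c2 x - c3 x) (K) (sinh r / c1 x) (Num.sqrt ((sinh r / c1 x) ^+ 2 + x)) k2 u0 v0 c10 ratio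
    => a b k v u kk u0 v0 a0 ratio h.
  clear - kk u0 v0 a0 ratio h.
  have bE : 5^-1 <= b / a by rewrite ler_pdivlMr //; lra.
  have kE : k * v * b / a >= 3 / 2 * v.
    have -> : k * v * b / a = k * (b / a) * v by ring.
    by apply: ler_wpM2r => //; nra.
  rewrite subr_ge0 ler_pdivrMr; last by rewrite mulr_gt0.
  by nra.
Qed.

End Trade.

(** * Products of circles in sectors *)

Section Cones.
Context {R : realType}.
Implicit Types (x y u D w t h : R).
Local Notation T := (pi / 2 : R).

Let T0 : 0 < T. Proof. by have /andP[h _] := @pihalf_bounds R; lra. Qed.
Let piE : pi = T + T :> R. Proof. by field. Qed.

(* The circle of centre [x + i y] and radius [u] lies in the sector [|arg| <= pi / 2 - h]. *)
Definition in_cone x y u h := [/\ x ^+ 2 + y ^+ 2 = 1 + u ^+ 2, 0 <= u <= x,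
  0 <= h <= T & u <= x * cos h - `|y| * sin h].

Lemma cos_ge0_le x h : 0 <= x <= T -> 0 <= h <= T -> 0 <= cos (x + h) -> x <= T - h.
Proof.
move=> /andP[x0 x1] /andP[h0 h1] hc; rewrite leNgt; apply/negP => hlt.
have : cos (x + h) < cos T by rewrite ltr_cos ?in_itv /=; [lra|apply/andP; split; lra|apply/andP; split; lra].
by rewrite cos_pihalf; lra.
Qed.

(** The last condition of [in_cone] puts the centre at distance at least [u] from both sides of the
    sector, so the circle stays inside; it misses the origin because x^2 + y^2 = 1 + u^2. *)
Lemma cone_polar x y u h c s : in_cone x y u h -> (c - x) ^+ 2 + (s - y) ^+ 2 = u ^+ 2 ->
  exists n chi, [/\ 0 < n, `|chi| <= T - h, c = n * cos chi & s = n * sin chi].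
Proof.
move=> [xyu /andP[u0 ux] /andP[h0 h1] hc] cs.
have ch0 : 0 <= cos h by apply: cos_ge0_pihalf; apply/andP; split; lra.
have sh0 : 0 <= sin h by apply: sin_ge0_pi; apply/andP; split; lra.
have cs2 := cos2Dsin2 h.
have c0 : 0 <= c.
  have : `|c - x| <= u by rewrite -(ler_pXn2r (n := 2)) ?nnegrE // real_normK ?num_real // -cs; have := sqr_ge0 (s - y); lra.
  by rewrite ler_norml; lra.
(* Cauchy-Schwarz, to be applied to the unit normals of the two sides of the sector. *)
have dot (a b : R) : a ^+ 2 + b ^+ 2 = 1 -> - u <= a * (c - x) + b * (s - y).
  move=> ab; suff : `|a * (c - x) + b * (s - y)| <= u by rewrite ler_norml; lra.
  rewrite -(ler_pXn2r (n := 2)) ?nnegrE // real_normK ?num_real // -cs.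
  rewrite -subr_ge0; have -> : (c - x) ^+ 2 + (s - y) ^+ 2 - (a * (c - x) + b * (s - y)) ^+ 2 =
    (b * (c - x) - a * (s - y)) ^+ 2 + (1 - (a ^+ 2 + b ^+ 2)) * ((c - x) ^+ 2 + (s - y) ^+ 2) by ring.
  by rewrite ab subrr mul0r addr0 sqr_ge0.
have cone : `|s| * sin h <= c * cos h.
  have h1' := dot (cos h) (sin h) cs2.
  have h2' : - u <= cos h * (c - x) + - sin h * (s - y) by apply: dot; rewrite sqrrN.
  have yl : - `|y| <= y <= `|y| by rewrite -ler_norml.
  have [s0|s0] := leP 0 s.
    have : y * sin h <= `|y| * sin h by apply: ler_wpM2r => //; lra.
    by rewrite (ger0_norm s0); lra.
  have : - y * sin h <= `|y| * sin h by apply: ler_wpM2r => //; lra.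
  by rewrite (ltr0_norm s0); lra.
have N0 : 0 < c ^+ 2 + s ^+ 2.
  rewrite lt_neqAle addr_ge0 ?sqr_ge0 // andbT; apply/eqP => N0.
  have cz : c = 0 by nra.
  have sz : s = 0 by nra.
  by move: cs; rewrite cz sz; nra.
set n := Num.sqrt (c ^+ 2 + s ^+ 2).
have n0 : 0 < n by rewrite sqrtr_gt0.
have n2 : n ^+ 2 = c ^+ 2 + s ^+ 2 by rewrite sqr_sqrtr // ltW.
have sn : -1 <= s / n <= 1.
  by rewrite ler_pdivlMr // ler_pdivrMr //; apply/andP; split; nra.
have sK : sin (asin (s / n)) = s / n by apply: asinK; rewrite in_itv.
have cK : cos (asin (s / n)) = c / n.
  rewrite cos_asin //; have -> : 1 - (s / n) ^+ 2 = (c / n) ^+ 2.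
    by rewrite !exprMn exprVn n2; field; rewrite lt0r_neq0.
  by rewrite sqrtr_sqr ger0_norm // divr_ge0 // ltW.
have sE : s = n * sin (asin (s / n)) by rewrite sK mulrC divfK ?lt0r_neq0.
have cE : c = n * cos (asin (s / n)) by rewrite cK mulrC divfK ?lt0r_neq0.
exists n, (asin (s / n)); split=> //.
have a1 := asin_geNpi2 sn; have a2 := asin_lepi2 sn.
apply: cos_ge0_le; [by rewrite normr_ge0 ler_norml a1|by rewrite h0|].
rewrite cosD cos_norm cK.
have -> : sin `|asin (s / n)| = `|s| / n.
  rewrite -[n in RHS](gtr0_norm n0) -normfV -normrM.
  have [a0|a0] := leP 0 (asin (s / n)).
    by rewrite (ger0_norm a0) -[in RHS]sK ger0_norm //; apply: sin_ge0_pi; lra.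
  rewrite (ltr0_norm a0) -[in RHS]sK -[in RHS]normrN -sinN ger0_norm //; apply: sin_ge0_pi; lra.
have -> : c / n * cos h - `|s| / n * sin h = (c * cos h - `|s| * sin h) / n by ring.
by apply: divr_ge0 (ltW n0); lra.
Qed.

(* For a unit [mu = c + i s] and [beta = p2 + q2 mu] this is
   [(p1 + q1 nu) beta = (p1 p2 + q1 conj q2) + (p1 q2 + q1 conj p2) mu], [nu = mu conj beta / beta]. *)
Lemma circle_mul x1 y1 a1 b1 x2 y2 a2 b2 c s u v :
  c ^+ 2 + s ^+ 2 = 1 -> 0 < u ^+ 2 + v ^+ 2 ->
  u = x2 + (a2 * c - b2 * s) -> v = y2 + (a2 * s + b2 * c) ->
  exists c' s', [/\ c' ^+ 2 + s' ^+ 2 = 1,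
    (x1 + (a1 * c' - b1 * s')) * u - (y1 + (a1 * s' + b1 * c')) * v =
    (x1 * x2 - y1 * y2 + a1 * a2 + b1 * b2) + ((x1 * a2 - y1 * b2 + a1 * x2 + b1 * y2) * c
       - (x1 * b2 + y1 * a2 + b1 * x2 - a1 * y2) * s) &
    (x1 + (a1 * c' - b1 * s')) * v + (y1 + (a1 * s' + b1 * c')) * u =
    (x1 * y2 + y1 * x2 + b1 * a2 - a1 * b2) + ((x1 * a2 - y1 * b2 + a1 * x2 + b1 * y2) * s
       + (x1 * b2 + y1 * a2 + b1 * x2 - a1 * y2) * c)].
Proof.
move=> cs N0 uE vE; move: (lt0r_neq0 N0) => {}N0.
exists (((u ^+ 2 - v ^+ 2) * c + 2 * u * v * s) / (u ^+ 2 + v ^+ 2)).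
exists (((u ^+ 2 - v ^+ 2) * s - 2 * u * v * c) / (u ^+ 2 + v ^+ 2)); split.
- transitivity ((u ^+ 2 + v ^+ 2) ^+ 2 * (c ^+ 2 + s ^+ 2) / (u ^+ 2 + v ^+ 2) ^+ 2); first by field.
  by rewrite cs mulr1 mulfV // expf_neq0.
- transitivity (x1 * u - y1 * v + a1 * (u * c + v * s) + b1 * (v * c - u * s)); first by field.
  have -> : u * c + v * s = x2 * c + y2 * s + a2 * (c ^+ 2 + s ^+ 2) by rewrite uE vE; ring.
  have -> : v * c - u * s = y2 * c - x2 * s + b2 * (c ^+ 2 + s ^+ 2) by rewrite uE vE; ring.
  by rewrite cs uE vE; ring.
- transitivity (x1 * v + y1 * u + a1 * (u * s - v * c) + b1 * (u * c + v * s)); first by field.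
  have -> : u * c + v * s = x2 * c + y2 * s + a2 * (c ^+ 2 + s ^+ 2) by rewrite uE vE; ring.
  have -> : u * s - v * c = x2 * s - y2 * c - b2 * (c ^+ 2 + s ^+ 2) by rewrite uE vE; ring.
  by rewrite cs uE vE; ring.
Qed.

Section Product.
Variables (x1 y1 a1 b1 u1 h1 x2 y2 a2 b2 u2 h2 : R).
Hypothesis cone1 : in_cone x1 y1 u1 h1.
Hypothesis cone2 : in_cone x2 y2 u2 h2.
Hypothesis u1E : u1 ^+ 2 = a1 ^+ 2 + b1 ^+ 2.
Hypothesis u2E : u2 ^+ 2 = a2 ^+ 2 + b2 ^+ 2.
Let x := x1 * x2 - y1 * y2 + a1 * a2 + b1 * b2.
Let y := x1 * y2 + y1 * x2 + b1 * a2 - a1 * b2.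
Let a := x1 * a2 - y1 * b2 + a1 * x2 + b1 * y2.
Let b := x1 * b2 + y1 * a2 + b1 * x2 - a1 * y2.

Lemma product_norm : x ^+ 2 + y ^+ 2 = 1 + (a ^+ 2 + b ^+ 2).
Proof.
have [n1 _ _ _] := cone1; have [n2 _ _ _] := cone2; rewrite u1E in n1; rewrite u2E in n2.
have : x ^+ 2 + y ^+ 2 - (a ^+ 2 + b ^+ 2) =
  (x1 ^+ 2 + y1 ^+ 2 - (a1 ^+ 2 + b1 ^+ 2)) * (x2 ^+ 2 + y2 ^+ 2 - (a2 ^+ 2 + b2 ^+ 2)).
  by rewrite /x /y /a /b; ring.
by rewrite n1 n2 !addrK mulr1; lra.
Qed.

(** By [circle_mul] every point of the circle of the product is a product of one point from each
    circle, and arguments add. If the radius is 0, any unit parameter describes the point. *)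
Lemma product_polar c s : (c - x) ^+ 2 + (s - y) ^+ 2 = a ^+ 2 + b ^+ 2 ->
  exists n chi, [/\ 0 < n, `|chi| <= pi - h1 - h2, c = n * cos chi & s = n * sin chi].
Proof.
move=> cs.
have [m [k [mk cE sE]]] : exists m k, [/\ m ^+ 2 + k ^+ 2 = 1, c = x + (a * m - b * k)
    & s = y + (a * k + b * m)].
  have := addr_ge0 (sqr_ge0 a) (sqr_ge0 b); rewrite le_eqVlt => /predU1P[w0|w0].
    move/esym/eqP: w0; rewrite paddr_eq0 ?sqr_ge0 // !sqrf_eq0 => /andP[/eqP az /eqP bz].
    move/eqP: cs; rewrite az bz expr0n addr0 /= paddr_eq0 ?sqr_ge0 // !sqrf_eq0 !subr_eq0.
    by move=> /andP[/eqP -> /eqP ->]; exists 1, 0; split; ring.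
  exists ((a * (c - x) + b * (s - y)) / (a ^+ 2 + b ^+ 2)).
  exists ((a * (s - y) - b * (c - x)) / (a ^+ 2 + b ^+ 2)).
  move: (a) (b) (x) (y) w0 cs => A B X Y /lt0r_neq0 w0 cs; split.
  - transitivity ((A ^+ 2 + B ^+ 2) * ((c - X) ^+ 2 + (s - Y) ^+ 2) / (A ^+ 2 + B ^+ 2) ^+ 2).
      by field.
    by rewrite cs; field.
  - by field.
  - by field.
pose u := x2 + (a2 * m - b2 * k); pose v := y2 + (a2 * k + b2 * m).
have uv2 : (u - x2) ^+ 2 + (v - y2) ^+ 2 = u2 ^+ 2.
  by rewrite u2E -[RHS]mulr1 -mk /u /v; ring.
have [n2 [t2 [n20 ht2 uE vE]]] := cone_polar x2 y2 u2 h2 u v cone2 uv2.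
have uv0 : 0 < u ^+ 2 + v ^+ 2.
  have -> : u ^+ 2 + v ^+ 2 = n2 ^+ 2 * (cos t2 ^+ 2 + sin t2 ^+ 2) by rewrite uE vE; ring.
  by rewrite cos2Dsin2 mulr1 exprn_gt0.
have [m' [k' [mk' cE' sE']]] := circle_mul x1 y1 a1 b1 x2 y2 a2 b2 m k u v mk uv0 erefl erefl.
move: cE' sE'; set u' := x1 + _; set v' := y1 + _ => cE' sE'.
have uv1 : (u' - x1) ^+ 2 + (v' - y1) ^+ 2 = u1 ^+ 2.
  by rewrite u1E -[RHS]mulr1 -mk' /u' /v'; ring.
have [n1 [t1 [n10 ht1 uE' vE']]] := cone_polar x1 y1 u1 h1 u' v' cone1 uv1.
exists (n1 * n2), (t1 + t2); split.
- exact: mulr_gt0.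
- by apply: le_trans (ler_normD _ _) _; rewrite piE; lra.
- by rewrite cE -cE' uE' vE' uE vE cosD; ring.
- by rewrite sE -sE' uE' vE' uE vE sinD; ring.
Qed.

Let w := Num.sqrt (a ^+ 2 + b ^+ 2).
Let C := Num.sqrt (1 + (a ^+ 2 + b ^+ 2)).

(** Since C^2 - w^2 = 1, the tangents from the origin to the circle have length 1 and touch it on
    the unit circle. The argument of the touching point farther from the real axis has absolute
    value [th + atan w], and that point obeys the bound of [product_polar]. *)
Lemma product_angle th : 0 < h1 + h2 -> 0 <= th <= pi -> x = C * cos th ->
  -1 < x /\ th + atan w + h1 + h2 <= pi.
Proof.
move=> h0 /andP[th0 thpi] xE.
have [_ _ /andP[h10 h11] _] := cone1; have [_ _ /andP[h20 h21] _] := cone2.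
have ab0 := addr_ge0 (sqr_ge0 a) (sqr_ge0 b).
have w2 : w ^+ 2 = a ^+ 2 + b ^+ 2 by rewrite sqr_sqrtr.
have C2 : C ^+ 2 = 1 + w ^+ 2 by rewrite sqr_sqrtr ?w2 // addr_ge0.
have w0 : 0 <= w by rewrite sqrtr_ge0.
have C0 : 0 < C by rewrite sqrtr_gt0 ltr_wpDr.
have nE : x ^+ 2 + y ^+ 2 = C ^+ 2 by rewrite product_norm C2 w2.
have xgt : -1 < x.
  rewrite ltNge; apply/negP => xle; have x2' : 0 <= x ^+ 2 - 1 by nra.
  (* For [x <= -1] the circle would meet the negative real axis at [- r], with argument pi, against
     [0 < h1 + h2]. *)
  pose r := - x + Num.sqrt (x ^+ 2 - 1).
  have r0 : 0 < r by rewrite /r ltr_wpDr ?sqrtr_ge0 //; lra.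
  have rE : r ^+ 2 + 2 * x * r + 1 = 0.
    have -> : r ^+ 2 + 2 * x * r + 1 = Num.sqrt (x ^+ 2 - 1) ^+ 2 - (x ^+ 2 - 1) by rewrite /r; ring.
    by rewrite sqr_sqrtr // subrr.
  have [|n [chi [n0 hchi cE sE]]] := product_polar (- r) 0.
    rewrite -w2; nra.
  have chi2 : chi ^+ 2 <= (pi - h1 - h2) ^+ 2 by rewrite -[chi ^+ 2]real_normK ?num_real // ler_pXn2r ?nnegrE // (le_trans _ hchi).
  have s0 : sin chi = 0 by apply/eqP; move/eqP: sE; rewrite eq_sym mulf_eq0 gt_eqF.
  have c0 : cos chi < 0 by rewrite -(pmulr_rlt0 _ n0) -cE oppr_lt0.
  have c1 : cos `|chi| = cos pi by rewrite cos_norm cospi; have := cos2Dsin2 chi; rewrite s0; nra.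
  have : `|chi| = pi.
    by apply: cos_inj c1; rewrite in_itv /=; apply/andP; split => //; lra.
  by lra.
split=> //.
have [cd sd] : C * cos (atan w) = 1 /\ C * sin (atan w) = w.
  have ca : C * cos (atan w) = 1.
    by rewrite cos_atan -C2 sqrtr_sqr gtr0_norm // mulfV // lt0r_neq0.
  split=> //; have ca0 : cos (atan w) != 0 by apply/eqP => z; move: ca; rewrite z; lra.
  by have : tan (atan w) = w := atanK w; rewrite /tan => /(canRL (divfK ca0)) ->; rewrite mulrCA ca mulr1.
have d0 : 0 <= atan w by rewrite -atan0 le_atan.
have d1 : atan w < T := atan_ltpi2 w.
have dl : th < pi - atan w.
  rewrite ltNge; apply/negP => hge.
  have : cos th <= cos (pi - atan w).
    by apply: cos_le_pi; lra.
  by rewrite cosB cospi sinpi mul0r addr0 mulN1r -(ler_pM2l C0) -xE mulrN cd; lra.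
have yE : `|y| = C * sin th.
  have s0 : 0 <= sin th by apply: sin_ge0_pi; lra.
  have : `|y| ^+ 2 = (C * sin th) ^+ 2.
    rewrite real_normK ?num_real // exprMn sin2cos2 mulrBr mulr1 -exprMn -xE; lra.
  move/eqP; rewrite eqrXn2 //; last by apply: mulr_ge0 => //; exact: ltW.
  by move/eqP.
(* The sign of [y] selects the half-plane of the touching point. *)
pose e : R := if 0 <= y then 1 else -1.
have e2 : e ^+ 2 = 1 by rewrite /e; case: ifP => _; ring.
have ey : y = e * (C * sin th).
  rewrite -yE /e; case: leP => [y0|y0]; first by rewrite ger0_norm ?mul1r.
  by rewrite ltr0_norm // mulN1r opprK.
have [|n [chi [n0 hchi cE sE]]] := product_polar (cos (th + atan w)) (e * sin (th + atan w)).
  rewrite ey xE -w2 cosD sinD.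
  move: (cos th) (sin th) (cos2Dsin2 th) => ct st cs1.
  move: (cos (atan w)) (sin (atan w)) (cos2Dsin2 (atan w)) cd sd => cw sw cs2 cd sd.
  transitivity ((ct * cw - st * sw - C * ct) ^+ 2 + e ^+ 2 * (st * cw + ct * sw - C * st) ^+ 2); first by ring.
  rewrite e2 mul1r.
  transitivity ((ct ^+ 2 + st ^+ 2) * ((cw ^+ 2 + sw ^+ 2) + C ^+ 2 - 2 * (C * cw))); first by ring.
  by rewrite cs1 cs2 cd C2; ring.
have n1 : n = 1.
  have : n ^+ 2 = 1.
    have := cos2Dsin2 (th + atan w); have := cos2Dsin2 chi => h3 h4.
    have : cos (th + atan w) ^+ 2 + e ^+ 2 * sin (th + atan w) ^+ 2 = n ^+ 2 * (cos chi ^+ 2 + sin chi ^+ 2).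
      by rewrite -exprMn sE cE; ring.
    by rewrite e2 mul1r h3 h4; lra.
  by move=> h3; nra.
have : cos (th + atan w) = cos `|chi| by rewrite cE n1 mul1r cos_norm.
move/cos_inj => ->; [lra|rewrite in_itv /=; apply/andP; split; lra|].
by rewrite in_itv /=; apply/andP; split => //; lra.
Qed.

End Product.

End Cones.

(** * Cone data of a single factor *)

Section Datum.
Context {R : realType}.
Implicit Types (x y u X Y U D w t h a b s e : R).
Local Notation T := (pi / 2 : R).
Local Notation P := (T ^+ 2 : R).
Local Notation K := (T * expR T).
Local Notation c0 := (@stumpff R 0).
Local Notation c1 := (@stumpff R 1).

Let T0 : 0 < T. Proof. by have /andP[h _] := @pihalf_bounds R; lra. Qed.
Let T1 : T < 377 / 240. Proof. by have /andP[_ h] := @pihalf_bounds R. Qed.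
Let K0 : 0 < K. Proof. by have /andP[h _] := @level_bounds R; lra. Qed.
Let piE : pi = T + T :> R. Proof. by field. Qed.

(** The gap is the value of [h] at which the distance condition of [in_cone] becomes an equality. *)
Lemma gap_cone X Y U : 0 <= X -> 0 <= Y -> 0 <= U ->
  X ^+ 2 + Y ^+ 2 = 1 + U ^+ 2 -> 0 < X * U + Y -> 0 <= gap X Y U -> in_cone X Y U (gap X Y U).
Proof.
move=> X0 Y0 U0 n d g0; have t0 := T0; have pE := piE; have [cg sg] := gap_cos_sin X Y U n d.
have gT : gap X Y U < T := atan_ltpi2 _.
have u1 : 0 < 1 + U ^+ 2 by have := sqr_ge0 U; lra.
have E : U = X * cos (gap X Y U) - `|Y| * sin (gap X Y U).
  rewrite cg sg (ger0_norm Y0).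
  have -> : X * ((X * U + Y) / (1 + U ^+ 2)) - Y * ((X - Y * U) / (1 + U ^+ 2)) =
     U * (X ^+ 2 + Y ^+ 2) / (1 + U ^+ 2) by ring.
  by rewrite n mulfK // lt0r_neq0.
split=> //; [rewrite U0 /=|by rewrite g0 ltW|by rewrite -E].
have s0 : 0 <= sin (gap X Y U) by apply: sin_ge0_pi; lra.
have c1' := cos_le1 (gap X Y U).
rewrite {1}E (ger0_norm Y0).
have : 0 <= Y * sin (gap X Y U) by exact: mulr_ge0.
have : X * cos (gap X Y U) <= X * 1 by apply: ler_wpM2l.
by lra.
Qed.

Lemma in_cone_norm x y u h : in_cone x `|y| u h -> in_cone x y u h.
Proof. by case=> n ux hh hc; split; rewrite ?normr_id in n hc *; rewrite // -n real_normK ?num_real. Qed.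

(* [e] is the angle gained when [a] costs part of the norm; 17 is the rate in [trade_trace]
   and is large enough because [17 * 37 / 100 >= 4 * T]. *)
Definition datum a b s h y e :=
  [/\ in_cone (c0 (b ^+ 2 - s ^+ 2)) (b * c1 (b ^+ 2 - s ^+ 2)) (s * c1 (b ^+ 2 - s ^+ 2)) h,
    0 <= y <= 1 /\ 0 <= e, cvH y + e <= h, 2 * a ^+ 2 <= 17 * e &
    [/\ asinh (s * c1 (b ^+ 2 - s ^+ 2)) <= cvr y, asinh (s * c1 (b ^+ 2 - s ^+ 2)) <= s &
      0 < h \/ [/\ a = 0, s = 0 & `|b| = T]]].

Lemma datum_ex a b s : 0 <= s -> Num.sqrt (a ^+ 2 + b ^+ 2) + s <= T ->
  exists h y e, datum a b s h y e.
Proof.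
move=> s0 hT; have t0 := T0; have t1 := T1; have ab0 := addr_ge0 (sqr_ge0 a) (sqr_ge0 b).
have ab : a ^+ 2 + b ^+ 2 <= (T - s) ^+ 2.
  rewrite -(sqr_sqrtr ab0) ler_pXn2r ?nnegrE ?sqrtr_ge0 //; first by lra.
  by have := sqrtr_ge0 (a ^+ 2 + b ^+ 2); lra.
have sT : s <= T by have := sqrtr_ge0 (a ^+ 2 + b ^+ 2); lra.
have b2 : `|b| ^+ 2 = b ^+ 2 by rewrite real_normK ?num_real.
have b0 := normr_ge0 b; have a20 := sqr_ge0 a.
have bs : `|b| <= T - s.
  by rewrite -(ler_pXn2r (n := 2)) ?nnegrE ?b2 //; lra.
(* A difference of squares: the factor T - s + |b| is at most 2 T, and T - s - |b| is the defect
   that [ray_gap] rewards. *)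
have a2 : 2 * a ^+ 2 <= 17 * (37 / 100 * (T - (`|b| + s))).
  rewrite -b2 in ab.
  have : a ^+ 2 <= (T - s - `|b|) * (T - s + `|b|) by rewrite -subr_sqr; lra.
  have : (T - s - `|b|) * (T - s + `|b|) <= (T - s - `|b|) * (377 / 120) by apply: ler_wpM2l; lra.
  by lra.
(* If [b = s = 0] there is no ray; the circle is the point 1, and the whole angle [h = T] is
   available. *)
have := addr_ge0 b0 s0; rewrite le_eqVlt => /predU1P[m0|m0].
  have sz : s = 0 by lra.
  have bz : b = 0 by apply/eqP; rewrite -normr_eq0; apply/eqP; lra.
  have [_ _ _ _ H0] := @cv0 R; have [_ _ _ r0 _] := @cv0 R.
  exists T, 0, (37 / 100 * T); rewrite /datum sz bz !expr0n !mul0r subrr asinh0 r0 H0.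
  have c00 : c0 0 = 1 by rewrite stumpff0E mul0r subr0.
  split.
  - rewrite c00; split; [by rewrite expr1n|by rewrite lexx ler01|by rewrite lexx ltW|].
    by rewrite cos_pihalf normr0 mulr0 mul0r subrr.
  - by rewrite lexx ler01; split=> //; apply: mulr_ge0; lra.
  - by rewrite add0r; lra.
  - by move: a2; rewrite -m0; lra.
  - by split; [| |left].
pose m := `|b| + s.
have mn := lt0r_neq0 m0; have Tn := lt0r_neq0 T0.
pose y := s / m; pose l := m / T.
have lTy : l * T * y = s by rewrite /l /y divfK // mulrC divfK.
have lTy' : l * T * (1 - y) = `|b| by rewrite mulrBr mulr1 lTy /l divfK // /m; ring.
have hy : 0 <= y <= 1.
  apply/andP; split; first by apply: divr_ge0 => //; exact: ltW.
  by rewrite /y ler_pdivrMr // mul1r /m; lra.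
have l0 : 0 < l by apply: divr_gt0.
have l1 : l <= 1 by rewrite /l ler_pdivrMr // mul1r /m; lra.
have hl : 0 < l <= 1 by rewrite l0.
have hl' : 0 <= l <= 1 by rewrite ltW.
have DE : rayD y l = b ^+ 2 - s ^+ 2.
  by rewrite /rayD -b2 -lTy' -lTy /cvD; ring.
have XE : rayX y l = c0 (b ^+ 2 - s ^+ 2) by rewrite /rayX DE.
have YE : rayY y l = `|b * c1 (b ^+ 2 - s ^+ 2)|.
  by rewrite /rayY lTy' DE normrM (gtr0_norm (x := c1 _)) // -DE; exact: ray_c1_gt0.
have UE : rayU y l = s * c1 (b ^+ 2 - s ^+ 2) by rewrite /rayU lTy DE.
have g := ray_gap y l hy hl; have H0 := cvH_ge0 y hy.
have eE : 37 / 100 * T * (1 - l) = 37 / 100 * (T - (`|b| + s)).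
  by rewrite -mulrA mulrBr mulr1 /l [T * (m / T)]mulrC divfK.
have e0 : 0 <= 37 / 100 * T * (1 - l) by rewrite eE; apply: mulr_ge0; lra.
have /andP[U0 Ur] := rayU_le y l hy hl'.
exists (gap (rayX y l) (rayY y l) (rayU y l)), y, (37 / 100 * T * (1 - l)); split.
- rewrite -XE -UE; apply: in_cone_norm; rewrite -YE.
  apply: gap_cone; [exact: rayX_ge0|by rewrite YE|exact: U0|exact: ray_norm|exact: ray_den|lra].
- by [].
- exact: g.
- by rewrite eE.
- rewrite -UE; split; [by rewrite ler_asinh|by have := asinh_rayU_le y l hy hl'; rewrite lTy|].
  have [s00|s00] := eqVneq s 0; last first.
    left; apply: lt_le_trans g; apply: ltr_wpDr => //; apply: cvH_gt0.
    by case/andP: hy => _ ->; rewrite andbT /y divr_gt0 // lt_neqAle eq_sym s00.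
  have [bT|bT] := eqVneq `|b| T; last first.
    left; apply: lt_le_trans g; apply: ltr_wpDl => //; rewrite eE.
    apply: mulr_gt0; [lra|rewrite subr_gt0 lt_neqAle s00 addr0 bT /=; lra].
  right; split=> //; move: a2; rewrite bT s00 addr0 subrr !mulr0 => a2.
  by apply/eqP; rewrite -sqrf_eq0; apply/eqP; lra.
Qed.

End Datum.

(** * Polar form of the gap, and the chord beyond the family *)

Section Angles.
Context {R : realType}.
Implicit Types (x y u X Y U D w t h a b s e r : R).
Local Notation T := (pi / 2 : R).
Local Notation P := (T ^+ 2 : R).
Local Notation K := (T * expR T).
Local Notation c0 := (@stumpff R 0).
Local Notation c1 := (@stumpff R 1).

Let T0 : 0 < T. Proof. by have /andP[h _] := @pihalf_bounds R; lra. Qed.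
Let K0 : 0 < K. Proof. by have /andP[h _] := @level_bounds R; lra. Qed.
Let piE : pi = T + T :> R. Proof. by field. Qed.

Lemma cosh_cos_atan r : cosh r * cos (atan (sinh r)) = 1 /\ cosh r * sin (atan (sinh r)) = sinh r.
Proof.
have C0 := cosh_gt0 r.
have ca : cosh r * cos (atan (sinh r)) = 1.
  by rewrite cos_atan -cosh2 sqrtr_sqr gtr0_norm // mulfV // lt0r_neq0.
split=> //; have ca0 : cos (atan (sinh r)) != 0.
  by apply/eqP => z; move: ca; rewrite z mulr0; lra.
by have : tan (atan (sinh r)) = sinh r := atanK _; rewrite /tan => /(canRL (divfK ca0)) ->; rewrite mulrCA ca mulr1.
Qed.

Lemma gap_polar X Y r : X ^+ 2 + Y ^+ 2 = 1 + sinh r ^+ 2 -> 0 < X * sinh r + Y ->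
  X = cosh r * sin (atan (sinh r) + gap X Y (sinh r)) /\
  Y = cosh r * cos (atan (sinh r) + gap X Y (sinh r)).
Proof.
move=> n d; have [cg sg] := gap_cos_sin X Y (sinh r) n d.
have [cd sd] := cosh_cos_atan r; have C2 := cosh2 r.
rewrite sinD cosD mulrDr mulrBr !mulrA cd sd cg sg -C2 !mul1r.
have C0 := lt0r_neq0 (cosh_gt0 r).
have S2 : sinh r ^+ 2 = cosh r ^+ 2 - 1 by lra.
split; apply/eqP; rewrite -subr_eq0; apply/eqP.
  transitivity (X * (cosh r ^+ 2 - 1 - sinh r ^+ 2) / cosh r ^+ 2); first by field.
  by rewrite S2 subrr mulr0 mul0r.
transitivity (Y * (cosh r ^+ 2 - 1 - sinh r ^+ 2) / cosh r ^+ 2); first by field.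
by rewrite S2 subrr mulr0 mul0r.
Qed.

(** Half the trace of a product of radius [r] whose angle leaves exactly [slope * r] of pi;
    [chordXE] shows the angle. *)
Definition chordX r := sinh r * sin (slope * r) - cosh r * cos (atan (sinh r)) * cos (slope * r).

Lemma chordXE r : chordX r = cosh r * cos (pi - atan (sinh r) - slope * r).
Proof.
have [cd sd] := cosh_cos_atan r.
by rewrite /chordX -{1}sd -addrA -opprD cosB cospi sinpi mul0r addr0 mulN1r cosD; ring.
Qed.

Lemma slope_lt : slope < 1 / 2 :> R.
Proof.
have [X1 Y1 U1 _] := @cv1 R.
have s1 : 1 < sinh T.
  have : 1 < (T : R) by have /andP[h _] := @pihalf_bounds R; lra.
  have /andP[e1 _] := @expR_pihalf_bounds R; have := expRNE T.
  by rewrite /sinh; move: (expR T) (expR (- T)) e1 => p q e1 e3 _; nra.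
have s0 : 0 < sinh T by lra.
have -> : slope = atan (sinh T)^-1 / T :> R.
  rewrite /slope /cvH /gap X1 Y1 U1 mul0r subr0 addr0 invfM mulrA mulfV ?mul1r //.
  exact: lt0r_neq0 (cosh_gt0 _).
rewrite ltr_pdivrMr // -[X in _ < X](_ : pi / 4 = _); last by field.
by rewrite -atan1 lt_atan // invf_lt1.
Qed.

(** As cosh r * cos (atan (sinh r)) = 1, the function is sinh r * sin (slope r) - cos (slope r).
    [slope < 1 / 2] keeps slope r below pi / 2, where both terms increase. *)
Lemma chordX_incr r r' : 0 <= r -> r < r' -> r' <= pi -> chordX r < chordX r'.
Proof.
move=> r0 rr' r'pi; have s0 : 0 < slope :> R by have := @slope_gt R; lra.
have sl := slope_lt; have t0 := T0; have pE := piE.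
rewrite /chordX !(proj1 (cosh_cos_atan _)) !mul1r.
pose F (r : R) := sinh r * sin (slope * r) - cos (slope * r).
rewrite -/(F r) -/(F r').
apply: (der_incr F (fun r => (cosh r + slope) * sin (slope * r) + slope * sinh r * cos (slope * r)) r r' rr') => x hx.
  rewrite /F.
  have dsin : der (fun r => sin (slope * r)) x (cos (slope * x) * slope).
    by apply: der_eq; [apply: der_sin; apply: der_mul; [exact: der_cst|exact: der_id]|cbv beta; ring].
  have dcos : der (fun r => cos (slope * r)) x (- sin (slope * x) * slope).
    by apply: der_eq; [apply: der_cos; apply: der_mul; [exact: der_cst|exact: der_id]|cbv beta; ring].
  have dsinh : der sinh x (cosh x).
    rewrite /sinh /cosh; der_auto; ring.
  by apply: der_eq; [apply: der_add; [apply: der_mul; [exact: dsinh|exact: dsin]|apply: der_opp; exact: dcos]|cbv beta; ring].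
have x0 : 0 < x by lra.
have sx : 0 < slope * x by exact: mulr_gt0.
have sx' : slope * x < T by have : slope * x < 1 / 2 * x; [rewrite ltr_pM2r|lra].
have si : 0 < sin (slope * x) by apply: sin_gt0_pi; lra.
have co : 0 <= cos (slope * x) by apply: cos_ge0_pihalf; lra.
apply: ltr_pwDl.
  by apply: mulr_gt0 => //; have := cosh_gt0 x; lra.
by apply: mulr_ge0 => //; apply: mulr_ge0; rewrite ?sinh_ge0; exact: ltW.
Qed.

Lemma chordX_T : chordX T = 0.
Proof.
have [X1 Y1 U1 _] := @cv1 R; have h1 : 0 <= (1 : R) <= 1 by rewrite ler01 lexx.
have [ch sh] := gap_cos_sin (cvX 1) (cvY 1) (cvU 1) (cv_norm 1) (cv_gap_den 1 h1).
rewrite -/(cvH 1) X1 Y1 U1 in ch sh.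
rewrite /chordX (proj1 (cosh_cos_atan _)) mul1r /slope divfK ?lt0r_neq0 // ch sh -cosh2.
by field; rewrite lt0r_neq0 ?cosh_gt0.
Qed.

End Angles.

(** * The bound on the logarithm *)

Section Level.
Context {R : realType}.
Implicit Types (x y u X Y U D w t h a b s e r th : R).
Local Notation T := (pi / 2 : R).
Local Notation P := (T ^+ 2 : R).
Local Notation K := (T * expR T).
Local Notation c0 := (@stumpff R 0).
Local Notation c1 := (@stumpff R 1).

Let T0 : 0 < T. Proof. by have /andP[h _] := @pihalf_bounds R; lra. Qed.
Let K0 : 0 < K. Proof. by have /andP[h _] := @level_bounds R; lra. Qed.
Let piE : pi = T + T :> R. Proof. by field. Qed.

Lemma stumpff0_inj_le D D' : D < pi ^+ 2 -> c0 D' <= c0 D -> D <= D'.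
Proof.
move=> hD; apply: contraTT; rewrite -!ltNge => h.
exact: stumpff0_decr h (ltW hD).
Qed.

Lemma stumpff0_cosh_le D r : D < pi ^+ 2 -> c0 D <= cosh r -> - r ^+ 2 <= D.
Proof.
move=> hD; rewrite -stumpff0_cosh; apply: stumpff0_inj_le.
by have := sqr_ge0 r; have := exprn_gt0 2 (pi_gt0 R); lra.
Qed.

(** Some member [y3] of the family has radius exactly [r], and by subadditivity its H is at most the
    sum available. So the angle of i times that member, whose real part is [- cvY y3], is at least
    [th + e], and [cv_level] bounds its logarithm. *)
Lemma short_angle r y1 y2 e th : 0 < r <= T -> 0 <= y1 <= 1 -> 0 <= y2 <= 1 -> 0 <= e -> 0 <= th ->
  r <= cvr y1 + cvr y2 -> th + atan (sinh r) + (cvH y1 + cvH y2) + e <= pi ->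
  exists th2 D2, [/\ th + e <= th2 <= pi, c0 D2 = cosh r * cos th2, D2 < pi ^+ 2 & lev (sinh r) D2 <= K ^+ 2].
Proof.
move=> /andP[r0 rT] hy1 hy2 e0 th0 hr hth.
have [_ _ _ z0 _] := @cv0 R; have [_ _ _ z1] := @cv1 R.
have [y3 hy3 rE] : exists2 y3, 0 <= y3 <= 1 & cvr y3 = r.
  have cc : {within `[0, 1], continuous (@cvr R)}.
    by apply: der_continuous => x _; exact: der_cvr.
  have [|c] := IVT ler01 cc (v := r).
    by rewrite z0 z1 minElt maxElt T0; apply/andP; split => //; exact: ltW.
  by rewrite in_itv /= => hc cE; exists c.
have y30 : 0 < y3 <= 1.
  case/andP: hy3 => h1 ->; rewrite andbT lt_neqAle h1 andbT; apply/eqP => yz.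
  by move: rE r0; rewrite -yz z0 => <-; rewrite ltxx.
have [D3 [D3pi c0E levE]] := cv_level y3 y30.
have sE : sinh r = cvU y3 by rewrite -rE /cvr asinhK.
have [_ YE] : cvX y3 = cosh r * sin (atan (sinh r) + cvH y3) /\ cvY y3 = cosh r * cos (atan (sinh r) + cvH y3).
  by rewrite /cvH -sE; apply: gap_polar; rewrite sE; [exact: cv_norm|exact: cv_gap_den].
have H3 := cvH_subadd y1 y2 y3 hy1 hy2 hy3; rewrite rE in H3; have {}H3 := H3 hr.
have h0 := cvH_ge0 y3 hy3; have d0 : 0 <= atan (sinh r) by rewrite -atan0 le_atan // sinh_ge0 ltW.
exists (pi - (atan (sinh r) + cvH y3)), D3; split=> //.
- by apply/andP; split; lra.
- by rewrite c0E YE cosB cospi sinpi mul0r addr0 mulN1r mulrN.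
- by rewrite sE.
Qed.

(** No member of the family has this radius; each summand is bounded below by its chord instead,
    which gives [slope * r]. A level above [K ^ 2] is refuted by comparison with the point of the
    level curve having the same determinant [D2]. *)
Lemma long_angle r y1 y2 e th : T < r <= pi -> 0 <= y1 <= 1 -> 0 <= y2 <= 1 -> 0 <= e -> 0 <= th ->
  r <= cvr y1 + cvr y2 -> th + atan (sinh r) + (cvH y1 + cvH y2) + e <= pi ->
  exists th2 D2, [/\ th + e <= th2 <= pi, c0 D2 = cosh r * cos th2, D2 < pi ^+ 2 & lev (sinh r) D2 <= K ^+ 2].
Proof.
move=> /andP[rT rpi] hy1 hy2 e0 th0 hr hth; have t0 := T0; have pE := piE.
have r0 : 0 < r by lra.
have s0 : 0 < slope :> R by have := @slope_gt R; lra.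
have chord y : 0 <= y <= 1 -> slope * cvr y <= cvH y.
  by move=> hy; rewrite /slope mulrAC ler_pdivrMr // mulrC [cvH y * _]mulrC; exact: cvH_chord.
have hH : slope * r <= cvH y1 + cvH y2.
  apply: le_trans (_ : slope * (cvr y1 + cvr y2) <= _); first by rewrite ler_pM2l.
  by rewrite mulrDr lerD // chord.
have sr0 : 0 < slope * r by apply: mulr_gt0.
have d0 : 0 < atan (sinh r) by rewrite -atan0 lt_atan // sinh_gt0.
have dT : atan (sinh r) < T := atan_ltpi2 _.
have C0 := cosh_gt0 r; have [cd sd] := cosh_cos_atan r.
have le2 : th + e <= pi - atan (sinh r) - slope * r by lra.
have [D2 D2pi D2E] : exists2 D, D < pi ^+ 2 & c0 D = cosh r * cos (th + e).
  apply: stumpff0_onto; rewrite -cd -mulrN ltr_pM2l //.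
  have -> : - cos (atan (sinh r)) = cos (pi - atan (sinh r)) by rewrite cosB cospi sinpi mul0r addr0 mulN1r.
  by rewrite ltr_cos ?in_itv /=; [lra|apply/andP; split; lra|apply/andP; split; lra].
exists (th + e), D2; split=> //; first by apply/andP; split; lra.
rewrite leNgt; apply/negP => hlt.
have X2 : chordX r <= c0 D2.
  by rewrite chordXE D2E ler_pM2l //; apply: cos_le_pi; lra.
have X0 : 0 < chordX r by have := chordX_incr T r (ltW T0) rT rpi; rewrite chordX_T.
have D2P : D2 <= P.
  apply: stumpff0_inj_le D2pi _; have [-> _] := stumpff_cos_sin T; rewrite cos_pihalf; lra.
have D2r : - r ^+ 2 <= D2.
  by apply: stumpff0_cosh_le D2pi _; rewrite D2E -[X in _ <= X]mulr1 ler_pM2l // cos_le1.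
have D2l : - pi ^+ 2 <= D2.
  by apply: le_trans D2r; rewrite lerN2 ler_pXn2r ?nnegrE ?pi_ge0 // ltW.
have hD : - pi ^+ 2 <= D2 <= P by rewrite D2l.
have c10 := stumpff1_gt0 D2 D2pi.
(* A level above [K ^ 2] at radius [r] means [r' < r]; then c0 D2 <= chordX r' < chordX r <= c0
   D2. *)
pose r' := asinh (lvU D2).
have sE : sinh r' = lvU D2 by rewrite asinhK.
have r'0 : 0 < r' by rewrite -sinh_gt0 sE; exact: lvU_gt0.
have r'r : r' < r.
  rewrite -ltr_sinh sE; move: hlt; rewrite /lev /lvU.
  move: (K) K0 (c1 D2) c10 => k k0 c c00 h.
  have : (k ^+ 2 - D2) < 2 * k * sinh r / c by lra.
  rewrite ltr_pdivlMr // ltr_pdivrMr; last by apply: mulr_gt0 => //; lra.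
  by move=> h2; lra.
have g := lv_gap D2 hD; rewrite -/r' in g.
have [XE _] : lvX D2 = cosh r' * sin (atan (sinh r') + gap (lvX D2) (lvY D2) (sinh r')) /\
    lvY D2 = cosh r' * cos (atan (sinh r') + gap (lvX D2) (lvY D2) (sinh r')).
  by apply: gap_polar; rewrite sE; [exact: lv_norm|exact: lv_den].
rewrite sE in XE; rewrite -sE in XE g.
have gN : - T < gap (lvX D2) (lvY D2) (sinh r') := atan_gtNpi2 _.
have d0' : 0 < atan (sinh r') by rewrite -atan0 lt_atan // sinh_gt0.
have dT' : atan (sinh r') < T := atan_ltpi2 _.
have sr1 : slope * r' < T.
  have : slope * r' < 1 / 2 * r' by rewrite ltr_pM2r // slope_lt.
  by lra.
have X1 : c0 D2 <= chordX r'.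
  rewrite chordXE -/(lvX D2) XE ler_pM2l ?cosh_gt0 //.
  set g0 := gap _ _ _ in g gN *.
  have -> : sin (atan (sinh r') + g0) = cos (T - (atan (sinh r') + g0)).
    by rewrite cosB cos_pihalf sin_pihalf mul0r add0r mul1r.
  by apply: cos_le_pi; lra.
have := chordX_incr r' r (ltW r'0) r'r rpi; lra.
Qed.

Lemma angle_level r y1 y2 e th D t : 0 <= r <= pi -> 0 <= y1 <= 1 -> 0 <= y2 <= 1 -> 0 <= e -> 0 <= th ->
  r <= cvr y1 + cvr y2 -> th + atan (sinh r) + (cvH y1 + cvH y2) + e <= pi ->
  D < pi ^+ 2 -> c0 D = cosh r * cos th -> `|t| <= pi - r -> t ^+ 2 <= 17 * e ->
  - pi ^+ 2 <= D /\ lev (sinh r) D + t ^+ 2 <= K ^+ 2.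
Proof.
move=> /andP[r0 rpi] hy1 hy2 e0 th0 hr hth Dpi DE ht1 ht2.
have C0 := cosh_gt0 r.
have Dr : - r ^+ 2 <= D.
  by apply: stumpff0_cosh_le Dpi _; rewrite DE -[X in _ <= X]mulr1 ler_pM2l // cos_le1.
split; first by apply: le_trans Dr; rewrite lerN2 ler_pXn2r ?nnegrE ?pi_ge0.
move: r0; rewrite le_eqVlt => /predU1P[r0|r0].
  (* Without anticonformal part the level is [D] itself, and 2 pi^2 < K^2 suffices. *)
  rewrite -r0 sinh0 /lev mulr0 mul0r addr0.
  have : t ^+ 2 <= pi ^+ 2.
    by rewrite -[t ^+ 2]real_normK ?num_real // ler_pXn2r ?nnegrE ?pi_ge0 //; lra.
  by have := @pi2_bound R; have /andP[h _] := @sqr_level_bounds R; lra.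
have [th2 [D2 [/andP[h1 h2] D2E D2pi lev2]]] : exists th2 D2, [/\ th + e <= th2 <= pi,
    c0 D2 = cosh r * cos th2, D2 < pi ^+ 2 & lev (sinh r) D2 <= K ^+ 2].
  have [rT|rT] := leP r T.
    by apply: (short_angle r y1 y2 e th) => //; rewrite r0.
  by apply: (long_angle r y1 y2 e th) => //; rewrite rT.
apply: (trade_trace r D D2 th th2 t) => //.
- by rewrite r0.
- rewrite Dr /=; apply: stumpff0_inj_le Dpi _; rewrite D2E DE ler_pM2l //.
  by apply: cos_le_pi; lra.
- lra.
- lra.
Qed.

End Level.

(** * The product of two exponentials *)

Section Core.
Context {R : realType}.
Implicit Types (x y u D w t h a b s e r th p q : R).
Local Notation T := (pi / 2 : R).
Local Notation K := (T * expR T).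
Local Notation c0 := (@stumpff R 0).
Local Notation c1 := (@stumpff R 1).

Let T0 : 0 < T. Proof. by have /andP[h _] := @pihalf_bounds R; lra. Qed.
Let K0 : 0 < K. Proof. by have /andP[h _] := @level_bounds R; lra. Qed.
Let piE : pi = T + T :> R. Proof. by field. Qed.

Lemma norm_triangle a b a' b' m n : 0 <= m -> 0 <= n -> a ^+ 2 + b ^+ 2 = m ^+ 2 ->
  a' ^+ 2 + b' ^+ 2 = n ^+ 2 -> Num.sqrt ((a + a') ^+ 2 + (b + b') ^+ 2) <= m + n.
Proof.
move=> m0 n0 hm hn.
rewrite -(ler_pXn2r (n := 2)) ?nnegrE ?sqrtr_ge0 ?addr_ge0 // sqr_sqrtr ?addr_ge0 ?sqr_ge0 //.
have : a * a' + b * b' <= m * n.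
  apply: le_trans (ler_norm _) _; rewrite -(ler_pXn2r (n := 2)) ?nnegrE ?mulr_ge0 //.
  rewrite real_normK ?num_real // exprMn -hm -hn -subr_ge0.
  have -> : (a ^+ 2 + b ^+ 2) * (a' ^+ 2 + b' ^+ 2) - (a * a' + b * b') ^+ 2 = (a * b' - b * a') ^+ 2 by ring.
  exact: sqr_ge0.
have -> : (a + a') ^+ 2 + (b + b') ^+ 2 = (a ^+ 2 + b ^+ 2) + (a' ^+ 2 + b' ^+ 2) + 2 * (a * a' + b * b') by ring.
by rewrite hm hn sqrrD -mulr_natl; lra.
Qed.

Lemma trace_budget a a' s s' g g1 g2 : a <= T - s -> a' <= T - s' -> g <= g1 + g2 ->
  g1 <= s -> g2 <= s' -> a + a' <= pi - g.
Proof. by move=> *; rewrite piE; lra. Qed.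

Lemma sqr_trace_le a a' e e' : 2 * a ^+ 2 <= 17 * e -> 2 * a' ^+ 2 <= 17 * e' ->
  (a + a') ^+ 2 <= 17 * (e + e').
Proof.
move=> h h'; have -> : (a + a') ^+ 2 = 2 * a ^+ 2 + 2 * a' ^+ 2 - (a - a') ^+ 2 by ring.
by have := sqr_ge0 (a - a'); lra.
Qed.

Lemma angle_budget th g g1 g2 e e' h h' : g1 + e <= h -> g2 + e' <= h' -> th + g + h + h' <= pi ->
  th + g + (g1 + g2) + (e + e') <= pi.
Proof. by move=> *; lra. Qed.

Section Pair.
Variables (a1 b1 p1 q1 a2 b2 p2 q2 : R).
Let s1 := Num.sqrt (p1 ^+ 2 + q1 ^+ 2).
Let s2 := Num.sqrt (p2 ^+ 2 + q2 ^+ 2).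
Hypothesis hA1 : Num.sqrt (a1 ^+ 2 + b1 ^+ 2) + s1 <= T.
Hypothesis hA2 : Num.sqrt (a2 ^+ 2 + b2 ^+ 2) + s2 <= T.
Hypothesis regular : ~ [/\ a1 = 0, s1 = 0, a2 = 0, s2 = 0 & b1 = b2 /\ `|b1| = T].
Let D1 := b1 ^+ 2 - s1 ^+ 2.
Let D2 := b2 ^+ 2 - s2 ^+ 2.
Let x1 := c0 D1. Let y1 := b1 * c1 D1. Let v1 := p1 * c1 D1. Let w1 := q1 * c1 D1.
Let x2 := c0 D2. Let y2 := b2 * c1 D2. Let v2 := p2 * c1 D2. Let w2 := q2 * c1 D2.
Let x := x1 * x2 - y1 * y2 + v1 * v2 + w1 * w2.
Let v := x1 * v2 - y1 * w2 + v1 * x2 + w1 * y2.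
Let w := x1 * w2 + y1 * v2 + w1 * x2 - v1 * y2.

(** The data of the two factors are added: radii by the triangle inequality, traces within [pi - r],
    angles by [product_angle]. [angle_level] turns the sums into the bound on the level. *)
Lemma product_level : -1 < x /\ forall D, D < pi ^+ 2 -> c0 D = x ->
  - pi ^+ 2 <= D /\ lev (Num.sqrt (v ^+ 2 + w ^+ 2)) D + (a1 + a2) ^+ 2 <= K ^+ 2.
Proof.
have t0 := T0; have pE := piE.
have sq a b : 0 <= a ^+ 2 + b ^+ 2 := addr_ge0 (sqr_ge0 a) (sqr_ge0 b).
have s10 : 0 <= s1 by exact: sqrtr_ge0.
have s20 : 0 <= s2 by exact: sqrtr_ge0.
have s1E : s1 ^+ 2 = p1 ^+ 2 + q1 ^+ 2 by rewrite sqr_sqrtr.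
have s2E : s2 ^+ 2 = p2 ^+ 2 + q2 ^+ 2 by rewrite sqr_sqrtr.
have [h1 [z1 [e1 [C1 [hz1 e10] hh1 ha1 [r1c r1s alt1]]]]] := datum_ex a1 b1 s1 s10 hA1.
have [h2 [z2 [e2 [C2 [hz2 e20] hh2 ha2 [r2c r2s alt2]]]]] := datum_ex a2 b2 s2 s20 hA2.
rewrite -/D1 -/x1 -/y1 in C1 r1c r1s; rewrite -/D2 -/x2 -/y2 in C2 r2c r2s.
move: C1 r1c r1s C2 r2c r2s; set u1 := s1 * _; set u2 := s2 * _ => C1 r1c r1s C2 r2c r2s.
have u1E : u1 ^+ 2 = v1 ^+ 2 + w1 ^+ 2 by rewrite /u1 exprMn s1E /v1 /w1; ring.
have u2E : u2 ^+ 2 = v2 ^+ 2 + w2 ^+ 2 by rewrite /u2 exprMn s2E /v2 /w2; ring.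
have [n1 /andP[u10 _] /andP[h10 h1T] _] := C1; have [n2 /andP[u20 _] /andP[h20 h2T] _] := C2.
pose y := x1 * y2 + y1 * x2 + w1 * v2 - v1 * w2.
have nE : x ^+ 2 + y ^+ 2 = 1 + (v ^+ 2 + w ^+ 2).
  exact: (product_norm _ _ _ _ _ _ _ _ _ _ _ _ C1 C2 u1E u2E).
pose W := Num.sqrt (v ^+ 2 + w ^+ 2); pose r := asinh W.
have W0 : 0 <= W by exact: sqrtr_ge0.
have W2 : W ^+ 2 = v ^+ 2 + w ^+ 2 by rewrite sqr_sqrtr.
have rW : sinh r = W by exact: asinhK.
have r0 : 0 <= r by rewrite -sinh_ge0 rW.
have CE : cosh r = Num.sqrt (1 + (v ^+ 2 + w ^+ 2)) by rewrite cosh_asinh W2.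
(* The anticonformal part of the product is p1 q2 + q1 conj p2, where p_i and q_i have moduli cosh
   r_i and sinh r_i; the addition formula of [sinh] gives the claim. *)
have rr : r <= asinh u1 + asinh u2.
  rewrite -ler_sinh rW sinhD !asinhK addrC.
  have -> : W = Num.sqrt ((x1 * v2 - y1 * w2 + (v1 * x2 + w1 * y2)) ^+ 2 + (x1 * w2 + y1 * v2 + (w1 * x2 - v1 * y2)) ^+ 2).
    by rewrite /W /w /v !addrA.
  apply: norm_triangle.
  - by apply: mulr_ge0 => //; exact: ltW (cosh_gt0 _).
  - by apply: mulr_ge0 => //; exact: ltW (cosh_gt0 _).
  - by rewrite exprMn cosh2 asinhK -n1 u2E; ring.
  - by rewrite exprMn cosh2 asinhK -n2 u1E; ring.
have ab1 : `|a1| <= T - s1.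
  apply: le_trans (_ : Num.sqrt (a1 ^+ 2 + b1 ^+ 2) <= _); last by rewrite lerBrDr.
  by rewrite -sqrtr_sqr ler_sqrt // lerDl sqr_ge0.
have ab2 : `|a2| <= T - s2.
  apply: le_trans (_ : Num.sqrt (a2 ^+ 2 + b2 ^+ 2) <= _); last by rewrite lerBrDr.
  by rewrite -sqrtr_sqr ler_sqrt // lerDl sqr_ge0.
have t1' := trace_budget `|a1| `|a2| s1 s2 r _ _ ab1 ab2 rr r1s r2s.
have t1 : `|a1 + a2| <= pi - r := le_trans (ler_normD _ _) t1'.
have t2 := sqr_trace_le a1 a2 e1 e2 ha1 ha2.
(* If [h1 + h2 = 0], both factors are quarter turns, in opposite directions because of [regular];
   the product is the identity and [D = 0]. *)
have [h0|h0] := ltP 0 (h1 + h2); last first.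
  case: alt1 => [h|[az1 sz1 bT1]]; first by have := ltr_wpDr h20 h; rewrite ltNge h0.
  case: alt2 => [h|[az2 sz2 bT2]]; first by have := ltr_wpDl h10 h; rewrite ltNge h0.
  have bn : b1 <> b2 by move=> bb; apply: regular; split.
  have b12 : b2 = - b1.
    have : b2 ^+ 2 = b1 ^+ 2 by rewrite -[b2 ^+ 2]real_normK ?num_real // bT2 -bT1 real_normK ?num_real.
    by move/eqP; rewrite eqf_sqr => /orP[/eqP bb|/eqP//]; case: bn.
  have [p1z q1z] : p1 = 0 /\ q1 = 0.
    by move: s1E; rewrite sz1 expr0n => /esym/eqP; rewrite paddr_eq0 ?sqr_ge0 // !sqrf_eq0 => /andP[/eqP ? /eqP ?].
  have [p2z q2z] : p2 = 0 /\ q2 = 0.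
    by move: s2E; rewrite sz2 expr0n => /esym/eqP; rewrite paddr_eq0 ?sqr_ge0 // !sqrf_eq0 => /andP[/eqP ? /eqP ?].
  have DE : D2 = D1 by rewrite /D1 /D2 sz1 sz2 b12 sqrrN.
  have xE : x = 1.
    rewrite /x /x1 /x2 /y1 /y2 /v1 /v2 /w1 /w2 p1z p2z q1z q2z DE b12.
    rewrite -(stumpff_cos2_sin2 D1).
    have D1E : D1 = b1 ^+ 2 by rewrite /D1 sz1 expr0n subr0.
    by move: (c0 D1) (c1 D1) => A B; rewrite D1E; ring.
  have vE : v = 0 by rewrite /v /v1 /v2 /w1 /w2 p1z p2z q1z q2z; ring.
  have wE : w = 0 by rewrite /w /v1 /v2 /w1 /w2 p1z p2z q1z q2z; ring.
  rewrite xE; split; first exact: lt_trans (ltrN10 R) ltr01.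
  move=> D Dpi DE'.
  have c00 : c0 0 = 1 by rewrite stumpff0E mul0r subr0.
  have pi0 : 0 < pi ^+ 2 :> R by rewrite exprn_gt0 ?pi_gt0.
  have D0 : D = 0.
    by apply/eqP; rewrite eq_le; apply/andP; split; apply: stumpff0_inj_le => //; rewrite DE' c00.
  rewrite D0 vE wE az1 az2 addr0 expr0n /= !addr0 sqrtr0 /lev mulr0 mul0r !addr0; split; first by rewrite oppr_le0 ltW.
  exact: sqr_ge0.
have C0 := cosh_gt0 r.
have xC : -1 <= x / cosh r <= 1.
  have : x ^+ 2 <= cosh r ^+ 2 by rewrite cosh2 rW W2 -nE lerDl sqr_ge0.
  rewrite -[x ^+ 2]real_normK ?num_real // ler_pXn2r ?nnegrE //; last exact: ltW.
  rewrite ler_norml => /andP[g1 g2].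
  by rewrite ler_pdivlMr // ler_pdivrMr // mulN1r mul1r g1.
pose th := acos (x / cosh r).
have thI : 0 <= th <= pi by rewrite acos_ge0 // acos_lepi.
have thE : cosh r * cos th = x by rewrite /th acosK ?in_itv // mulrC divfK // lt0r_neq0.
have [xgt ang] : -1 < x /\ th + atan W + h1 + h2 <= pi.
  by apply: (product_angle _ _ _ _ _ _ _ _ _ _ _ _ C1 C2 u1E u2E th h0 thI); rewrite -CE thE.
split=> // D Dpi DE; rewrite -/W -rW; case/andP: thI => th0 _.
apply: (angle_level r z1 z2 (e1 + e2) th D (a1 + a2)) => //.
- by rewrite r0 -subr_ge0 (le_trans _ t1) ?normr_ge0.
- exact: addr_ge0.
- exact: le_trans rr (lerD r1c r2c).
- by rewrite rW; exact: angle_budget hh1 hh2 ang.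
- by rewrite DE thE.
Qed.

End Pair.
End Core.

(** * Real 2 by 2 matrices *)

Section Expm.
Context {R : realType}.
Implicit Types (a b p q x y v w t D : R).
Local Notation c0 := (@stumpff R 0).
Local Notation c1 := (@stumpff R 1).

(* Coefficients of [(a + J)^n] on [1] and [J] when [J^2 = - D]. *)
Definition powcoef a D n : R * R :=
  iter n (fun z => (a * z.1 - D * z.2, a * z.2 + z.1)) (1, 0).

Lemma powcoef_bound a D n :
  `|(powcoef a D n).1| + `|(powcoef a D n).2| <= 1 * (`|a| + `|D| + 1) ^+ n.
Proof.
elim: n => [|n IH]; first by rewrite /= normr1 normr0 addr0 mul1r expr0.
rewrite mul1r in IH *; rewrite exprS /=; move: (powcoef a D n) IH => [z1 z2] /= IH.
have m0 : 0 <= `|a| + `|D| + 1 by rewrite !addr_ge0.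
rewrite mul1r; apply: le_trans (ler_wpM2l m0 IH).
have h1 := ler_normD (a * z1) (- (D * z2)); have h2 := ler_normD (a * z2) z1.
rewrite normrN !normrM in h1 h2.
have := normr_ge0 z1; have := normr_ge0 z2; have := normr_ge0 a; have := normr_ge0 D.
by move: (`|z1|) (`|z2|) (`|a|) (`|D|) h1 h2 => r1 r2 r3 r4; nra.
Qed.

Let bound1 a D n : `|(powcoef a D n).1| <= 1 * (`|a| + `|D| + 1) ^+ n.
Proof. by apply: le_trans (powcoef_bound a D n); rewrite lerDl. Qed.

Let bound2 a D n : `|(powcoef a D n).2| <= 1 * (`|a| + `|D| + 1) ^+ n.
Proof. by apply: le_trans (powcoef_bound a D n); rewrite lerDr. Qed.

(** With J^2 = - D, the functions conserved in [E1] and [E2] are the coordinates of exp(- a x) (U +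
    V J) (C - S J), where C + S J is exp(x J). At x = 1 this system is solved for U and V. *)
Lemma egf_powcoef a D :
  egf (fun n => (powcoef a D n).1) 1 = expR a * c0 D /\
  egf (fun n => (powcoef a D n).2) 1 = expR a * c1 D.
Proof.
set U := egf _; set V := egf (fun n => (powcoef a D n).2).
have dU x : der U x (a * U x - D * V x).
  have := is_derive_egf _ _ _ x (bound1 a D).
  have -> : (fun n => (powcoef a D n.+1).1) = (fun n => a * (powcoef a D n).1 + - D * (powcoef a D n).2).
    by apply/funext => n /=; rewrite mulNr.
  by rewrite (egf_lin _ _ _ _ _ _ a (- D) x (bound1 a D) (bound2 a D)) mulNr.
have dV x : der V x (a * V x + U x).
  have := is_derive_egf _ _ _ x (bound2 a D).
  have -> : (fun n => (powcoef a D n.+1).2) = (fun n => a * (powcoef a D n).2 + 1 * (powcoef a D n).1).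
    by apply/funext => n /=; rewrite mul1r.
  by rewrite (egf_lin _ _ _ _ _ _ a 1 x (bound2 a D) (bound1 a D)) mul1r.
pose C x := c0 (x ^+ 2 * D); pose S x := x * c1 (x ^+ 2 * D).
have dC x : der C x (- D * S x) by rewrite /C /S; der_auto; field.
have dS x : der S x (C x).
  rewrite /S /C; der_auto.
  have h0 := stumpff0E (x ^+ 2 * D); have h1 := stumpff1E (x ^+ 2 * D).
  rewrite [in RHS]h0; move: h1; move: (c1 _) (stumpff 2 _) (stumpff 3 _) => z1 z2 z3 ->; by field.
have dE x : der (fun z => expR (- (a * z))) x (- a * expR (- (a * x))).
  by apply: der_eq; [apply: der_expR; apply: der_opp; apply: der_mul; [exact: der_cst|exact: der_id]|cbv beta; ring].
have E1 : expR (- (a * 1)) * (U 1 * C 1 + D * (V 1 * S 1)) = expR (- (a * 0)) * (U 0 * C 0 + D * (V 0 * S 0)).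
  apply: (der0_cst (fun x => expR (- (a * x)) * (U x * C x + D * (V x * S x)))) => x.
  apply: der_eq.
    apply: der_mul; [exact: dE|apply: der_add; [apply: der_mul; [exact: dU|exact: dC]|]].
    by apply: der_mul; [exact: der_cst|apply: der_mul; [exact: dV|exact: dS]].
  by cbv beta; ring.
have E2 : expR (- (a * 1)) * (V 1 * C 1 - U 1 * S 1) = expR (- (a * 0)) * (V 0 * C 0 - U 0 * S 0).
  apply: (der0_cst (fun x => expR (- (a * x)) * (V x * C x - U x * S x))) => x.
  apply: der_eq.
    apply: der_mul; [exact: dE|apply: der_add; [apply: der_mul; [exact: dV|exact: dC]|]].
    by apply: der_opp; apply: der_mul; [exact: dU|exact: dS].
  by cbv beta; ring.
have U0 : U 0 = 1 by rewrite /U egf0.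
have V0 : V 0 = 0 by rewrite /V egf0.
have C0 : C 0 = 1 by rewrite /C expr0n /= mul0r stumpff0 invr1.
have z0 : expR (- (a * 0)) = 1 by rewrite mulr0 oppr0 expR0.
have S0 : S 0 = 0 by rewrite /S mul0r.
have C1 : C 1 = c0 D by rewrite /C expr1n mul1r.
have S1 : S 1 = c1 D by rewrite /S expr1n !mul1r.
rewrite z0 U0 V0 C0 S0 C1 S1 mulr1 in E1; rewrite z0 U0 V0 C0 S0 C1 S1 mulr1 in E2.
have cs := stumpff_cos2_sin2 D.
have ea : expR a * expR (- a) = 1 by rewrite -expRD subrr expR0.
have {}E1 : U 1 * c0 D + D * (V 1 * c1 D) = expR a.
  by have := congr1 ( *%R (expR a)) E1; rewrite mulrA ea mul1r => ->; ring.
have {}E2 : V 1 * c0 D - U 1 * c1 D = 0.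
  by have := congr1 ( *%R (expR a)) E2; rewrite mulrA ea mul1r => ->; ring.
split.
  transitivity (U 1 * (c0 D ^+ 2 + D * c1 D ^+ 2)); first by rewrite cs mulr1.
  rewrite -E1; transitivity ((U 1 * c0 D + D * (V 1 * c1 D)) * c0 D - D * c1 D * (V 1 * c0 D - U 1 * c1 D)); first by ring.
  by rewrite E2; ring.
transitivity (V 1 * (c0 D ^+ 2 + D * c1 D ^+ 2)); first by rewrite cs mulr1.
rewrite -E1; transitivity ((U 1 * c0 D + D * (V 1 * c1 D)) * c1 D + c0 D * (V 1 * c0 D - U 1 * c1 D)); first by ring.
by rewrite E2; ring.
Qed.

Lemma expm_quadratic (J : 'M[R]_2) a D : J * J = - D *: 1 ->
  expm (a *: 1 + J) = (expR a * c0 D) *: 1 + (expR a * c1 D) *: J.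
Proof.
move=> J2; have [EU EV] := egf_powcoef a D.
pose U n := \sum_(k < n) (k`!%:R)^-1 * (powcoef a D k).1.
pose V n := \sum_(k < n) (k`!%:R)^-1 * (powcoef a D k).2.
have powE n : (a *: 1 + J) ^+ n = (powcoef a D n).1 *: 1 + (powcoef a D n).2 *: J.
  elim: n => [|n IH]; first by rewrite expr0 /= scale0r addr0 scale1r.
  rewrite exprSr IH /=; move: (powcoef a D n) => [z1 z2] /=.
  rewrite mulrDl !mulrDr -!scalerAl -!scalerAr !mulr1 !mul1r J2 !scalerA.
  rewrite [X in _ + X]addrC addrACA -!scalerDl; congr (_ *: _ + _ *: _); ring.
have sumE n : \sum_(k < n) (k`!%:R)^-1 *: (a *: 1 + J) ^+ k = U n *: 1 + V n *: J.
  rewrite /U /V !scaler_suml -big_split; apply: eq_bigr => k _.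
  by rewrite powE scalerDr !scalerA.
have cU : U n @[n --> \oo] --> expR a * c0 D.
  rewrite -EU; have := is_cvg_egf _ _ _ 1 (bound1 a D); rewrite /egf /pseries seriesEord.
  suff -> : [sequence \sum_(k < n) ((powcoef a D k).1 / k`!%:R * 1 ^+ k)]_n = U by [].
  by apply/funext => n; apply: eq_bigr => k _; rewrite expr1n mulr1 mulrC.
have cV : V n @[n --> \oo] --> expR a * c1 D.
  rewrite -EV; have := is_cvg_egf _ _ _ 1 (bound2 a D); rewrite /egf /pseries seriesEord.
  suff -> : [sequence \sum_(k < n) ((powcoef a D k).2 / k`!%:R * 1 ^+ k)]_n = V by [].
  by apply/funext => n; apply: eq_bigr => k _; rewrite expr1n mulr1 mulrC.
rewrite /expm; apply: (@cvg_lim 'M[R]_2); first exact: norm_hausdorff.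
under eq_fun do rewrite sumE.
by apply: cvgD; apply: cvgZr_tmp.
Qed.

End Expm.

(** * Complex coordinates: products, exponential, operator norm, spectrum *)

Section Matrices.
Context {R : realType}.
Implicit Types (a b p q x y v w t D : R).
Local Notation c0 := (@stumpff R 0).
Local Notation c1 := (@stumpff R 1).

(* The real-linear map [z |-> (x + i y) z + (p + i q) conj z] of the complex plane. *)
Definition cmx x y p q : 'M[R]_2 :=
  \matrix_(i < 2, j < 2)
    (if i == 0 then (if j == 0 then x + p else q - y) else (if j == 0 then q + y else x - p)).

Lemma mx2P (A B : 'M[R]_2) : A 0 0 = B 0 0 -> A 0 1 = B 0 1 -> A 1 0 = B 1 0 -> A 1 1 = B 1 1 -> A = B.
Proof.
move=> h00 h01 h10 h11; apply/matrixP => i j.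
have two (k : 'I_2) : k = 0 \/ k = 1.
  by case: k => [[|[|//]] hk]; [left|right]; apply/val_inj.
by case: (two i) => ->; case: (two j) => ->.
Qed.

Lemma cmx_ex (A : 'M[R]_2) : exists x y p q, A = cmx x y p q.
Proof.
exists ((A 0 0 + A 1 1) / 2), ((A 1 0 - A 0 1) / 2), ((A 0 0 - A 1 1) / 2), ((A 1 0 + A 0 1) / 2).
by apply: mx2P; rewrite mxE /=; field.
Qed.

Lemma cmx_inj x y p q x' y' p' q' : cmx x y p q = cmx x' y' p' q' ->
  [/\ x = x', y = y', p = p' & q = q'].
Proof.
move=> h; have e i j : cmx x y p q i j = cmx x' y' p' q' i j by rewrite h.
have := e 0 0; have := e 0 1; have := e 1 0; have := e 1 1.
by rewrite !mxE /= => h1 h2 h3 h4; split; lra.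
Qed.

Lemma cmxM x1 y1 p1 q1 x2 y2 p2 q2 :
  cmx x1 y1 p1 q1 *m cmx x2 y2 p2 q2 =
  cmx (x1 * x2 - y1 * y2 + p1 * p2 + q1 * q2) (x1 * y2 + y1 * x2 + q1 * p2 - p1 * q2)
    (x1 * p2 - y1 * q2 + p1 * x2 + q1 * y2) (x1 * q2 + y1 * p2 + q1 * x2 - p1 * y2).
Proof. by apply: mx2P; rewrite mxE !big_ord_recl big_ord0 !mxE /=; ring. Qed.

Lemma cmxZ a x y p q : a *: cmx x y p q = cmx (a * x) (a * y) (a * p) (a * q).
Proof. by apply: mx2P; rewrite !mxE /=; ring. Qed.

Lemma cmxD x1 y1 p1 q1 x2 y2 p2 q2 :
  cmx x1 y1 p1 q1 + cmx x2 y2 p2 q2 = cmx (x1 + x2) (y1 + y2) (p1 + p2) (q1 + q2).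
Proof. by apply: mx2P; rewrite !mxE /=; ring. Qed.

Lemma cmx1 : 1 = cmx 1 0 0 0.
Proof. by apply: mx2P; rewrite !mxE /=; ring. Qed.

Lemma expm_cmx a b p q : let D := b ^+ 2 - (p ^+ 2 + q ^+ 2) in
  expm (cmx a b p q) = expR a *: cmx (c0 D) (b * c1 D) (p * c1 D) (q * c1 D).
Proof.
move=> D; have -> : cmx a b p q = a *: 1 + cmx 0 b p q.
  by rewrite cmx1 cmxZ cmxD; congr cmx; ring.
rewrite (expm_quadratic _ _ D); last first.
  by rewrite -mulmxE cmxM cmx1 cmxZ /D; congr cmx; ring.
by rewrite cmx1 !cmxZ cmxD; congr cmx; ring.
Qed.

(** [sup] takes a default value on empty and on unbounded sets; an upper bound that is attained
    excludes both. *)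
Lemma sup_max (S : set R) m : ubound S m -> S m -> sup S = m.
Proof.
move=> ub Sm; apply/eqP; rewrite eq_le; apply/andP; split.
  by apply: ge_sup => //; exists m.
by apply: ub_le_sup => //; exists m.
Qed.

Let sq a b : 0 <= a ^+ 2 + b ^+ 2 := addr_ge0 (sqr_ge0 a) (sqr_ge0 b).

Lemma enormE (v : 'cV[R]_2) : enorm v = Num.sqrt (v 0 0 ^+ 2 + v 1 0 ^+ 2).
Proof. by rewrite /enorm !big_ord_recl big_ord0 addr0; congr (Num.sqrt (_ + v _ _ ^+ 2)); apply/val_inj. Qed.

Lemma half_angle a b : a ^+ 2 + b ^+ 2 = 1 ->
  exists c s, [/\ c ^+ 2 + s ^+ 2 = 1, c ^+ 2 - s ^+ 2 = a & 2 * c * s = b].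
Proof.
move=> ab; have a1 : -1 <= a <= 1 by rewrite -ler_norml -(ler_pXn2r (n := 2)) ?nnegrE // real_normK ?num_real // expr1n -ab lerDl sqr_ge0.
case/andP: a1 => a1 a2.
have c2 : Num.sqrt ((1 + a) / 2) ^+ 2 = (1 + a) / 2 by rewrite sqr_sqrtr //; lra.
have s2 : Num.sqrt ((1 - a) / 2) ^+ 2 = (1 - a) / 2 by rewrite sqr_sqrtr //; lra.
move: (Num.sqrt ((1 + a) / 2)) (Num.sqrt ((1 - a) / 2)) c2 s2 => c s c2 s2.
have : (2 * c * s) ^+ 2 == b ^+ 2.
  apply/eqP; have -> : (2 * c * s) ^+ 2 = 4 * (c ^+ 2 * s ^+ 2) by ring.
  have -> : b ^+ 2 = 1 - a ^+ 2 by rewrite -ab; ring.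
  by rewrite c2 s2; field.
rewrite eqf_sqr => /orP[/eqP h|/eqP h]; [exists c, s|exists c, (- s)]; split.
- by rewrite c2 s2; field.
- by rewrite c2 s2; field.
- by [].
- by rewrite sqrrN c2 s2; field.
- by rewrite sqrrN c2 s2; field.
- by rewrite mulrN h opprK.
Qed.

(** The triangle inequality is an equality at a unit z for which (x + i y) z and (p + i q) conj z
    have the same direction. *)
Lemma opnorm_cmx x y p q : opnorm (cmx x y p q) = Num.sqrt (x ^+ 2 + y ^+ 2) + Num.sqrt (p ^+ 2 + q ^+ 2).
Proof.
set m := Num.sqrt (x ^+ 2 + y ^+ 2); set n := Num.sqrt (p ^+ 2 + q ^+ 2).
have m2 : m ^+ 2 = x ^+ 2 + y ^+ 2 by rewrite sqr_sqrtr.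
have n2 : n ^+ 2 = p ^+ 2 + q ^+ 2 by rewrite sqr_sqrtr.
have m0 : 0 <= m by exact: sqrtr_ge0.
have n0 : 0 <= n by exact: sqrtr_ge0.
have coordE (v : 'cV[R]_2) (c := v 0 0) (s := v 1 0) : enorm (cmx x y p q *m v) =
    Num.sqrt ((x * c - y * s + (p * c + q * s)) ^+ 2 + (y * c + x * s + (q * c - p * s)) ^+ 2).
  rewrite enormE !mxE !big_ord_recl !big_ord0 !mxE /= -/(v 0 0).
  have -> : v (lift ord0 ord0) 0 = s by congr (v _ _); apply/val_inj.
  by congr (Num.sqrt (_ ^+ 2 + _ ^+ 2)); rewrite /c; ring.
apply: sup_max.
  move=> _ [v /= hv <-]; rewrite coordE.
  rewrite enormE in hv; move: (v 0 0) (v 1 0) hv => c s hv.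
  apply: le_trans (_ : m * Num.sqrt (c ^+ 2 + s ^+ 2) + n * Num.sqrt (c ^+ 2 + s ^+ 2) <= _).
    apply: norm_triangle.
    - by apply: mulr_ge0 => //; exact: sqrtr_ge0.
    - by apply: mulr_ge0 => //; exact: sqrtr_ge0.
    - by rewrite exprMn m2 sqr_sqrtr //; ring.
    - by rewrite exprMn n2 sqr_sqrtr //; ring.
  by rewrite -mulrDl -[X in _ <= X]mulr1 ler_wpM2l // addr_ge0.
(* With z = c + i s, the real part of (x + i y) conj (p + i q) z^2 must equal its modulus;
   [half_angle] extracts the square root z. *)
have [c [s [cs1 cs2]]] : exists c s, c ^+ 2 + s ^+ 2 = 1 /\
    (x * p + y * q) * (c ^+ 2 - s ^+ 2) + (x * q - y * p) * (2 * c * s) = m * n.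
  have [mn0|mn0] := eqVneq (m * n) 0.
    exists 1, 0; rewrite mn0; split; first by ring.
    have : (x * p + y * q) ^+ 2 + (x * q - y * p) ^+ 2 = (m * n) ^+ 2 by rewrite exprMn m2 n2; ring.
    rewrite mn0 expr0n /= => /eqP; rewrite paddr_eq0 ?sqr_ge0 // !sqrf_eq0 => /andP[/eqP -> /eqP ->].
    by ring.
  have /andP[mN nN] : (m != 0) && (n != 0) by rewrite -negb_or -mulf_eq0.
  have [|c [s [h1 h2 h3]]] := half_angle ((x * p + y * q) / (m * n)) ((x * q - y * p) / (m * n)).
    have -> : ((x * p + y * q) / (m * n)) ^+ 2 + ((x * q - y * p) / (m * n)) ^+ 2 =
      ((x ^+ 2 + y ^+ 2) * (p ^+ 2 + q ^+ 2)) / (m * n) ^+ 2 by field; rewrite mN nN.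
    by rewrite -m2 -n2 -exprMn mulfV // expf_neq0.
  exists c, s; split=> //; rewrite h2 h3.
  transitivity ((x ^+ 2 + y ^+ 2) * (p ^+ 2 + q ^+ 2) / (m * n)); first by field; rewrite mN nN.
  by rewrite -m2 -n2 -exprMn expr2 mulfK.
exists (\col_(i < 2) (if i == 0 then c else s)) => /=.
  by rewrite enormE !mxE /= cs1 sqrtr1.
rewrite coordE !mxE /=.
have -> : (x * c - y * s + (p * c + q * s)) ^+ 2 + (y * c + x * s + (q * c - p * s)) ^+ 2 = (m + n) ^+ 2.
  transitivity ((m ^+ 2 + n ^+ 2) * (c ^+ 2 + s ^+ 2) + 2 * (m * n)); last by rewrite cs1; ring.
  by rewrite -cs2 m2 n2; ring.
by rewrite sqrtr_sqr ger0_norm // addr_ge0.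
Qed.

Lemma char_poly_cmx x y p q : char_poly (cmx x y p q) =
  'X^2 - (2 * x) *: 'X + (x ^+ 2 + (y ^+ 2 - (p ^+ 2 + q ^+ 2)))%:P.
Proof.
rewrite /char_poly /char_poly_mx (expand_det_row _ 0) !big_ord_recl big_ord0 addr0.
rewrite /cofactor !det_mx11 !mxE /=.
rewrite /bump /= addn0 expr0 expr1 !mulr1n !mulr0n -mul_polyC.
rewrite !expr2 !(polyCD, polyCB, polyCN, polyCM) polyC1.
ring.
Qed.

Lemma eigenvalueC_cmx x y p q u v : eigenvalueC (cmx x y p q) (Complex u v) <->
  (u - x) ^+ 2 + (y ^+ 2 - (p ^+ 2 + q ^+ 2)) = v ^+ 2 /\ (u - x) * v = 0.
Proof.
rewrite /eigenvalueC char_poly_cmx -[map_poly _ _]/(map_poly (real_complex R) _).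
rewrite rmorphD rmorphB /= map_polyXn map_polyZ map_polyX map_polyC /= rootE.
rewrite !(hornerD, hornerN, hornerXn, hornerZ, hornerX, hornerC) expr2; simpc.
rewrite eq_complex /=; split.
  by move=> /andP[/eqP h1 /eqP h2]; split; lra.
by move=> [h1 h2]; apply/andP; split; apply/eqP; lra.
Qed.

(** For D = y^2 - (p^2 + q^2) the eigenvalues are x + i sqrt D and x - i sqrt D when D >= 0, and
    real otherwise. *)
Lemma principal_log_cmx (M : 'M[R]_2) x y p q : is_principal_log M (cmx x y p q) <->
  expm (cmx x y p q) = M /\ y ^+ 2 - (p ^+ 2 + q ^+ 2) < pi ^+ 2.
Proof.
have pi0 := pi_gt0 R.
split=> -[eM h]; split=> //.
  rewrite ltNge; apply/negP => hD; set D := _ - _ in hD.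
  have D0 : 0 <= D by apply: le_trans hD; exact: sqr_ge0.
  have ev : eigenvalueC (cmx x y p q) (Complex x (Num.sqrt D)).
    by rewrite eigenvalueC_cmx subrr expr0n /= add0r mul0r sqr_sqrtr.
  have /andP[_] := h _ ev.
  by rewrite /= ltNge -[X in X <= _](ger0_norm (ltW pi0)) -sqrtr_sqr ler_sqrt // hD.
move=> [u v] /eigenvalueC_cmx[h1 h2] /=; rewrite -ltr_norml -(ltr_pXn2r (n := 2)) ?nnegrE // ?ltW //.
rewrite real_normK ?num_real // -h1.
move/eqP: h2; rewrite mulf_eq0 => /orP[/eqP ->|/eqP v0]; first by rewrite expr0n add0r.
by rewrite h1 v0 expr0n /= exprn_gt0.
Qed.

End Matrices.

(** * Existence and norm of principal logarithms *)

Section Logs.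
Context {R : realType}.
Implicit Types (a b p q x y v w t D : R).
Local Notation T := (pi / 2 : R).
Local Notation K := (T * expR T).
Local Notation c0 := (@stumpff R 0).
Local Notation c1 := (@stumpff R 1).

Let T0 : 0 < T. Proof. by have /andP[h _] := @pihalf_bounds R; lra. Qed.
Let K0 : 0 < K. Proof. by have /andP[h _] := @level_bounds R; lra. Qed.

Let sq a b : 0 <= a ^+ 2 + b ^+ 2 := addr_ge0 (sqr_ge0 a) (sqr_ge0 b).

Lemma principal_log_ex t x y v w : x ^+ 2 + y ^+ 2 = 1 + (v ^+ 2 + w ^+ 2) -> -1 < x ->
  exists X, is_principal_log (expR t *: cmx x y v w) X.
Proof.
move=> n x1; have [D Dpi DE] := stumpff0_onto x x1.
have c10 := stumpff1_gt0 D Dpi; have c1n := lt0r_neq0 c10.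
exists (cmx t (y / c1 D) (v / c1 D) (w / c1 D)); rewrite principal_log_cmx.
have -> : (y / c1 D) ^+ 2 - ((v / c1 D) ^+ 2 + (w / c1 D) ^+ 2) = D.
  have cs := stumpff_cos2_sin2 D; rewrite DE in cs.
  transitivity ((y ^+ 2 - (v ^+ 2 + w ^+ 2)) / c1 D ^+ 2); first by field.
  have -> : y ^+ 2 - (v ^+ 2 + w ^+ 2) = D * c1 D ^+ 2 by lra.
  by rewrite mulfK // expf_neq0.
split=> //; rewrite expm_cmx.
have -> : (y / c1 D) ^+ 2 - ((v / c1 D) ^+ 2 + (w / c1 D) ^+ 2) = D.
  have cs := stumpff_cos2_sin2 D; rewrite DE in cs.
  transitivity ((y ^+ 2 - (v ^+ 2 + w ^+ 2)) / c1 D ^+ 2); first by field.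
  have -> : y ^+ 2 - (v ^+ 2 + w ^+ 2) = D * c1 D ^+ 2 by lra.
  by rewrite mulfK // expf_neq0.
by rewrite DE !divfK.
Qed.

Lemma principal_log_le t x y v w X : x ^+ 2 + y ^+ 2 = 1 + (v ^+ 2 + w ^+ 2) ->
  (forall D, D < pi ^+ 2 -> c0 D = x ->
     - pi ^+ 2 <= D /\ lev (Num.sqrt (v ^+ 2 + w ^+ 2)) D + t ^+ 2 <= K ^+ 2) ->
  is_principal_log (expR t *: cmx x y v w) X -> opnorm X <= K.
Proof.
move=> n hlev; have [t' [y' [p' [q' ->]]]] := cmx_ex X.
rewrite principal_log_cmx expm_cmx !cmxZ; set D := _ - _ => -[/cmx_inj[ex ey ev ew] Dpi].
have c10 := stumpff1_gt0 D Dpi; have c1n := lt0r_neq0 c10.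
(* Comparison of determinants, which are the squares of these exponentials. *)
have tE : expR t' = expR t.
  have : expR t' ^+ 2 = expR t ^+ 2.
    transitivity (expR t' ^+ 2 * (c0 D ^+ 2 + D * c1 D ^+ 2)); first by rewrite stumpff_cos2_sin2 mulr1.
    transitivity ((expR t' * c0 D) ^+ 2 + (expR t' * (y' * c1 D)) ^+ 2
       - ((expR t' * (p' * c1 D)) ^+ 2 + (expR t' * (q' * c1 D)) ^+ 2)).
      by move: (c0 D) (c1 D) => z0 z1; rewrite /D; ring.
    rewrite ex ey ev ew; transitivity (expR t ^+ 2 * (x ^+ 2 + y ^+ 2 - (v ^+ 2 + w ^+ 2))); first by ring.
    by rewrite n addrK mulr1.
  by move/eqP; rewrite eqrXn2 ?expR_ge0 // => /eqP.
have e0 : expR t != 0 := lt0r_neq0 (expR_gt0 t).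
rewrite tE in ex ey ev ew; rewrite (expR_inj tE).
move/(mulfI e0): ex => ex; move/(mulfI e0): ey => ey; move/(mulfI e0): ev => ev; move/(mulfI e0): ew => ew.
have [D1 hl] := hlev D Dpi ex.
rewrite opnorm_cmx; set m := Num.sqrt (p' ^+ 2 + q' ^+ 2).
have m0 : 0 <= m by exact: sqrtr_ge0.
have m2 : m ^+ 2 = p' ^+ 2 + q' ^+ 2 by rewrite sqr_sqrtr.
have WE : Num.sqrt (v ^+ 2 + w ^+ 2) = m * c1 D.
  rewrite -ev -ew; have -> : (p' * c1 D) ^+ 2 + (q' * c1 D) ^+ 2 = (m * c1 D) ^+ 2 by rewrite [RHS]exprMn m2; ring.
  by rewrite sqrtr_sqr ger0_norm // mulr_ge0 // ltW.
have {}hl : D + 2 * K * m + t ^+ 2 <= K ^+ 2.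
  move: hl; rewrite /lev WE; have -> // : 2 * K * (m * c1 D) / c1 D = 2 * K * m.
  by move: (K) (c1 D) c1n => k c cn; field.
have yD : y' ^+ 2 = D + m ^+ 2 by rewrite m2 /D; ring.
have pK : pi ^+ 2 <= K ^+ 2 by have := @pi2_bound R; have /andP[h _] := @sqr_level_bounds R; lra.
have t2 := sqr_ge0 t.
have mK : m <= K.
  have : 2 * K * m <= 2 * K * K by lra.
  by rewrite ler_pM2l // mulr_gt0.
(* The norm is sqrt (t^2 + y'^2) + m; since y'^2 = D + m^2, [hl] says t^2 + y'^2 <= (K - m)^2. *)
rewrite -lerBrDr -(ler_pXn2r (n := 2)) ?nnegrE ?sqrtr_ge0 ?subr_ge0 // sqr_sqrtr // yD.
by move: (K) hl => k hl; lra.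
Qed.

Lemma Itil_cmx b : b *: Itil R = cmx 0 b 0 0.
Proof. by apply: mx2P; rewrite !mxE /=; ring. Qed.

End Logs.

Theorem theorem9p2 (R : realType) :
  let admissible (A B : 'M[R]_2) :=
    [/\ opnorm A <= pi / 2, opnorm B <= pi / 2 &
        ~ ((A = (pi / 2) *: Itil R /\ B = (pi / 2) *: Itil R) \/
           (A = - (pi / 2) *: Itil R /\ B = - (pi / 2) *: Itil R))] in
  (forall A B : 'M[R]_2, admissible A B ->
     exists X : 'M[R]_2, is_principal_log (expm A *m expm B) X) /\
  sup [set opnorm X | X in [set X : 'M[R]_2 | exists A B : 'M[R]_2,
          admissible A B /\ is_principal_log (expm A *m expm B) X]]
    = pi / 2 * expR (pi / 2).
Proof.
move=> admissible; have T0 : 0 < pi / 2 :> R by rewrite divr_gt0 ?pi_gt0.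
have prod A B : admissible A B -> exists t x y v w,
    [/\ expm A *m expm B = expR t *: cmx x y v w, x ^+ 2 + y ^+ 2 = 1 + (v ^+ 2 + w ^+ 2), -1 < x &
      forall D, D < pi ^+ 2 -> stumpff 0 D = x ->
        - pi ^+ 2 <= D /\ lev (Num.sqrt (v ^+ 2 + w ^+ 2)) D + t ^+ 2 <= (pi / 2 * expR (pi / 2)) ^+ 2].
  have [a1 [b1 [p1 [q1 ->]]]] := cmx_ex A; have [a2 [b2 [p2 [q2 ->]]]] := cmx_ex B.
  move=> [hA hB reg]; rewrite !opnorm_cmx in hA hB.
  have sq0 (p q : R) : Num.sqrt (p ^+ 2 + q ^+ 2) = 0 -> p = 0 /\ q = 0.
    move/eqP; rewrite sqrtr_eq0 => h; have : p ^+ 2 + q ^+ 2 == 0 by rewrite eq_le h addr_ge0 ?sqr_ge0.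
    by rewrite paddr_eq0 ?sqr_ge0 // !sqrf_eq0 => /andP[/eqP -> /eqP ->].
  (* The sign of the common rotation part decides which of the two excluded pairs would occur. *)
  have reg' : ~ [/\ a1 = 0, Num.sqrt (p1 ^+ 2 + q1 ^+ 2) = 0, a2 = 0,
      Num.sqrt (p2 ^+ 2 + q2 ^+ 2) = 0 & b1 = b2 /\ `|b1| = pi / 2].
    move=> [az1 /sq0[pz1 qz1] az2 /sq0[pz2 qz2] [bb hb]]; apply: reg.
    rewrite !Itil_cmx az1 pz1 qz1 az2 pz2 qz2 -bb.
    have [b0|b0] := leP 0 b1; [left|right].
      by rewrite -hb ger0_norm.
    by rewrite -hb ltr0_norm // opprK.
  have [xgt hl] := product_level a1 b1 p1 q1 a2 b2 p2 q2 hA hB reg'.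
  have s1E : Num.sqrt (p1 ^+ 2 + q1 ^+ 2) ^+ 2 = p1 ^+ 2 + q1 ^+ 2 by rewrite sqr_sqrtr // addr_ge0 ?sqr_ge0.
  have s2E : Num.sqrt (p2 ^+ 2 + q2 ^+ 2) ^+ 2 = p2 ^+ 2 + q2 ^+ 2 by rewrite sqr_sqrtr // addr_ge0 ?sqr_ge0.
  rewrite s1E s2E in xgt hl.
  do 5 eexists; split; [| |exact: xgt|exact: hl].
    rewrite !expm_cmx -scalemxAl -scalemxAr scalerA -expRD cmxM.
    reflexivity.
  have := stumpff_cos2_sin2 (b1 ^+ 2 - (p1 ^+ 2 + q1 ^+ 2)).
  have := stumpff_cos2_sin2 (b2 ^+ 2 - (p2 ^+ 2 + q2 ^+ 2)).
  move: (stumpff 0 _) (stumpff 1 _) (stumpff 0 _) (stumpff 1 _) => x1 y1 x2 y2 h2 h1.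
  apply/eqP; rewrite -subr_eq0; apply/eqP.
  transitivity ((x1 ^+ 2 + (b1 ^+ 2 - (p1 ^+ 2 + q1 ^+ 2)) * y1 ^+ 2) *
    (x2 ^+ 2 + (b2 ^+ 2 - (p2 ^+ 2 + q2 ^+ 2)) * y2 ^+ 2) - 1); first by ring.
  by rewrite h1 h2 mulr1 subrr.
split=> [A B /prod[t [x [y [v [w [-> n xgt _]]]]]]|]; first exact: principal_log_ex.
apply: sup_max => /=.
  move=> _ [X [A [B [/prod[t [x [y [v [w [-> n _ hl]]]]]] hX]]] <-].
  exact: principal_log_le n hl hX.
have [cT sT] := stumpff_cos_sin (pi / 2 : R); rewrite cos_pihalf in cT; rewrite sin_pihalf in sT.
have ch := stumpff0_cosh (pi / 2 : R); have sh := stumpff1_sinh (pi / 2 : R).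
(* The product of exp(T Itil) = i and z |-> cosh T z + sinh T conj z has parts i cosh T and i sinh
   T. Its determinant parameter is T^2, where [c1] equals 1 / T, so the logarithm multiplies both
   parts by T. *)
exists (cmx 0 (pi / 2 * cosh (pi / 2)) (0 : R) (pi / 2 * sinh (pi / 2))); last first.
  rewrite opnorm_cmx !expr0n /= !add0r !sqrtr_sqr !ger0_norm.
  - by rewrite -mulrDr /cosh /sinh; congr (_ * _); field.
  - by apply: mulr_ge0; [exact: ltW|rewrite sinh_ge0 ltW].
  - by apply: mulr_ge0; [exact: ltW|exact: ltW (cosh_gt0 _)].
exists (cmx 0 (pi / 2) 0 0), (cmx 0 0 (pi / 2) 0); split.
  split.
  - by rewrite opnorm_cmx !expr0n /= !add0r sqrtr0 addr0 sqrtr_sqr ger0_norm // ltW.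
  - by rewrite opnorm_cmx !expr0n /= !addr0 sqrtr0 add0r sqrtr_sqr ger0_norm // ltW.
  - rewrite !Itil_cmx => -[[_]|[_]] /cmx_inj[_ h _ _]; lra.
rewrite principal_log_cmx.
have DE : (pi / 2 * cosh (pi / 2)) ^+ 2 - (0 ^+ 2 + (pi / 2 * sinh (pi / 2)) ^+ 2) = (pi / 2) ^+ 2 :> R.
  move: (pi / 2) (cosh (pi / 2)) (sinh (pi / 2)) (cosh2 (pi / 2 : R)) => k c s h.
  transitivity (k ^+ 2 * (c ^+ 2 - s ^+ 2)); first by ring.
  by rewrite h addrK mulr1.
rewrite DE; split; last first.
  by rewrite ltr_pXn2r ?nnegrE ?pi_ge0 ?(ltW T0) // ltr_pdivrMr //; have := pi_gt0 R; lra.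
rewrite !expm_cmx DE.
have -> : (pi / 2) ^+ 2 - (0 ^+ 2 + 0 ^+ 2) = (pi / 2) ^+ 2 :> R by move: (pi / 2) => k; ring.
have -> : 0 ^+ 2 - ((pi / 2) ^+ 2 + 0 ^+ 2) = - (pi / 2) ^+ 2 :> R by move: (pi / 2) => k; ring.
rewrite expR0 !scale1r cmxM cT ch sT sh !mul0r; congr cmx.
- ring.
- by rewrite mulrAC sT; ring.
- ring.
- by rewrite mulrAC sT; ring.
Qed.
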